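(* Let $d = d(n)$ be positive integers with $d = o(n^{1/3})$ as $n \to \infty$, and let $p = \binom{n}{d}$. For each $n$, let $m = m(n)$ be a positive integer and let $X = X^{(p)}$ be a $p \times m$ random matrix whose columns are independent and each follow the random tensor model of degree $d$ (each column generated from its own random vector in $\mathbb{R}^n$). Assume that $p/m \to \lambda \in (0,\infty)$ as $n \to \infty$, and that the entries of the underlying random vectors $x \in \mathbb{R}^n$ have uniformly bounded fourth moments (uniformly in $n$ and in the column). Then, with probability $1$, the empirical spectral distribution of $W = \frac{1}{m}XX^\mathsf{T}$ converges weakly to the Marchenko-Pastur distribution with parameter $\lambda$.
   Context: Random tensor model of degree $d$: let $x = (x_1,\dots,x_n) \in \mathbb{R}^n$ have independent entries with $\mathbb{E}x_i = 0$ and $\mathbb{E}x_i^2 = 1$. The random vector ${\bm{x}} \in \mathbb{R}^{\binom{n}{d}}$ has entries indexed by $d$-element subsets $\mathbf{i} = \{i_1,\dots,i_d\} \subset [n]$, given by ${\bm{x}}_{\mathbf{i}} = \prod_{i \in \mathbf{i}} x_i = x_{i_1}\cdots x_{i_d}$; we say ${\bm{x}}$ follows the random tensor model. (Note the fourth moment assumption concerns only the entries of $x$, not those of ${\bm{x}}$.) Empirical spectral distribution of a symmetric $p\times p$ matrix $W$: $F^W(x) = \frac{1}{p}\#\{i : \lambda_i(W) \le x\}$. Marchenko-Pastur distribution with parameter $\lambda\in(0,\infty)$: with $\lambda_\pm = (1\pm\sqrt{\lambda})^2$ and $f_\lambda(x) = \frac{1}{2\pi \lambda x}\sqrt{[(\lambda_+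 - x)(x-\lambda_-)]_+}$, it is the distribution with density $f_\lambda$ if $\lambda\le 1$, and for $\lambda>1$ the distribution consisting of a point mass $1-1/\lambda$ at $0$ plus the absolutely continuous part with density $f_\lambda$. *)

(* Defs.v *)
From HB Require Import structures.
From mathcomp Require Import all_boot all_order all_algebra.
From mathcomp Require Import all_classical all_reals all_analysis.
From mathcomp Require Import polyrcf.
Set Implicit Arguments. Unset Strict Implicit. Unset Printing Implicit Defensive.
Import Order.TTheory GRing.Theory Num.Theory numFieldNormedType.Exports.
Local Open Scope classical_set_scope.
Local Open Scope ring_scope.

Definition mutually_independent {d} {T : measurableType d} {R : realType}
  (P : probability T R) {I : finType} (X : I -> T -> R) : Prop :=
  forall (J : {set I}) (B : I -> set R), (forall i, measurable (B i)) ->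
  P (\bigcap_(i in [set i | i \in J]) (X i @^-1` B i)) =
  (\prod_(i in J) P (X i @^-1` B i))%E.

Definition dsubsets (n k : nat) : {set {set 'I_n}} := [set A : {set 'I_n} | #|A| == k].

(* p x m matrix whose j-th column is the degree-k tensor of the vector x j . :
   entry (A, j) = prod_{i in A} x_{j i}, rows indexed by the k-subsets A of [n]
   (enumerated via enum_val; #|dsubsets n k| = 'C(n, k)). *)
Definition tensor_mx (R : comNzRingType) (n k m : nat) (x : 'I_m -> 'I_n -> R)
  : 'M[R]_(#|dsubsets n k|, m) :=
  \matrix_(a < #|dsubsets n k|, j < m)
     \prod_(i in (enum_val a : {set 'I_n})) x j i.

Definition eig_count {R : realType} {p : nat} (W : 'M[R]_p) (t : R) : nat :=
  \sum_(r <- rootsR (char_poly W) | r <= t) mup r (char_poly W).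

Definition esd {R : realType} {p : nat} (W : 'M[R]_p) (t : R) : R :=
  (eig_count W t)%:R / p%:R.

Definition mp_density {R : realType} (lam t : R) : R :=
  let lp := (1 + Num.sqrt lam) ^+ 2 in
  let lm := (1 - Num.sqrt lam) ^+ 2 in
  (2 * pi * lam * t)^-1 * Num.sqrt (Num.max 0 ((lp - t) * (t - lm))).

Definition mp_cdf {R : realType} (lam t : R) : R :=
  (if (1 < lam) && (0 <= t) then 1 - lam^-1 else 0) +
  fine (\int[lebesgue_measure]_(s in `]-oo, t]) (mp_density lam s)%:E)%E.

Definition cdf_weak_cvg {R : realType} (F : nat -> R -> R) (G : R -> R) : Prop :=
  forall t : R, {for t, continuous G} -> (fun n => F n t) @ \oo --> G t.

(* Main.v *)
Require Import Defs.
From HB Require Import structures.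
From mathcomp Require Import all_boot all_order all_algebra.
From mathcomp Require Import all_classical all_reals all_analysis.
From mathcomp Require Import polyrcf complex.
From mathcomp Require Import measurable_realfun zify ring lra.
Import Order.TTheory GRing.Theory Num.Theory numFieldNormedType.Exports.
Local Open Scope classical_set_scope.
Local Open Scope ring_scope.
Local Open Scope ereal_scope.
Local Open Scope ring_scope.
Set Implicit Arguments.
Unset Strict Implicit.
Unset Printing Implicit Defensive.

(** Write s_n(t) for the normalized trace of the resolvent (t + W)^-1 at a real
    t >= 1; working at negative spectral parameters keeps everything real.
    Removing one column at a time (Sherman-Morrison) shows that 1 - t s_n is
    m/p times the average over the columns of q / (1 + q), where q is 1/m times
    the quadratic form of the removed tensor column in the resolvent of the
    other columns. The variance of q is bounded by a Schur test on the
    covariance of the products x_I x_J: the fourth moments and d^3 = o(n) make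
    its row sums o(p). Hence q is close to its conditional mean, and E s_n
    approaches the positive root of 1 - t s = s / (1 + lam s), which is stable
    under perturbation. Replacing one column moves the trace by at most 1/t, so
    bounded differences give a summable fourth-moment bound and almost sure
    convergence of s_n(t) at the countably many points t = 1 + 1/k. The same
    root is the Stieltjes transform of the Marchenko-Pastur law, computed from
    an arcsine primitive. Partial fractions then give convergence of the
    integrals of all polynomials in y = 1/(1+x), among which 1 - (1 - y^N)^M
    approximates indicator functions of half-lines; this yields the convergence
    of distribution functions. *)

(** * Resolvents of positive semidefinite matrices *)

(** The cube in d^3 = o(n) comes from the row sums of the covariance. Fix index sets I, J and sum
    the bound on E[x_I x_J x_A x_B] over A and B. Relative to binom(n, d), an element of A \ B
    together with one of B \ A costs a factor d/(n - d). The two differences have the same size, so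
    this factor can be split evenly, charging y = sqrt(d/(n - d)) to every single element. The
    constraint linking the two sets then disappears, and the sum factorizes over coordinates into
    about d factors 1 + O(y). It is controlled by d y = sqrt(d^3/(n - d)). The other obstacle is
    conditioning on all columns but one. Instead of conditional expectations, a block of coordinates
    is redrawn from a second copy of the probability space, which is justified by comparing joint
    laws on measurable boxes. Spectral points stay at t >= 1 because the stability of the root and
    the effect of one column on the trace then both have constant 1. *)

Section Resolvent.
Variable R : realFieldType.

Definition quadf p (A : 'M[R]_p) (v : 'cV[R]_p) : R := (v^T *m A *m v) 0 0.

Definition psdmx p (W : 'M[R]_p) : Prop :=
  W^T = W /\ forall v, 0 <= quadf W v.

Definition resolvent p (t : R) (W : 'M[R]_p) : 'M[R]_p := invmx (W + t%:M).

Lemma dotE p (v : 'cV[R]_p) : (v^T *m v) 0 0 = \sum_i v i 0 ^+ 2.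
Proof. by rewrite mxE; apply: eq_bigr => i _; rewrite mxE expr2. Qed.

Lemma dot_ge0 p (v : 'cV[R]_p) : 0 <= (v^T *m v) 0 0.
Proof. by rewrite dotE sumr_ge0 // => i _; rewrite sqr_ge0. Qed.

Lemma dot_eq0 p (v : 'cV[R]_p) : (v^T *m v) 0 0 = 0 -> v = 0.
Proof.
rewrite dotE => /eqP; rewrite psumr_eq0; last by move=> i _; rewrite sqr_ge0.
move=> /allP v0; apply/matrixP => i j; rewrite ord1 mxE.
by have := v0 i (mem_index_enum _); rewrite sqrf_eq0 => /eqP.
Qed.

Lemma quadfD p (A B : 'M[R]_p) v : quadf (A + B) v = quadf A v + quadf B v.
Proof. by rewrite /quadf mulmxDr mulmxDl mxE. Qed.

Lemma quadfZ p a (A : 'M[R]_p) v : quadf (a *: A) v = a * quadf A v.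
Proof. by rewrite /quadf -scalemxAr -scalemxAl mxE. Qed.

Lemma quadf_scalar p t (v : 'cV[R]_p) : quadf t%:M v = t * (v^T *m v) 0 0.
Proof. by rewrite /quadf mul_mx_scalar -scalemxAl mxE. Qed.

Lemma quadf_sum p m (A : 'I_m -> 'M[R]_p) (Q : pred 'I_m) v :
  quadf (\sum_(i | Q i) A i) v = \sum_(i | Q i) quadf (A i) v.
Proof.
rewrite (big_morph (fun A => quadf A v) (id1 := 0) (op1 := +%R)) //.
- by move=> ? ?; rewrite quadfD.
- by rewrite /quadf mulmx0 mul0mx mxE.
Qed.

Lemma quadf_rank1 p (u v : 'cV[R]_p) : quadf (u *m u^T) v = ((u^T *m v) 0 0) ^+ 2.
Proof.
rewrite /quadf mulmxA -mulmxA mxE big_ord1 expr2; congr (_ * _).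
by rewrite -[in RHS](trmxK v) -trmx_mul [in RHS]mxE.
Qed.

Lemma quadf_rank1_ge0 p (u v : 'cV[R]_p) : 0 <= quadf (u *m u^T) v.
Proof. by rewrite quadf_rank1 sqr_ge0. Qed.

Lemma psdmx_sum_rank1 p m (c : R) (Q : pred 'I_m) (u : 'I_m -> 'cV[R]_p) :
  0 <= c -> psdmx (c *: \sum_(k | Q k) u k *m (u k)^T).
Proof.
move=> c0; split; last first.
  move=> v; rewrite quadfZ quadf_sum mulr_ge0 // sumr_ge0 // => k _.
  exact: quadf_rank1_ge0.
rewrite linearZ /= raddf_sum /=; congr (_ *: _).
by apply: eq_bigr => k _; rewrite trmx_mul trmxK.
Qed.

Section fixed.
Variables (p : nat) (t : R) (W : 'M[R]_p).
Hypotheses (t0 : 0 < t) (psdW : psdmx W).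

Local Notation Rs := (resolvent t W).

Lemma resolvent_unit : W + t%:M \in unitmx.
Proof.
rewrite -row_free_unit; apply: inj_row_free => v v0; apply: trmx_inj.
rewrite trmx0; apply: dot_eq0; apply/eqP; rewrite eq_le dot_ge0 andbT.
have : quadf (W + t%:M) v^T = 0 by rewrite /quadf trmxK v0 mul0mx mxE.
rewrite quadfD quadf_scalar => /eqP; rewrite addr_eq0 => /eqP Wv.
have := psdW.2 v^T; rewrite Wv oppr_ge0 pmulr_rle0 //.
Qed.

Lemma resolventV : Rs *m (W + t%:M) = 1%:M.
Proof. by rewrite mulVmx // resolvent_unit. Qed.

Lemma resolventVr : (W + t%:M) *m Rs = 1%:M.
Proof. by rewrite mulmxV // resolvent_unit. Qed.

Lemma resolvent_unique B : (W + t%:M) *m B = 1%:M -> B = Rs.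
Proof. by move=> h; rewrite -[B]mul1mx -resolventV -mulmxA h mulmx1. Qed.

Lemma resolvent_sym : Rs^T = Rs.
Proof. by rewrite /resolvent trmx_inv linearD /= tr_scalar_mx psdW.1. Qed.

Lemma quadf_resolvent v :
  quadf Rs v = quadf W (Rs *m v) + t * ((Rs *m v)^T *m (Rs *m v)) 0 0.
Proof.
rewrite -quadf_scalar -quadfD /quadf trmx_mul resolvent_sym -!mulmxA.
by rewrite (mulmxA (W + _)) resolventVr mul1mx.
Qed.

Lemma quadf_resolvent_ge v : t * ((Rs *m v)^T *m (Rs *m v)) 0 0 <= quadf Rs v.
Proof. by rewrite quadf_resolvent lerDr psdW.2. Qed.

Lemma quadf_resolvent_ge0 v : 0 <= quadf Rs v.
Proof. by apply: le_trans (quadf_resolvent_ge v); rewrite mulr_ge0 ?dot_ge0 // ltW. Qed.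

Lemma quadf_delta A i : quadf A (delta_mx i 0 : 'cV[R]_p) = A i i.
Proof. by rewrite /quadf trmx_delta -rowE -colE !mxE. Qed.

(** The matrix inequality t R^2 <= R, read at a basis vector. It is the source of both the diagonal
    bound 1/t and the Frobenius bound, without diagonalization. *)
Lemma resolvent_diag i : t * \sum_j Rs i j ^+ 2 <= Rs i i.
Proof.
have := quadf_resolvent_ge (delta_mx i 0); rewrite quadf_delta -colE dotE.
move=> h; apply: le_trans h; rewrite ler_pM2l //; apply: ler_sum => j _.
by rewrite mxE -[in X in X <= _]resolvent_sym mxE.
Qed.

Lemma resolvent_diag_ge0 i : 0 <= Rs i i.
Proof. by have := quadf_resolvent_ge0 (delta_mx i 0); rewrite quadf_delta. Qed.

Lemma resolvent_diag_le i : Rs i i <= t^-1.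
Proof.
have h : t * (Rs i i) ^+ 2 <= Rs i i.
  apply: le_trans (resolvent_diag i); rewrite ler_pM2l //.
  by rewrite (bigD1 i) //= lerDl sumr_ge0 // => j _; rewrite sqr_ge0.
have := resolvent_diag_ge0 i; rewrite le_eqVlt => /orP[/eqP <-|r0].
  by rewrite invr_ge0 ltW.
by rewrite -(ler_pM2l t0) mulfV ?gt_eqF // -(ler_pM2r r0) mul1r -mulrA -expr2.
Qed.

Lemma resolvent_tr_ge0 : 0 <= \tr Rs.
Proof. by apply: sumr_ge0 => i _; exact: resolvent_diag_ge0. Qed.

Lemma resolvent_tr_le : \tr Rs <= p%:R / t.
Proof.
rewrite /mxtrace (le_trans (ler_sum _ (fun i _ => resolvent_diag_le i))) //.
by rewrite sumr_const card_ord mulr_natl.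
Qed.

(** The order is p and not p^2: together with covariance row sums o(p), this gives a variance o(p^2)
    for the quadratic form, hence o(1) after division by m. *)
Lemma resolvent_frob : \sum_i \sum_j Rs i j ^+ 2 <= p%:R / t ^+ 2.
Proof.
rewrite expr2 invfM mulrA; apply: le_trans (_ : \tr Rs / t <= _); last first.
  by rewrite ler_pM2r ?invr_gt0 // resolvent_tr_le.
rewrite ler_pdivlMr // mulrC mulr_sumr; apply: ler_sum => i _.
exact: resolvent_diag.
Qed.

Lemma resolvent_tr_mul : \tr (W *m Rs) = p%:R - t * \tr Rs.
Proof.
apply/eqP; rewrite eq_sym subr_eq -[t * _]mxtraceZ -mul_scalar_mx -linearD /=.
by rewrite -mulmxDl resolventVr mxtrace1.
Qed.

End fixed.

Section rank_one.
Variables (p : nat) (t : R) (W : 'M[R]_p) (c : R) (v : 'cV[R]_p).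
Hypotheses (t0 : 0 < t) (psdW : psdmx W) (c0 : 0 <= c).
Local Notation Rs := (resolvent t W).
Local Notation q := (quadf Rs v).
Local Notation W' := (W + c *: (v *m v^T)).

Lemma psdmx_rank1_update : psdmx W'.
Proof.
split; first by rewrite linearD linearZ /= trmx_mul trmxK psdW.1.
by move=> w; rewrite quadfD quadfZ addr_ge0 ?psdW.2 // mulr_ge0 ?quadf_rank1_ge0.
Qed.

Lemma rank1_denom_gt0 : 0 < 1 + c * q.
Proof. by rewrite ltr_wpDr // mulr_ge0 // quadf_resolvent_ge0. Qed.

(** The candidate is multiplied by [W' + t%:M] and identified by uniqueness of the inverse. With u =
    R v one has (W + t) u = v and v^T u = q, so every correction term is a multiple of v v^T R and
    the coefficients cancel. *)
Lemma sherman_morrison :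
  resolvent t W' = Rs - (c / (1 + c * q)) *: (Rs *m v *m (v^T *m Rs)).
Proof.
pose u := Rs *m v.
have Bu : (W + t%:M) *m u = v by rewrite mulmxA resolventVr // mul1mx.
have vu : v^T *m u = q%:M by rewrite [LHS]mx11_scalar /quadf mulmxA.
have d0 := lt0r_neq0 rank1_denom_gt0.
apply/esym/(resolvent_unique t0 psdmx_rank1_update).
rewrite addrAC mulmxDl !mulmxBr resolventVr // -!scalemxAr -/u.
rewrite (mulmxA (W + _) u) Bu -!scalemxAl (mulmxA (v *m v^T) u) -(mulmxA v v^T u).
rewrite vu mul_mx_scalar -!scalemxAl !mulmxA !scalerA -!addrA -[RHS]addr0.
congr (_ + _).
rewrite -!scaleNr -!scalerDl -[RHS](scale0r (v *m v^T *m Rs)); congr (_ *: _).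
by rewrite /GRing.scale /=; field.
Qed.

Lemma quadf_rank1_update : quadf (resolvent t W') v = q / (1 + c * q).
Proof.
have d0 := lt0r_neq0 rank1_denom_gt0.
rewrite sherman_morrison quadfD -scaleNr quadfZ.
have -> : quadf (Rs *m v *m (v^T *m Rs)) v = q ^+ 2.
  rewrite /quadf !mulmxA -[_ *m v^T *m Rs *m v]mulmxA -mulmxA mxE big_ord1.
  by rewrite !mulmxA expr2.
by field.
Qed.

(** The difference equals c |R v|^2 / (1 + c q), and t |R v|^2 <= q by [quadf_resolvent_ge]. The
    bound is uniform in v, which is what makes bounded differences applicable to unbounded
    entries. *)
Lemma tr_rank1_update : 0 <= \tr Rs - \tr (resolvent t W') <= t^-1.
Proof.
have d0 := rank1_denom_gt0.
rewrite sherman_morrison linearB /= opprB addrC subrK linearZ /= mxtrace_mulC.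
set z := \tr _; have -> : z = ((Rs *m v)^T *m (Rs *m v)) 0 0.
  by rewrite /z trmx_mul resolvent_sym // /mxtrace big_ord1.
have z0 := dot_ge0 (Rs *m v); rewrite -/z.
have zq := quadf_resolvent_ge t0 psdW v.
apply/andP; split; first by rewrite mulr_ge0 // divr_ge0 // ltW.
rewrite mulrAC ler_pdivrMr // ler_pdivlMl //.
have := ler_wpM2l c0 zq; lra.
Qed.

End rank_one.

Section columns.
Variables (p m : nat) (c t : R) (X : 'M[R]_(p, m)).
Hypotheses (c0 : 0 <= c) (t0 : 0 < t).

Definition gram_without (k : 'I_m) : 'M[R]_p :=
  c *: \sum_(j | j != k) col j X *m (col j X)^T.

Lemma mulmx_tr_sum_col : X *m X^T = \sum_j col j X *m (col j X)^T.
Proof.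
apply/matrixP => a b; rewrite summxE !mxE; apply: eq_bigr => j _.
by rewrite !mxE big_ord1 !mxE.
Qed.

Lemma psdmx_gram : psdmx (c *: (X *m X^T)).
Proof. by rewrite mulmx_tr_sum_col; exact: psdmx_sum_rank1. Qed.

Lemma psdmx_gram_without k : psdmx (gram_without k).
Proof. exact: psdmx_sum_rank1. Qed.

Lemma gram_split k :
  c *: (X *m X^T) = gram_without k + c *: (col k X *m (col k X)^T).
Proof. by rewrite mulmx_tr_sum_col (bigD1 k) //= scalerDr addrC. Qed.

Lemma tr_resolvent_leave_one_out k :
  0 <= \tr (resolvent t (gram_without k)) - \tr (resolvent t (c *: (X *m X^T)))
    <= t^-1.
Proof. by rewrite (gram_split k) tr_rank1_update //; exact: psdmx_gram_without. Qed.

(** Expand W over the columns in tr (W R) = p - t tr R. The k-th term is c times the quadratic form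
    of column k in the full resolvent, which [quadf_rank1_update] rewrites with the resolvent that
    does not involve this column. *)
Lemma resolvent_self_consistent :
  p%:R - t * \tr (resolvent t (c *: (X *m X^T))) =
  \sum_k (c * quadf (resolvent t (gram_without k)) (col k X)
           / (1 + c * quadf (resolvent t (gram_without k)) (col k X))).
Proof.
rewrite -resolvent_tr_mul //; last exact: psdmx_gram.
rewrite -scalemxAl linearZ /= {1}mulmx_tr_sum_col mulmx_suml raddf_sum /= mulr_sumr.
apply: eq_bigr => k _; rewrite -mulrA; congr (_ * _).
rewrite -mulmxA mxtrace_mulC /mxtrace big_ord1.
rewrite -(quadf_rank1_update _ t0 (psdmx_gram_without k) c0) -gram_split.
by rewrite /quadf.
Qed.

End columns.
End Resolvent.

(** * Spectra and eigenvalue counts of positive semidefinite matrices *)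

Lemma char_poly_similar (F : comUnitRingType) p (P A : 'M[F]_p) :
  P \in unitmx -> char_poly (invmx P *m A *m P) = char_poly A.
Proof.
move=> uP; rewrite /char_poly.
have PVP : map_mx polyC (invmx P) *m map_mx polyC P = 1%:M.
  by rewrite -map_mxM mulVmx // map_mx1.
have -> : char_poly_mx (invmx P *m A *m P) =
    map_mx polyC (invmx P) *m char_poly_mx A *m map_mx polyC P.
  rewrite /char_poly_mx !map_mxM mulmxBr mulmxBl; congr (_ - _).
  by rewrite mul_mx_scalar -scalemxAl PVP scalemx1.
by rewrite !det_mulmx mulrAC -det_mulmx PVP det1 mul1r.
Qed.

Lemma invmx_diag_similar (F : fieldType) p (P : 'M[F]_p) (d : 'rV[F]_p) (t : F) :
  P \in unitmx -> (forall i, d 0 i + t != 0) ->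
  invmx (invmx P *m diag_mx d *m P + t%:M) =
  invmx P *m diag_mx (\row_i (d 0 i + t)^-1) *m P.
Proof.
move=> uP d0; set B := _ *m P + _; set B' := RHS.
suff BB' : B *m B' = 1%:M.
  have [uB _] := mulmx1_unit BB'.
  by rewrite -[B']mul1mx -(mulVmx uB) -mulmxA BB' mulmx1.
have -> : B = invmx P *m diag_mx (\row_i (d 0 i + t)) *m P.
  rewrite /B.
  have -> : t%:M = invmx P *m t%:M *m P.
    by rewrite mul_mx_scalar -scalemxAl mulVmx // scalemx1.
  rewrite -mulmxDl -mulmxDr; congr (_ *m _ *m _).
  by apply/matrixP => i j; rewrite !mxE; case: eqVneq => [->|_]; rewrite ?mulr1n ?mulr0n ?addr0.
rewrite /B' !mulmxA mulmxK // -(mulmxA (invmx P)) mulmx_diag.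
set D := diag_mx _; have -> : D = 1%:M.
  apply/matrixP => i j; rewrite !mxE.
  by case: eqVneq => [->|_]; rewrite ?mulr1n ?mulr0n ?mulfV.
by rewrite mulmx1 mulVmx.
Qed.

(** Diagonalization is borrowed from Hermitian matrices over [R[i]]: the spectrum there is real, and
    both the characteristic polynomial and the trace of the resolvent descend to [R] by injectivity
    of the embedding. *)
Lemma psdmx_spectrum (R : rcfType) p (W : 'M[R]_p) : psdmx W ->
  exists r : 'I_p -> R,
  [/\ char_poly W = \prod_i ('X - (r i)%:P),
      forall i, 0 <= r i &
      forall t, 0 < t -> \tr (resolvent t W) = \sum_i (r i + t)^-1].
Proof.
move=> [Wsym Wpos].
pose f : {rmorphism R -> R[i]} := real_complex R.
pose A := map_mx f W.
have Areal : A \is a mxOver Num.real.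
  by apply/mxOverP => i j; rewrite mxE; apply/complex_realP; exists (W i j).
have Aherm : A \is hermsymmx.
  apply: realsym_hermsym => //; apply/is_hermitianmxP.
  by rewrite expr0 scale1r; apply/matrixP => i j; rewrite !mxE -[in LHS]Wsym mxE.
have Anorm := orthomx_spectralP (hermitian_normalmx Aherm).
set P := spectralmx A in Anorm; set d := spectral_diag A in Anorm.
have uP : P \in unitmx := spectral_unit A.
pose r i := complex.Re (d 0 i).
have dE i : d 0 i = f (r i).
  have /mxOverP/(_ 0 i) := hermitian_spectral_diag_real Aherm.
  by move=> /RRe_real <-.
have charW : char_poly W = \prod_i ('X - (r i)%:P).
  apply: (map_poly_inj f); rewrite map_char_poly -/A Anorm char_poly_similar //.
  rewrite char_poly_trig ?diag_mx_is_trig // rmorph_prod /=.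
  by apply: eq_bigr => i _; rewrite mxE eqxx mulr1n dE map_polyXsubC.
have r0 i : 0 <= r i.
  have : eigenvalue W (r i).
    by rewrite eigenvalue_root_char charW (bigD1 i) //= rootM root_XsubC eqxx.
  move=> /eigenvalueP[v vW v0].
  have := Wpos v^T; rewrite /quadf trmxK vW -scalemxAl mxE.
  rewrite pmulr_lge0 // lt_def; apply/andP; split; last first.
    by have := dot_ge0 v^T; rewrite trmxK.
  apply: contraNneq v0 => h; rewrite -[v]trmxK; apply/eqP.
  by rewrite (@dot_eq0 _ _ v^T) ?trmx0 // trmxK.
exists r; split=> // t t0; apply: (fmorph_inj f).
rewrite -trace_map_mx /resolvent map_invmx map_mxD map_scalar_mx /= -/A Anorm.
rewrite invmx_diag_similar //; last first.
  move=> i; rewrite dE -rmorphD fmorph_eq0 gt_eqF // ltr_wpDl //.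
rewrite mxtrace_mulC mulmxA mulmxV // mul1mx mxtrace_diag rmorph_sum /=.
by apply: eq_bigr => i _; rewrite mxE dE -rmorphD fmorphV.
Qed.

Lemma mup_prod_XsubC (F : fieldType) (I : finType) (r : I -> F) (x : F) :
  mup x (\prod_i ('X - (r i)%:P)) = #|[pred i | r i == x]|.
Proof.
rewrite -sum1_card big_mkcond /=.
elim: (index_enum I) => [|i s IH]; first by rewrite !big_nil mupNroot // root1.
rewrite !big_cons mupM ?polyXsubC_eq0 //; last first.
  by rewrite prodf_seq_neq0; apply/allP => j _; rewrite polyXsubC_eq0.
rewrite IH -['X - _]expr1 mup_XsubCX inE eq_sym.
by case: (_ == _); rewrite ?add0n.
Qed.

(** [rootsR] lists each root once, weighted by [mup]. After exchanging the two sums, every index i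
    meets exactly one listed root, namely r i. *)
Lemma eig_count_prod (R : realType) p (W : 'M[R]_p) (r : 'I_p -> R) t :
  char_poly W = \prod_i ('X - (r i)%:P) ->
  eig_count W t = #|[pred i | r i <= t]|.
Proof.
move=> charW; rewrite /eig_count charW.
set q := \prod_i _.
have q0 : q != 0 by apply/prodf_neq0 => i _; rewrite polyXsubC_eq0.
under eq_bigr do rewrite mup_prod_XsubC -sum1_card.
under eq_bigr do rewrite big_mkcond /=.
rewrite exchange_big /= -sum1_card [RHS]big_mkcond /=.
apply: eq_bigr => i _; rewrite -big_mkcondr /=.
have ri : r i \in rootsR q.
  by rewrite -roots_on_rootsR // in_itv /= /q (bigD1 i) //= rootM root_XsubC eqxx.
rewrite [RHS]/=; under eq_bigl do rewrite inE.
transitivity (\sum_(x <- rootsR q | ((x == r i) && (r i <= t))%R) 1)%N.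
  by apply: eq_bigl => x; rewrite eq_sym andbC; case: eqVneq => // ->.
rewrite inE; case: (r i <= t); last by rewrite big1 // => x; rewrite andbF.
under eq_bigl do rewrite andbT.
by rewrite sum1_count count_uniq_mem ?uniq_roots // ri.
Qed.

(** * Row sums of the tensor covariance *)

Section SubsetSums.
Import mathcomp.boot.finset.
Variables (R : realFieldType) (n : nat) (K : R).
Hypothesis K1 : 1 <= K.
Implicit Types (U D A B I J S : {set 'I_n}).

Let K0 : 0 <= K. Proof. exact: le_trans K1. Qed.

Lemma expr_card_prod U (a : R) : a ^+ #|U| = \prod_i (if i \in U then a else 1).
Proof. by rewrite -big_mkcond /= prodr_const. Qed.

(** The elementary symmetric polynomial of degree s in n variables, set to K on U and to 1 off U;
    for K = 1 it is binom(n, s). *)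
Definition esubsets U (s : nat) : R :=
  \sum_(D : {set 'I_n} | #|D| == s) K ^+ #|D :&: U|.

Lemma esubsets_ge0 U s : 0 <= esubsets U s.
Proof. by apply: sumr_ge0 => D _; rewrite exprn_ge0. Qed.

(** Double counting of the pairs (i, D) with i in D and |D| = s + 1: removing i from D splits off
    its weight. *)
Lemma esubsets_succ U s : s.+1%:R * esubsets U s.+1 =
  \sum_(D : {set 'I_n} | #|D| == s)
     K ^+ #|D :&: U| * \sum_(i | i \notin D) (if i \in U then K else 1).
Proof.
transitivity (\sum_(D : {set 'I_n} | #|D| == s.+1) \sum_(i in D) K ^+ #|D :&: U|).
  rewrite /esubsets mulr_sumr; apply: eq_bigr => D /eqP cD.
  by rewrite sumr_const cD mulr_natl.
rewrite (exchange_big_dep xpredT) //=.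
under [RHS]eq_bigr do rewrite mulr_sumr.
rewrite [RHS](exchange_big_dep xpredT) //=; apply: eq_bigr => i _.
rewrite (reindex_onto (fun D => i |: D) (fun D => D :\ i)) /=; last first.
  by move=> D /andP[_ iD]; rewrite setD1K.
apply: eq_big => [D|D].
  rewrite setU11 andbT; case: (boolP (i \in D)) => iD.
    by rewrite andbF; apply/negP => /andP[_ /eqP h]; move: iD; rewrite -h !inE eqxx.
  by rewrite setU1K // eqxx !andbT cardsU1 iD add1n eqSS.
move=> /andP[_ /eqP h]; have iD : i \notin D by rewrite -h !inE eqxx.
rewrite setIUl; case: ifP => iU.
  rewrite (setIidPl _) ?sub1set // cardsU1 inE (negbTE iD) /= add1n exprS mulrC //.
have -> : [set i] :&: U = set0.
  by apply/setP => j; rewrite !inE; case: eqP => // ->; rewrite iU.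
by rewrite set0U mulr1.
Qed.

Lemma sum_notin D : \sum_(i | i \notin D) (1 : R) = (n - #|D|)%:R.
Proof.
rewrite sumr_const; congr (_%:R); apply/eqP.
rewrite -(eqn_add2l #|D|) subnKC; last by rewrite -[leqRHS]card_ord max_card.
by rewrite -[eqbRHS]card_ord -(cardC (mem D)).
Qed.

Lemma esubsets_succ_ge U s : (s <= n)%N ->
  (n - s)%:R * esubsets U s <= s.+1%:R * esubsets U s.+1.
Proof.
move=> sn; rewrite esubsets_succ /esubsets mulr_sumr.
apply: ler_sum => D /eqP cD; rewrite mulrC ler_wpM2l ?exprn_ge0 //.
rewrite -cD -sum_notin.
by apply: ler_sum => i _; case: ifP.
Qed.

Lemma esubsets_succ_le U s : (s <= n)%N ->
  s.+1%:R * esubsets U s.+1 <= ((n - s)%:R + #|U|%:R * K) * esubsets U s.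
Proof.
move=> sn; rewrite esubsets_succ /esubsets mulr_sumr.
apply: ler_sum => D /eqP cD; rewrite [leRHS]mulrC ler_wpM2l ?exprn_ge0 //.
rewrite -cD -sum_notin.
have -> : #|U|%:R * K = \sum_i (if i \in U then K else 0).
  by rewrite -big_mkcond /= sumr_const mulr_natl.
rewrite [X in _ <= _ + X](bigID (fun i => i \notin D)) /=.
rewrite addrA -big_split /=; apply: ler_wpDr.
  by apply: sumr_ge0 => i _; case: ifP.
by apply: ler_sum => i _; case: ifP => _; lra.
Qed.

Variable d : nat.
Hypothesis dn : (d < n)%N.
Let nd0 : 0 < (n - d)%:R :> R. Proof. by rewrite ltr0n subn_gt0. Qed.

Definition dratio : R := d%:R / (n - d)%:R.
Definition dconst : R := (1 + 2 * d%:R * K / (n - d)%:R) ^+ d.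

Let q0 : 0 <= dratio. Proof. by rewrite divr_ge0. Qed.

(** By (n - s) e_s <= (s + 1) e_(s+1) and s < d, lowering the cardinality by one costs a factor
    [dratio]. This is where powers of d/(n - d) enter. *)
Lemma esubsets_ratio U s : (s < d)%N -> esubsets U s <= dratio * esubsets U s.+1.
Proof.
move=> sd; have sn : (s <= n)%N by apply: ltnW; exact: ltn_trans dn.
have ns0 : 0 < (n - s)%:R :> R by rewrite ltr0n subn_gt0 (ltn_trans sd).
rewrite -(ler_pM2l ns0); apply: le_trans (esubsets_succ_ge U sn) _.
rewrite mulrA ler_wpM2r ?esubsets_ge0 // /dratio mulrA ler_pdivlMr //.
by rewrite -!natrM ler_nat mulnC leq_mul // leq_sub2l // ltnW.
Qed.

Lemma esubsets_ratioX U j : (j <= d)%N ->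
  esubsets U (d - j) <= dratio ^+ j * esubsets U d.
Proof.
elim: j => [|j IH] jd; first by rewrite subn0 expr0 mul1r.
have lt : (d - j.+1 < d)%N by rewrite ltn_subrL /= (leq_ltn_trans _ jd).
apply: le_trans (esubsets_ratio U lt) _.
by rewrite subnSK // exprS -mulrA ler_wpM2l // IH // ltnW.
Qed.

(** Compared with the binomial coefficient, the step from s to s + 1 gains at most (n - s + |U|
    K)/(n - s) <= 1 + 2 d K/(n - d). The 2 in [dconst] is the size 2d of a union of two d-sets. *)
Lemma esubsets_le U : (#|U| <= d.*2)%N -> esubsets U d <= 'C(n, d)%:R * dconst.
Proof.
move=> cU; rewrite /dconst.
set c := 1 + _.
have c0 : 0 <= c by rewrite /c addr_ge0 // divr_ge0 // !mulr_ge0.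
suff H s : (s <= d)%N -> esubsets U s <= 'C(n, s)%:R * c ^+ s by exact: H.
elim: s => [_|s IH sd].
  rewrite /esubsets (big_pred1 set0); last by move=> D; rewrite /= cards_eq0.
  by rewrite set0I cards0 expr0 bin0 mulr1.
have sn : (s <= n)%N by apply: ltnW; exact: ltn_trans dn.
have ns : (n - d <= n - s)%N by rewrite leq_sub2l // ltnW.
rewrite -(@ler_pM2l _ s.+1%:R) ?ltr0n // (le_trans (esubsets_succ_le U sn)) //.
have -> : s.+1%:R * ('C(n, s.+1)%:R * c ^+ s.+1) =
    ((n - s)%:R * c) * ('C(n, s)%:R * c ^+ s) :> R.
  rewrite mulrA -natrM mul_bin_left natrM exprS; ring.
apply: ler_pM => //; last exact: IH (ltnW sd).
- by rewrite addr_ge0 // mulr_ge0.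
- exact: esubsets_ge0.
rewrite /c mulrDr mulr1 lerD2l mulrA ler_pdivlMr //.
have -> : (n - s)%:R * (2 * d%:R * K) = (n - s)%:R * (2 * d%:R) * K :> R by ring.
rewrite (mulrAC _ K) ler_wpM2r //.
by rewrite -!natrM ler_nat mulnC leq_mul // mul2n.
Qed.

(* [mweight k] bounds |E x_i^k| for k <= 4, and [tweight I J A B] bounds
   E[x_I x_J x_A x_B]. *)
Definition mweight (k : nat) : R :=
  match k with 0%N => 1 | 1%N => 0 | 2%N => 1 | _ => K end.

Definition tweight I J A B : R :=
  \prod_i mweight ((i \in I) + (i \in J) + (i \in A) + (i \in B)).

Lemma mweight_ge0 k : 0 <= mweight k.
Proof. by case: k => [|[|[|k]]] //=. Qed.

Lemma tweight_ge0 I J A B : 0 <= tweight I J A B.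
Proof. by apply: prodr_ge0 => i _; exact: mweight_ge0. Qed.

Lemma sum_inj_le (X Y : finType) (P : pred X) (Q : pred Y) (h : X -> Y) (F : Y -> R) :
  {in P &, injective h} -> (forall x, P x -> Q (h x)) -> (forall y, Q y -> 0 <= F y) ->
  \sum_(x | P x) F (h x) <= \sum_(y | Q y) F y.
Proof.
move=> hinj PQ F0.
have -> : \sum_(x | P x) F (h x) = \sum_(y in [set h x | x in P]) F y.
  by rewrite big_imset.
rewrite [leRHS](bigID (fun y => y \in [set h x | x in P])) /=.
have -> : \sum_(y | Q y && (y \in [set h x | x in P])) F y =
    \sum_(y in [set h x | x in P]) F y.
  apply: eq_bigl => y; case: (boolP (y \in _)) => [/imsetP[x Px ->]|]; last by rewrite andbF.
  by rewrite andbT PQ.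
by rewrite lerDl sumr_ge0 // => y /andP[/F0].
Qed.

Section fixed_pair.
Variables (I J : {set 'I_n}).
Hypotheses (cI : #|I| = d) (cJ : #|J| = d).
Variable y : R.
Hypotheses (y0 : 0 <= y) (yq : y ^+ 2 = dratio).

(* Contribution of one coordinate to the sum over the pairs (A, B) with
   prescribed A \ B and B \ A; [y] carries half a unit of cardinality. *)
Definition cfactor (inI inJ inS1 inS2 : bool) : R :=
  match inS1, inS2 with
  | true, true => 0
  | false, false => if inI (+) inJ then K * y ^+ 2 else 1
  | _, _ => if inI && inJ then K * y else if inI || inJ then y else 0
  end.

Lemma cfactor_ge0 a b c e : 0 <= cfactor a b c e.
Proof.
by case: a; case: b; case: c; case: e => //=; rewrite ?mulr_ge0 ?exprn_ge0.
Qed.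

Let U := I :|: J.
Let dI := (I :\: J) :|: (J :\: I).

Lemma cardU_le : (#|U| <= d.*2)%N.
Proof. by rewrite cardsU cI cJ -addnn leq_subr. Qed.

Definition diff_fiber S1 S2 (X : {set 'I_n} * {set 'I_n}) :=
  [&& #|X.1| == d, #|X.2| == d, X.1 :\: X.2 == S1 & X.2 :\: X.1 == S2].

(** A coordinate covered exactly once by I, J, A, B has weight 0. Nonzero terms therefore have S1
    and S2 inside I :|: J, and the rest T of the symmetric difference of I and J inside both A and
    B. Such a pair is determined by D = (A :&: B) :\: T, of cardinality d - u - b, so the sum is
    bounded by an [esubsets]. Bringing the cardinality back to d costs dratio^(u + b), that is, y^2
    per element of T and y per element of S1 and of S2. *)
Lemma tweight_fiber S1 S2 :
  \sum_(X | diff_fiber S1 S2 X) tweight I J X.1 X.2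
  <= 'C(n, d)%:R * dconst * \prod_i cfactor (i \in I) (i \in J) (i \in S1) (i \in S2).
Proof.
have C0 : 0 <= 'C(n, d)%:R * dconst.
  by apply: le_trans (esubsets_le cardU_le); exact: esubsets_ge0.
set P := diff_fiber S1 S2.
pose T := dI :\: (S1 :|: S2).
pose good (AB : {set 'I_n} * {set 'I_n}) :=
  (S1 :|: S2 \subset U) && (T \subset AB.1 :&: AB.2).
rewrite (bigID good) /= [X in _ + X]big1 ?addr0; last first.
  move=> [A B] /= /andP[/and4P[_ _ /eqP/setP AB /eqP/setP BA]].
  rewrite negb_and => /orP[] /fintype.subsetPn[i iS iU].
    apply/eqP; rewrite prodf_seq_eq0; apply/hasP; exists i; rewrite ?mem_index_enum //=.
    have := AB i; have := BA i; move: iS iU; rewrite !inE.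
    by case: (i \in S1); case: (i \in S2); case: (i \in I); case: (i \in J);
      case: (i \in A); case: (i \in B) => //=; rewrite eqxx.
  apply/eqP; rewrite prodf_seq_eq0; apply/hasP; exists i; rewrite ?mem_index_enum //=.
  have := AB i; have := BA i; move: iS iU; rewrite !inE.
  by case: (i \in S1); case: (i \in S2); case: (i \in I); case: (i \in J);
      case: (i \in A); case: (i \in B) => //=; rewrite eqxx.
(* One admissible pair serves to read off the cardinalities |S1| = |S2| = u and b <= d - u; if there
   is none, the sum is empty. *)
have [[A0 B0]|none] := pickP (fun AB => P AB && good AB); last first.
  rewrite big_pred0 // mulr_ge0 // prodr_ge0 // => i _; exact: cfactor_ge0.
rewrite /P /good /diff_fiber /= => /andP[/and4P[/eqP cA /eqP cB /eqP AB /eqP BA] /andP[SU TD]].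
pose u := #|S1|; pose b := #|T|.
have cAB : #|A0 :&: B0| = (d - u)%N.
  by rewrite -cA -(cardsID B0 A0) AB /u addnK.
have cS2 : #|S2| = u.
  have := cardsID B0 A0; have := cardsID A0 B0; rewrite setIC AB BA cA cB.
  by rewrite -/u => <- /addnI.
have ud : (u <= d)%N by rewrite -cA /u -AB subset_leq_card // subsetDl.
have bd : (b <= d - u)%N by rewrite -cAB subset_leq_card.
have S12 i : ~~ ((i \in S1) && (i \in S2)).
  by rewrite -AB -BA !inE; case: (i \in A0); case: (i \in B0).
pose c := #|(S1 :|: S2) :&: (I :&: J)|.
have rhsE : \prod_i cfactor (i \in I) (i \in J) (i \in S1) (i \in S2) =
    K ^+ c * K ^+ b * dratio ^+ (u + b).
  have -> : dratio ^+ (u + b) = y ^+ #|S1| * y ^+ #|S2| * (y ^+ 2) ^+ b.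
    by rewrite exprD -yq -/u cS2 -[in LHS]exprM mul2n -addnn exprD.
  rewrite !expr_card_prod -!big_split /=; apply: eq_bigr => i _.
  have := S12 i; have /implyP := fintype.subsetP SU i; rewrite !inE.
  by case: (i \in S1); case: (i \in S2); case: (i \in I); case: (i \in J) => //= _ _;
    rewrite ?mul1r ?mulr1.
apply: le_trans (_ : K ^+ c * K ^+ b * esubsets U (d - (u + b)) <= _); last first.
  rewrite rhsE mulrCA ler_wpM2l ?mulr_ge0 ?exprn_ge0 //.
  apply: le_trans (esubsets_ratioX U _) _.
    by rewrite -(subnKC ud) leq_add2l.
  by rewrite mulrC ler_wpM2r ?exprn_ge0 // esubsets_le // cardU_le.
(* Injective on admissible pairs: T lies in A :&: B, so D gives A :&: B back, and S1, S2 then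
   restore A and B. *)
pose h (X : {set 'I_n} * {set 'I_n}) := (X.1 :&: X.2) :\: T.
apply: le_trans (_ : \sum_(X | P X && good X) K ^+ c * K ^+ b * K ^+ #|h X :&: U| <= _).
  apply: ler_sum => -[A B] /andP[/and4P[_ _ /eqP/setP eA /eqP/setP eB] _].
  rewrite !expr_card_prod -!big_split /=; apply: ler_prod => i _.
  rewrite mweight_ge0 /=; have := eA i; have := eB i; rewrite /T /dI /U !inE.
  by case: (i \in S1); case: (i \in S2); case: (i \in I); case: (i \in J);
    case: (i \in A); case: (i \in B) => //= _ _; rewrite ?mul1r ?mulr1 ?mulr_ge0.
rewrite -mulr_sumr ler_wpM2l ?mulr_ge0 ?exprn_ge0 //.
apply: (sum_inj_le (F := fun D => K ^+ #|D :&: U|)).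
- move=> [A B] [A' B'] /andP[/and4P[_ _ /eqP e1 /eqP e2] /andP[_ t1]].
  move=> /andP[/and4P[_ _ /eqP e1' /eqP e2'] /andP[_ t1']] hh.
  have e : A :&: B = A' :&: B'.
    by rewrite -(setID (A :&: B) T) -(setID (A' :&: B') T) -/(h (A, B)) hh
      (setIidPr t1) (setIidPr t1').
  have -> : A = A' by rewrite -(setID A B) -(setID A' B') e e1 e1'.
  by rewrite -(setID B A) -(setID B' A') setIC e e2 (setIC B') e2'.
- move=> [A B] /andP[/and4P[/eqP cA' _ /eqP e1 _] /andP[_ t1]].
  rewrite /h /= cardsD (setIidPr t1) -/b.
  by rewrite subnDA; apply/eqP; congr (_ - _)%N; rewrite -cA' -(cardsID B A) e1 addnK.
- by move=> D _; rewrite exprn_ge0.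
Qed.

Lemma tweight_sum_le (Q : pred ({set 'I_n} * {set 'I_n})) :
  \sum_(X : {set 'I_n} * {set 'I_n} | [&& #|X.1| == d, #|X.2| == d
      & Q (X.1 :\: X.2, X.2 :\: X.1)]) tweight I J X.1 X.2
  <= 'C(n, d)%:R * dconst *
     \sum_(S | Q S) \prod_i cfactor (i \in I) (i \in J) (i \in S.1) (i \in S.2).
Proof.
rewrite (partition_big (fun X => (X.1 :\: X.2, X.2 :\: X.1)) Q) /=; last first.
  by move=> X /and3P[].
rewrite mulr_sumr; apply: ler_sum => -[S1 S2] QS /=.
apply: le_trans (tweight_fiber S1 S2); rewrite le_eqVlt; apply/orP; left.
apply/eqP; apply: eq_bigl => -[A B] /=; rewrite /diff_fiber /= xpair_eqE.
case: eqP => // _; case: eqP => // _ /=; case: eqP => [->|]; last by rewrite andbF.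
by case: eqP => [->|]; rewrite ?andbT ?andbF.
Qed.

(** A pair of subsets is a choice of two bits per coordinate, so the sum of products distributes.
    The half exponents in [cfactor] serve to bring the sum to this form. *)
Lemma sum_pairs_prod (f : 'I_n -> bool -> bool -> R) :
  \sum_(S : {set 'I_n} * {set 'I_n}) \prod_i f i (i \in S.1) (i \in S.2) =
  \prod_i (f i true true + f i true false + (f i false true + f i false false)).
Proof.
rewrite bigA_distr -(pair_big xpredT xpredT
  (fun S1 S2 : {set 'I_n} => \prod_i f i (i \in S1) (i \in S2))) /=.
apply: eq_bigr => S1 _.
transitivity (\prod_i (f i (i \in S1) true + f i (i \in S1) false)).
  rewrite bigA_distr; apply: eq_bigr => S2 _; apply: eq_bigr => i _.
  by case: (i \in S2).
by apply: eq_bigr => i _; case: (i \in S1).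
Qed.

End fixed_pair.

Variable y : R.
Hypotheses (y0 : 0 <= y) (yq : y ^+ 2 = dratio).

Let C0 : 0 <= dconst.
Proof. by rewrite exprn_ge0 // addr_ge0 // divr_ge0 // !mulr_ge0. Qed.

(** Per coordinate, the four cases of [cfactor] add up to 1 + 2Ky on I :&: J, to 2y + Ky^2 on the
    symmetric difference, and to 1 elsewhere. As I != J, some coordinate k is of the second kind;
    its small factor is kept, and [small] bounds the others of that kind by 1. *)
Lemma tweight_row_neq I J : #|I| = d -> #|J| = d -> I != J ->
  2 * y + K * y ^+ 2 <= 1 ->
  \sum_(X : {set 'I_n} * {set 'I_n} | (#|X.1| == d) && (#|X.2| == d))
      tweight I J X.1 X.2
  <= 'C(n, d)%:R * (dconst * ((1 + 2 * K * y) ^+ d * (2 * y + K * y ^+ 2))).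
Proof.
move=> cI cJ nIJ small.
have /= := tweight_sum_le cI cJ y0 yq xpredT.
under eq_bigl do rewrite andbT.
move=> h; apply: le_trans h _; rewrite -mulrA ler_wpM2l // ler_wpM2l //.
rewrite (sum_pairs_prod (fun i => cfactor y (i \in I) (i \in J))).
have [k kd] : exists k, k \in (I :\: J) :|: (J :\: I).
  apply/set0Pn; apply: contraNneq nIJ => /setP h; apply/eqP/setP => i.
  by have := h i; rewrite !inE; case: (i \in I); case: (i \in J).
have -> : (1 + 2 * K * y) ^+ d * (2 * y + K * y ^+ 2) =
    \prod_i ((if i \in I then 1 + 2 * K * y else 1) *
      (if i \in [set k] then 2 * y + K * y ^+ 2 else 1)).
  by rewrite big_split /= -!expr_card_prod cI cards1 expr1.
have z0 : 0 <= K * y by rewrite mulr_ge0.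
have z1 : 0 <= K * y ^+ 2 by rewrite mulr_ge0 ?exprn_ge0.
apply: ler_prod => i _; rewrite !inE.
have zz : 1 <= 1 + 2 * K * y by lra.
have z2 : 0 <= 2 * y + K * y ^+ 2 by rewrite addr_ge0 // mulr_ge0.
have z3 : 2 * y + K * y ^+ 2 <= (1 + 2 * K * y) * (2 * y + K * y ^+ 2).
  by rewrite ler_peMl.
case: (eqVneq i k) => [->|_].
  by move: kd; rewrite !inE; case: (k \in I); case: (k \in J) => //= _;
  apply/andP; split; rewrite ?mul1r; lra.
by case: (i \in I); case: (i \in J) => //=; apply/andP; split; rewrite ?mulr1; lra.
Qed.

(** With I = J no coordinate is small, but distinct A and B of equal size have both differences
    nonempty. Each of the two sums over nonempty S equals (1 + Ky)^d - 1, which is small when d y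
    is. *)
Lemma tweight_row_off I : #|I| = d ->
  \sum_(X : {set 'I_n} * {set 'I_n} | [&& #|X.1| == d, #|X.2| == d & X.1 != X.2])
      tweight I I X.1 X.2
  <= 'C(n, d)%:R * (dconst * ((1 + K * y) ^+ d - 1) ^+ 2).
Proof.
move=> cI.
pose Q (S : {set 'I_n} * {set 'I_n}) := (S.1 != set0) && (S.2 != set0).
have z0 : 0 <= K * y by rewrite mulr_ge0.
apply: le_trans (_ : \sum_(X : {set 'I_n} * {set 'I_n} | [&& #|X.1| == d, #|X.2| == d
      & Q (X.1 :\: X.2, X.2 :\: X.1)]) tweight I I X.1 X.2 <= _).
  rewrite le_eqVlt; apply/orP; left; apply/eqP; apply: eq_bigl => -[A B] /=.
  case: eqP => // cA; case: eqP => // cB /=; rewrite /Q /= !setD_eq0.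
  rewrite -negb_or; congr (~~ _); apply/idP/idP => [/eqP ->|/orP[h|h]].
  - by rewrite subxx.
  - by rewrite eqEcard h cA cB leqnn.
  - by rewrite eq_sym eqEcard h cA cB leqnn.
apply: le_trans (tweight_sum_le cI cI y0 yq Q) _.
rewrite -mulrA ler_wpM2l // ler_wpM2l //.
pose sg (S : {set 'I_n}) := \prod_i (if i \in S then (if i \in I then K * y else 0) else 1).
have sg0 S : 0 <= sg S by apply: prodr_ge0 => i _; case: ifP => // _; case: ifP.
apply: le_trans (_ : \sum_(S | Q S) sg S.1 * sg S.2 <= _).
  apply: ler_sum => -[S1 S2] _ /=; rewrite -big_split /=; apply: ler_prod => i _.
  rewrite cfactor_ge0 //=.
  by case: (i \in I); case: (i \in S1); case: (i \in S2) => //=; rewrite ?mul1r ?mulr1 ?mulr_ge0.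
rewrite -(pair_big (fun S => S != set0) (fun S => S != set0) (fun S1 S2 => sg S1 * sg S2)) /=.
have E : \sum_(S | S != set0) sg S = (1 + K * y) ^+ d - 1.
  have : \sum_S sg S = (1 + K * y) ^+ d.
    rewrite -bigA_distr -cI expr_card_prod; apply: eq_bigr => i _.
    by case: ifP => _ /=; rewrite ?add0r // addrC.
  have sgE : sg set0 = 1 by apply: big1 => i _; rewrite inE.
  by rewrite (bigD1 set0) //= sgE => <-; rewrite addrAC subrr add0r.
under eq_bigr do rewrite -mulr_sumr.
by rewrite -mulr_suml E expr2.
Qed.

Lemma tweight_diag I A : tweight I I A A = K ^+ #|A :&: I|.
Proof.
rewrite expr_card_prod; apply: eq_bigr => i _; rewrite inE.
by case: (i \in I); case: (i \in A).
Qed.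

Lemma tweight_row_diag I : #|I| = d ->
  \sum_(A : {set 'I_n} | #|A| == d) (tweight I I A A - 1) <= 'C(n, d)%:R * (dconst - 1).
Proof.
move=> cI; under eq_bigr do rewrite tweight_diag.
rewrite sumrB mulrBr; apply: lerB; first by apply: esubsets_le; rewrite cI -addnn leq_addr.
by rewrite sumr_const mulr1 -cardsE -[X in 'C(X, _)](card_ord n) card_draws.
Qed.

(** The summands bound, relative to binom(n, d), a row with I != J, the terms A != B of a row with I
    = J, and its terms A = B once the product of means 1 is subtracted. *)
Definition tensor_eps : R :=
  dconst * ((1 + 2 * K * y) ^+ d * (2 * y + K * y ^+ 2)) +
  (dconst * ((1 + K * y) ^+ d - 1) ^+ 2 + (dconst - 1)).

Lemma tweight_row I J : #|I| = d -> #|J| = d -> 2 * y + K * y ^+ 2 <= 1 ->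
  \sum_(X : {set 'I_n} * {set 'I_n} | (#|X.1| == d) && (#|X.2| == d))
      (tweight I J X.1 X.2 - ((I == J) && (X.1 == X.2))%:R)
  <= 'C(n, d)%:R * tensor_eps.
Proof.
move=> cI cJ small; rewrite /tensor_eps mulrDr.
have z0 : 0 <= K * y by rewrite mulr_ge0.
have z1 : 0 <= K * y ^+ 2 by rewrite mulr_ge0 ?exprn_ge0.
have c1 : 1 <= dconst by rewrite exprn_ege1 // lerDl divr_ge0 // !mulr_ge0.
case: (eqVneq I J) => [<-|nIJ]; last first.
  apply: ler_wpDr.
    rewrite mulr_ge0 // addr_ge0 ?subr_ge0 // mulr_ge0 // sqr_ge0 //.
  by under eq_bigr do rewrite subr0; exact: tweight_row_neq.
apply: ler_wpDl.
  by rewrite mulr_ge0 // mulr_ge0 // mulr_ge0 ?exprn_ge0 ?addr_ge0 ?mulr_ge0.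
rewrite mulrDr (bigID (fun X => X.1 != X.2)) /=; apply: lerD.
  apply: le_trans (tweight_row_off cI); rewrite le_eqVlt; apply/orP; left; apply/eqP.
  apply: eq_big => [X|X /andP[_ /negbTE ->]]; first by rewrite andbA.
  by rewrite subr0.
apply: le_trans (tweight_row_diag cI); rewrite le_eqVlt; apply/orP; left; apply/eqP.
rewrite [RHS](reindex_onto (fun X : {set 'I_n} * {set 'I_n} => X.1) (fun A => (A, A))) //=.
apply: eq_big => [[A B]|[A B]] /=.
  rewrite negbK xpair_eqE eqxx /=; case: eqP => cA; case: (eqVneq A B) => [<-|_] //=.
  - by rewrite andbT; apply/eqP.
  - by rewrite andbF.
by rewrite negbK => /andP[_ /eqP ->]; rewrite eqxx.
Qed.
End SubsetSums.

(** * Independence and decoupling *)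

Section Laws.
Variable R : realType.

(* Measurability of a function of a family of reals, phrased so that no
   sigma-algebra on the function space [I -> R] has to be fixed. *)
Definition mfunctional (I : Type) (f : (I -> R) -> R) : Prop :=
  forall (d : measure_display) (T : measurableType d) (Y : I -> T -> R),
    (forall i, measurable_fun setT (Y i)) ->
    measurable_fun setT (fun w => f (fun i => Y i w)).

Definition boxes (I : finType) : set (set (I -> R)) :=
  [set C | exists B : I -> set R,
    (forall i, measurable (B i)) /\ C = [set v | forall i, B i (v i)]].

Section equal_laws.
Variables (I : finType) (d1 d2 : measure_display).
Variables (T1 : measurableType d1) (T2 : measurableType d2).
Variables (P1 : probability T1 R) (P2 : {measure set T2 -> \bar R}).
Variables (Y1 : I -> T1 -> R) (Y2 : I -> T2 -> R).
Hypotheses (mY1 : forall i, measurable_fun setT (Y1 i)).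
Hypotheses (mY2 : forall i, measurable_fun setT (Y2 i)).
Hypothesis boxE : forall B : I -> set R, (forall i, measurable (B i)) ->
  P1 [set w | forall i, B i (Y1 i w)] = P2 [set w | forall i, B i (Y2 i w)].

Local Notation S := (g_sigma_algebraType (@boxes I)).

Lemma measurable_coord i : measurable_fun setT (fun v : S => v i).
Proof.
move=> _ B mB; rewrite setTI; apply: sub_sigma_algebra.
exists (fun j => if j == i then B else setT); split.
  by move=> j; case: eqP => // _; exact: measurableT.
apply/seteqP; split => [v /= Bv j|v /= /(_ i)]; last by rewrite eqxx.
by case: eqP => // ->.
Qed.

Lemma measurable_family d (T : measurableType d) (Y : I -> T -> R) :
  (forall i, measurable_fun setT (Y i)) ->
  @measurable_fun _ _ T S setT (fun w i => Y i w).
Proof.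
move=> mY; apply: (@measurability _ _ T S _ _ (@boxes I)) => //.
move=> _ [C [B [mB ->]] <-]; rewrite setTI.
have -> : (fun w => (fun i => Y i w)) @^-1` [set v | forall i, B i (v i)] =
    \bigcap_(i in [set: I]) (Y i @^-1` B i).
  by apply/seteqP; split => [w /= h i _|w h i]; [exact: h|exact: (h i)].
apply: fin_bigcap_measurable => // i _.
by rewrite -[_ @^-1` _]setTI; exact: mY.
Qed.

(** Boxes are stable under intersection, so two joint laws that agree on them agree on the
    sigma-algebra they generate; integrals follow by change of variables. [P2] is only a measure so
    that it can be instantiated with [P \x P]. *)
Lemma ge0_law_eq (f : (I -> R) -> R) : mfunctional f -> (forall v, 0 <= f v) ->
  (\int[P1]_w (f (fun i => Y1 i w))%:E = \int[P2]_w (f (fun i => Y2 i w))%:E)%E.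
Proof.
move=> mf f0.
have mfS : measurable_fun [set: S] (EFin \o (f : S -> R)).
  by apply/measurable_EFinP; exact: (mf _ S (fun i v => v i) measurable_coord).
pose phi1 : {mfun T1 >-> S} :=
  HB.pack (fun w i => Y1 i w) (isMeasurableFun.Build _ _ T1 S _ (measurable_family mY1)).
pose phi2 : {mfun T2 >-> S} :=
  HB.pack (fun w i => Y2 i w) (isMeasurableFun.Build _ _ T2 S _ (measurable_family mY2)).
transitivity (\int[pushforward P1 phi1]_v (f v)%:E)%E.
  rewrite ge0_integral_pushforward // => v _; rewrite lee_fin //.
transitivity (\int[pushforward P2 phi2]_v (f v)%:E)%E; last first.
  by rewrite ge0_integral_pushforward // => v _; rewrite lee_fin.
apply: eq_measure_integral => A mA _.
apply: (@measure_unique _ R S (@boxes I) (fun=> setT) _ _ _ _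
  (pushforward P1 phi1) (pushforward P2 phi2)) => //.
- move=> _ _ [B [mB ->]] [B' [mB' ->]]; exists (fun i => B i `&` B' i); split.
    by move=> i; exact: measurableI.
  by apply/seteqP; split=> [v [h h'] i|v h]; [split|split=> i; case: (h i)].
- by move=> _; exists (fun=> setT); split=> //; apply/seteqP; split.
- by rewrite bigcup_const.
- by move=> _ [B [mB ->]]; exact: boxE.
- by move=> _; rewrite [X in (X < _)%E](_ : _ = P1 setT) // probability_setT ltry.
Qed.

Lemma law_eq (f : (I -> R) -> R) : mfunctional f ->
  (\int[P1]_w (f (fun i => Y1 i w))%:E = \int[P2]_w (f (fun i => Y2 i w))%:E)%E.
Proof.
move=> mf; rewrite [LHS]integralE [RHS]integralE; congr (_ - _)%E.
  transitivity (\int[P1]_w (Num.max (f (fun i => Y1 i w)) 0)%:E)%E.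
    by apply: eq_integral => w _; rewrite funeposE EFin_max.
  rewrite (@ge0_law_eq (fun v => Num.max (f v) 0)).
  - by apply: eq_integral => w _; rewrite funeposE EFin_max.
  - by move=> d T Y mY; apply: measurable_maxr => //; exact: mf.
  - by move=> v; rewrite le_max lexx orbT.
transitivity (\int[P1]_w (Num.max (- f (fun i => Y1 i w)) 0)%:E)%E.
  by apply: eq_integral => w _; rewrite funenegE EFin_max.
rewrite (@ge0_law_eq (fun v => Num.max (- f v) 0)).
- by apply: eq_integral => w _; rewrite funenegE EFin_max.
- by move=> d T Y mY; apply: measurable_maxr => //; exact: measurableT_comp (mf _ _ _ mY).
- by move=> v; rewrite le_max lexx orbT.
Qed.

End equal_laws.

Section decoupling.
Variables (I : finType) (dT : measure_display) (T : measurableType dT).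
Variables (P : probability T R) (X : I -> T -> R).
Hypotheses (mX : forall i, measurable_fun setT (X i)) (indX : mutually_independent P X).

Lemma independent_box (A : pred I) (B : I -> set R) : (forall i, measurable (B i)) ->
  (P [set w | forall i, A i -> B i (X i w)] = \prod_(i | A i) P (X i @^-1` B i))%E.
Proof.
move=> mB; have := indX [set i | A i]%SET mB.
have -> : \bigcap_(i in [set i | i \in [set i | A i]%SET]) (X i @^-1` B i) =
    [set w | forall i, A i -> B i (X i w)].
  by apply/seteqP; split=> [w h i Ai|w h i]; [apply: h; rewrite /= inE|rewrite /= inE => /h].
by move=> ->; apply: eq_bigl => i; rewrite inE.
Qed.

Definition mixf (A : pred I) (v v' : I -> R) : I -> R :=
  fun i => if A i then v' i else v i.

Lemma measurable_Xi (i : I) (B : set R) : measurable B -> measurable (X i @^-1` B).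
Proof. by move=> mB; rewrite -[_ @^-1` _]setTI; exact: mX. Qed.

Lemma measurable_box (A : pred I) (B : I -> set R) : (forall i, measurable (B i)) ->
  measurable [set w | forall i, A i -> B i (X i w)].
Proof.
move=> mB; have -> : [set w | forall i, A i -> B i (X i w)] =
    \bigcap_(i in [set i | A i]) (X i @^-1` B i) by [].
by apply: fin_bigcap_measurable => // i _; exact: measurable_Xi.
Qed.

Definition mixX (A : pred I) (i : I) (z : T * T) : R :=
  if A i then X i z.2 else X i z.1.

Lemma measurable_mixX A i : measurable_fun setT (mixX A i).
Proof.
rewrite /mixX; case: (A i).
  exact: measurableT_comp (mX i) measurable_snd.
exact: measurableT_comp (mX i) measurable_fst.
Qed.

(** Separating the coordinates in A from the others makes the box a rectangle of [T * T], and
    independence identifies its product measure with the original probability. *)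
Lemma mixX_box (A : pred I) (B : I -> set R) : (forall i, measurable (B i)) ->
  (P [set w | forall i, B i (X i w)] =
   (P \x P) [set z | forall i, B i (mixX A i z)])%E.
Proof.
move=> mB.
have -> : [set z | forall i, B i (mixX A i z)] =
    [set w | forall i, ~~ A i -> B i (X i w)] `*` [set w | forall i, A i -> B i (X i w)].
  apply/seteqP; split=> [[w w'] h|[w w'] [/= h h'] i].
    by split=> i /= Ai; have := h i; rewrite /mixX; case: (A i) Ai.
  by rewrite /mixX; case: (boolP (A i)) => Ai /=; [exact: h'|exact: h].
have mm (C : pred I) := measurable_box C mB.
rewrite product_measure1E; [|exact: (mm (fun i => ~~ A i))|exact: mm].
have /= -> := independent_box (fun i => ~~ A i) mB.
have /= -> := independent_box A mB.
have -> : [set w | forall i, B i (X i w)] = [set w | forall i, xpredT i -> B i (X i w)].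
  by apply/seteqP; split=> [w h i _|w h i]; exact: h.
by rewrite (independent_box xpredT) // (bigID A) /= muleC.
Qed.

(** The Fubini form of conditioning on the coordinates off A: those in A are redrawn from the inner
    copy w'. *)
Lemma ge0_decouple (A : pred I) (f : (I -> R) -> R) :
  mfunctional f -> (forall v, 0 <= f v) ->
  (\int[P]_w (f (X ^~ w))%:E =
   \int[P]_w \int[P]_w' (f (mixf A (X ^~ w) (X ^~ w')))%:E)%E.
Proof.
move=> mf f0.
rewrite (ge0_law_eq mX (measurable_mixX A) (fun B mB => mixX_box A mB) mf f0).
rewrite fubini_tonelli1 //.
  by apply/measurable_EFinP; exact: mf (measurable_mixX A).
by move=> z; rewrite lee_fin.
Qed.

Lemma decouple (A : pred I) (f : (I -> R) -> R) :
  mfunctional f -> P.-integrable setT (fun w => (f (X ^~ w))%:E) ->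
  (\int[P]_w (f (X ^~ w))%:E =
   \int[P]_w \int[P]_w' (f (mixf A (X ^~ w) (X ^~ w')))%:E)%E.
Proof.
move=> mf intf.
rewrite (law_eq mX (measurable_mixX A) (fun B mB => mixX_box A mB) mf).
rewrite -integral12_prod_meas1 //; apply/integrableP; split.
  by apply/measurable_EFinP; exact: mf (measurable_mixX A).
(* Integrability over the product space is transported from P by the nonnegative case applied to
   |f|. *)
have mnf : mfunctional (fun v => `|f v|).
  by move=> d T' Y mY; apply: measurableT_comp (mf _ _ _ mY).
have := ge0_law_eq mX (measurable_mixX A) (fun B mB => mixX_box A mB) mnf.
move=> /(_ (fun v => normr_ge0 _)) E.
by move: intf => /integrableP[_]; rewrite /= -E.
Qed.

End decoupling.
End Laws.

(** From 1 - y <= exp(-y) one gets exp y <= 1/(1 - y). The quadratic exceeds this by y^2 (1 - 2y)/(1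
    - y), whence the threshold 1/2. *)
Lemma expR_le_quadratic (R : realType) (y : R) : y <= 2^-1 ->
  expR y <= 1 + y + 2 * y ^+ 2.
Proof.
move=> y2.
have y1 : 0 < 1 - y by lra.
have h : 1 - y <= (expR y)^-1 by rewrite -expRN; have := expR_ge1Dx (- y); lra.
have e0 := expR_gt0 y.
have h2 : expR y * (1 - y) <= 1.
  by rewrite -[leRHS](mulfV (lt0r_neq0 e0)) ler_pM2l.
rewrite -(ler_pM2r y1) (le_trans h2) // -subr_ge0.
have -> : (1 + y + 2 * y ^+ 2) * (1 - y) - 1 = y ^+ 2 * (1 - 2 * y) by ring.
by rewrite mulr_ge0 ?sqr_ge0 //; lra.
Qed.

(** For y >= 0 this is the fourth power of y/4 <= exp(y/4); the second exponential covers the other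
    sign. *)
Lemma pow4_le_expR (R : realType) (y : R) : y ^+ 4 <= 4 ^+ 4 * (expR y + expR (- y)).
Proof.
wlog y0 : y / 0 <= y.
  move=> H; have [/H //|/ltW yn] := lerP 0 y.
  have := H (- y); rewrite oppr_ge0 => /(_ yn); rewrite opprK addrC.
  by rewrite -[4%N]/(2 * 2)%N !exprM sqrrN.
have h : (y / 4) ^+ 4 <= expR y.
  have -> : expR y = expR (y / 4) ^+ 4 by rewrite -expRM_natl; congr expR; field.
  rewrite lerXn2r ?nnegrE ?expR_ge0 ?divr_ge0 //.
  have := expR_ge1Dx (y / 4); set e := expR _; lra.
have : y ^+ 4 <= 4 ^+ 4 * expR y.
  have -> : y ^+ 4 = 4 ^+ 4 * (y / 4) ^+ 4 by field.
  by rewrite ler_pM2l // exprn_gt0.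
have : 0 <= 4 ^+ 4 * expR (- y) by rewrite mulr_ge0 ?expR_ge0 // exprn_ge0.
by rewrite mulrDr; lra.
Qed.

(** * Concentration by bounded differences *)

Section BoundedExpectation.
Variables (R : realType) (dT : measure_display) (T : measurableType dT).
Variable P : probability T R.

Lemma integrable_bounded (g : T -> R) M : measurable_fun setT g ->
  (forall w, `|g w| <= M) -> P.-integrable setT (EFin \o g).
Proof.
move=> mg gM; apply: (@le_integrable _ _ _ _ _ _ _ (EFin \o cst M)) => //.
- exact/measurable_EFinP.
- by move=> w _; rewrite lee_fin (le_trans (gM w)) // ler_norm.
- exact: finite_measure_integrable_cst.
Qed.

Local Notation integrableE g := (P.-integrable setT (EFin \o g)).

Lemma integrableE_cst (r : R) : integrableE (fun=> r).
Proof. exact: finite_measure_integrable_cst. Qed.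

Lemma integrableE_D (f g : T -> R) : integrableE f -> integrableE g ->
  integrableE (fun w => f w + g w).
Proof. by move=> fi gi; apply: eq_integrable (integrableD _ fi gi). Qed.

Lemma integrableE_B (f g : T -> R) : integrableE f -> integrableE g ->
  integrableE (fun w => f w - g w).
Proof. by move=> fi gi; apply: eq_integrable (integrableB _ fi gi). Qed.

Lemma integrableE_Z (f : T -> R) r : integrableE f -> integrableE (fun w => r * f w).
Proof. by move=> fi; apply: eq_integrable (integrableZl _ r fi). Qed.

Lemma integrableE_sum (J : Type) (s : seq J) (Q : pred J) (f : J -> T -> R) :
  (forall j, Q j -> integrableE (f j)) -> integrableE (fun w => \sum_(j <- s | Q j) f j w).
Proof.
move=> fi; apply: eq_integrable (integrable_sum _ s fi) => // w _.
by rewrite /= sumEFin.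
Qed.

Lemma Rintegral_sum (J : Type) (s : seq J) (Q : pred J) (f : J -> T -> R) :
  (forall j, Q j -> integrableE (f j)) ->
  \int[P]_w (\sum_(j <- s | Q j) f j w) = \sum_(j <- s | Q j) \int[P]_w f j w.
Proof.
move=> fi; elim: s => [|j s IH].
  by under eq_Rintegral do rewrite big_nil; rewrite big_nil Rintegral_cst // mul0r.
under eq_Rintegral do rewrite big_cons; rewrite big_cons.
case: (boolP (Q j)) => // Qj; rewrite RintegralD ?IH //; first exact: fi.
exact: integrableE_sum.
Qed.

Lemma EFin_Rintegral (g : T -> R) : P.-integrable setT (EFin \o g) ->
  ((\int[P]_w g w)%:E = \int[P]_w (g w)%:E)%E.
Proof. by move=> ig; rewrite fineK //; exact: integrable_fin_num. Qed.

Lemma Rintegral_cst1 (r : R) : \int[P]_w r = r.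
Proof. by rewrite Rintegral_cst //= probability_setT mulr1. Qed.

Lemma Rintegral_le_cst (g : T -> R) r : P.-integrable setT (EFin \o g) ->
  (forall w, g w <= r) -> \int[P]_w g w <= r.
Proof.
move=> ig gr; rewrite -[leRHS]Rintegral_cst1; apply: le_Rintegral => //.
exact: integrableE_cst.
Qed.

Lemma Rintegral_ge_cst (g : T -> R) r : P.-integrable setT (EFin \o g) ->
  (forall w, r <= g w) -> r <= \int[P]_w g w.
Proof.
move=> ig gr; rewrite -[leLHS]Rintegral_cst1; apply: le_Rintegral => //.
exact: finite_measure_integrable_cst.
Qed.

End BoundedExpectation.

Section BoundedDifferences.
Variables (R : realType) (dT : measure_display) (T : measurableType dT).
Variables (P : probability T R) (I : finType) (X : I -> T -> R).
Hypotheses (mX : forall i, measurable_fun setT (X i)) (indX : mutually_independent P X).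
Variables (blk : I -> nat) (m : nat).
Hypothesis blkm : forall i, (blk i < m)%N.

Let inblk k : pred I := fun i => blk i == k.
Local Notation mix k := (mixf (inblk k)).

Definition agree_off k (v v' : I -> R) := forall i, blk i != k -> v i = v' i.

Lemma mix_agree k v v' u : agree_off k v v' -> mix k v u = mix k v' u.
Proof.
move=> vv'; apply/funext => i; rewrite /mixf /inblk.
by case: eqP => // /eqP/vv'.
Qed.

Lemma agree_mix k v u u' : agree_off k (mix k v u) (mix k v u').
Proof. by move=> i /negbTE ik; rewrite /mixf /inblk ik. Qed.

Lemma agree_mix2 k j v v' u : agree_off j v v' -> agree_off j (mix k v u) (mix k v' u).
Proof. by move=> vv' i ij; rewrite /mixf; case: ifP => // _; exact: vv'. Qed.

(** The conditional expectation of f given all blocks but the k-th, defined at every point of the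
    sample space and not only almost everywhere. *)
Definition block_avg k (f : (I -> R) -> R) (v : I -> R) : R :=
  \int[P]_w f (mix k v (X ^~ w)).

Section avg.
Variables (k : nat) (f : (I -> R) -> R) (M : R).
Hypotheses (mf : mfunctional f) (fM : forall v, 0 <= f v <= M).

Lemma measurable_mix v : measurable_fun setT (fun w => f (mix k v (X ^~ w))).
Proof.
have mY i : measurable_fun setT (fun w => mix k v (X ^~ w) i).
  by rewrite /mixf; case: (inblk k i).
exact: mf mY.
Qed.

Lemma integrable_mix v : P.-integrable setT (EFin \o (fun w => f (mix k v (X ^~ w)))).
Proof.
apply: (@integrable_bounded _ _ _ _ _ M) => [|w]; first exact: measurable_mix.
by have /andP[h1 h2] := fM (mix k v (X ^~ w)); rewrite ger0_norm.
Qed.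

Lemma EFin_avg v : ((block_avg k f v)%:E = \int[P]_w (f (mix k v (X ^~ w)))%:E)%E.
Proof. by rewrite EFin_Rintegral //; exact: integrable_mix. Qed.

Lemma block_avg_bound v : 0 <= block_avg k f v <= M.
Proof.
apply/andP; split.
  by apply: Rintegral_ge_cst => [|w]; [exact: integrable_mix|case/andP: (fM (mix k v (X ^~ w)))].
by apply: Rintegral_le_cst => [|w]; [exact: integrable_mix|case/andP: (fM (mix k v (X ^~ w)))].
Qed.

Lemma mfunctional_avg : mfunctional (block_avg k f).
Proof.
move=> d' T' Y mY; apply/measurable_EFinP.
have -> : EFin \o (fun w => block_avg k f (Y ^~ w)) =
    fubini_F P (fun z : T' * T => (f (mix k (Y ^~ z.1) (X ^~ z.2)))%:E).
  by apply/funext => w; rewrite /= EFin_avg.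
apply: measurable_fun_fubini_tonelli_F; last first.
  by move=> z; rewrite lee_fin; case/andP: (fM (mix k (Y ^~ z.1) (X ^~ z.2))).
apply/measurable_EFinP.
have mY' i : measurable_fun setT (fun z : T' * T => mix k (Y ^~ z.1) (X ^~ z.2) i).
  rewrite /mixf; case: (inblk k i); first exact: measurableT_comp (mX i) measurable_snd.
  exact: measurableT_comp (mY i) measurable_fst.
exact: mf mY'.
Qed.

Lemma integral_block_avg :
  (\int[P]_w (f (X ^~ w))%:E = \int[P]_w (block_avg k f (X ^~ w))%:E)%E.
Proof.
rewrite (ge0_decouple mX indX (inblk k) mf); last by move=> v; case/andP: (fM v).
by apply: eq_integral => w _; rewrite EFin_avg.
Qed.

End avg.

Definition bdiff c (f : (I -> R) -> R) := forall k v v', agree_off k v v' -> f v <= f v' + c.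

Definition indep_of k (f : (I -> R) -> R) := forall v v', agree_off k v v' -> f v = f v'.

Lemma bdiff_avg c k f M : mfunctional f -> (forall v, 0 <= f v <= M) ->
  bdiff c f -> bdiff c (block_avg k f).
Proof.
move=> mf fM df j v v' vv'; have imix := integrable_mix k mf fM.
have ic := integrableE_cst P c.
rewrite -[c](Rintegral_cst1 P) -RintegralD //.
apply: le_Rintegral => //; first exact: integrableE_D.
by move=> w _; apply: (df j); exact: agree_mix2.
Qed.

Lemma indep_avg_same k f : indep_of k (block_avg k f).
Proof.
by move=> v v' vv'; apply: eq_Rintegral => w _; rewrite (mix_agree _ vv').
Qed.

Lemma indep_avg k j f : indep_of j f -> indep_of j (block_avg k f).
Proof.
move=> fj v v' vv'; apply: eq_Rintegral => w _; apply: fj; exact: agree_mix2.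
Qed.

(** Given the other blocks, f stays within c of its average mu. In the quadratic bound on exp the
    square is replaced by (th c)^2; what remains is affine in f - mu, and its linear term integrates
    to 0. *)
Lemma exp_step c k f M th : mfunctional f -> (forall v, 0 <= f v <= M) -> bdiff c f ->
  0 <= th -> th * c <= 2^-1 -> forall v,
  (\int[P]_w (expR (th * f (mix k v (X ^~ w))))%:E <=
   ((1 + 2 * (th * c) ^+ 2) * expR (th * block_avg k f v))%:E)%E.
Proof.
move=> mf fM df th0 thc v; set mu := block_avg k f v.
pose Y w := f (mix k v (X ^~ w)).
have iY : P.-integrable setT (EFin \o Y) := integrable_mix k mf fM v.
have mY : measurable_fun setT Y := measurable_mix k mf v.
have Yle w : Y w <= mu + c.
  rewrite -lerBlDr; apply: Rintegral_ge_cst => // w'; rewrite lerBlDr.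
  by apply: (df k); exact: agree_mix.
have Yge w : mu - c <= Y w.
  rewrite lerBlDr; apply: Rintegral_le_cst => // w'.
  by apply: (df k); exact: agree_mix.
pose Z w := 1 + 2 * (th * c) ^+ 2 + th * (Y w - mu).
have iYm : P.-integrable setT (EFin \o (fun w => th * (Y w - mu))).
  by apply: integrableE_Z; apply: integrableE_B => //; exact: integrableE_cst.
have iZ : P.-integrable setT (EFin \o Z).
  by apply: integrableE_D => //; exact: integrableE_cst.
have ZE : \int[P]_w Z w = 1 + 2 * (th * c) ^+ 2.
  rewrite RintegralD //; last exact: integrableE_cst.
  rewrite Rintegral_cst1 RintegralZl //; last first.
    by apply: integrableE_B => //; exact: integrableE_cst.
  rewrite RintegralB //; last exact: integrableE_cst.
  by rewrite Rintegral_cst1 -/mu -/(block_avg k f v) subrr mulr0 addr0.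
have eZ w : expR (th * Y w) <= Z w * expR (th * mu).
  have -> : expR (th * Y w) = expR (th * (Y w - mu)) * expR (th * mu).
    by rewrite -expRD; congr expR; ring.
  rewrite ler_pM2r ?expR_gt0 //.
  have hle : th * (Y w - mu) <= th * c by rewrite ler_wpM2l // lerBlDl.
  have hge : - (th * c) <= th * (Y w - mu).
    by rewrite -mulrN ler_wpM2l // lerBrDr addrC.
  apply: le_trans (expR_le_quadratic (le_trans hle thc)) _.
  rewrite /Z.
  have : (th * (Y w - mu)) ^+ 2 <= (th * c) ^+ 2.
    have hn : `|th * (Y w - mu)| <= th * c by rewrite ler_norml hge hle.
    by rewrite -(real_normK (num_real (th * _))) lerXn2r ?nnegrE // (le_trans _ hn).
  lra.
apply: le_trans (_ : \int[P]_w (Z w * expR (th * mu))%:E <= _)%E.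
  apply: ge0_le_integral => //.
  - by apply/measurable_EFinP; apply: measurableT_comp => //; exact: measurable_funM.
  - apply/measurable_EFinP; apply: measurable_funM => //.
    by move/integrableP: iZ => [/measurable_EFinP].
  - by move=> w _; rewrite lee_fin eZ.
under eq_integral do rewrite EFinM.
by rewrite integralZr // -EFin_Rintegral // ZE -EFinM.
Qed.

(** A Doob martingale read backwards: at stage k the blocks below k have been averaged out. *)
Fixpoint iter_avg k (f : (I -> R) -> R) : (I -> R) -> R :=
  if k is k'.+1 then block_avg k' (iter_avg k' f) else f.

Section concentration.
Variables (f : (I -> R) -> R) (M c th : R).
Hypotheses (mf : mfunctional f) (fM : forall v, 0 <= f v <= M) (df : bdiff c f).
Hypotheses (th0 : 0 <= th) (thc : th * c <= 2^-1).

Lemma iter_avg_props k : [/\ mfunctional (iter_avg k f),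
  forall v, 0 <= iter_avg k f v <= M, bdiff c (iter_avg k f) &
  forall j, (j < k)%N -> indep_of j (iter_avg k f)].
Proof.
elim: k => [|k [mk bk dk ik]] //=; split.
- exact: mfunctional_avg bk.
- exact: block_avg_bound mk bk.
- exact: bdiff_avg bk dk.
- move=> j; rewrite ltnS leq_eqVlt => /orP[/eqP ->|/ik]; first exact: indep_avg_same.
  exact: indep_avg.
Qed.

Lemma iter_avg_const v v' : iter_avg m f v = iter_avg m f v'.
Proof.
have [_ _ _ ind] := iter_avg_props m.
pose g k i := if (blk i < k)%N then v i else v' i.
suff H k : (k <= m)%N -> iter_avg m f (g k) = iter_avg m f v'.
  rewrite -(H m) //; congr iter_avg; apply/funext => i; by rewrite /g blkm.
elim: k => [_|k IH km]; first by congr iter_avg.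
rewrite -(IH (ltnW km)); apply: (ind k) => // i ik.
by rewrite /g ltnS leq_eqVlt (negbTE ik).
Qed.

Lemma iter_avg_mean v : iter_avg m f v = \int[P]_w f (X ^~ w).
Proof.
have E k : (\int[P]_w (f (X ^~ w))%:E = \int[P]_w (iter_avg k f (X ^~ w))%:E)%E.
  elim: k => [//|k ->]; have [mk bk _ _] := iter_avg_props k.
  exact: integral_block_avg bk.
rewrite /Rintegral (E m).
under eq_integral do rewrite (iter_avg_const _ v).
by rewrite integral_cst //= probability_setT mule1.
Qed.

(** Each averaged block costs one factor 1 + 2 (th c)^2, and after m averages only the constant E f
    is left in the exponential. *)
Lemma mcdiarmid_mgf :
  (\int[P]_w (expR (th * f (X ^~ w)))%:E <=
   ((1 + 2 * (th * c) ^+ 2) ^+ m * expR (th * \int[P]_w f (X ^~ w)))%:E)%E.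
Proof.
set a := 1 + _; have a0 : 0 <= a by rewrite addr_ge0 // mulr_ge0 // sqr_ge0.
have H k : (\int[P]_w (expR (th * f (X ^~ w)))%:E <=
    (a ^+ k)%:E * \int[P]_w (expR (th * iter_avg k f (X ^~ w)))%:E)%E.
  elim: k => [|k IH]; first by rewrite expr0 mul1e.
  apply: le_trans IH _; rewrite exprSr EFinM -muleA; apply: lee_wpmul2l.
    by rewrite lee_fin exprn_ge0.
  have [mk bk dk _] := iter_avg_props k.
  have [mk' bk' _ _] := iter_avg_props k.+1.
  have me (g : (I -> R) -> R) : mfunctional g -> mfunctional (fun v => expR (th * g v)).
    move=> mg d' T' Y mY; apply: measurableT_comp => //.
    by apply: measurable_funM => //; exact: mg.
  rewrite (ge0_decouple mX indX (inblk k) (me _ mk)); last by move=> v; exact: expR_ge0.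
  rewrite -ge0_integralZl //; last first.
    by apply/measurable_EFinP; exact: (me _ mk') mX.
  apply: ge0_le_integral => //.
  - by move=> w _; apply: integral_ge0 => w' _; rewrite lee_fin expR_ge0.
  - apply: (measurable_fun_fubini_tonelli_F (m2 := P)
      (fun z : T * T => (expR (th * iter_avg k f (mix k (X ^~ z.1) (X ^~ z.2))))%:E)).
      apply/measurable_EFinP; exact: (me _ mk) (measurable_mixX mX (inblk k)).
    by move=> z; rewrite lee_fin expR_ge0.
  - apply: measurable_funeM; apply/measurable_EFinP; exact: (me _ mk') mX.
  - by move=> w _; rewrite -EFinM; exact: exp_step bk dk th0 thc _.
apply: le_trans (H m) _; rewrite EFinM lee_wpmul2l // ?lee_fin ?exprn_ge0 //.
under eq_integral do rewrite iter_avg_mean.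
by rewrite integral_cst //= probability_setT mule1.
Qed.

End concentration.

Lemma bounded_differences_4th_moment (f : (I -> R) -> R) M c th :
  mfunctional f -> (forall v, 0 <= f v <= M) -> bdiff c f ->
  0 < th -> th * c <= 2^-1 ->
  (\int[P]_w ((f (X ^~ w) - \int[P]_w f (X ^~ w)) ^+ 4)%:E <=
   (2 * 4 ^+ 4 * (1 + 2 * (th * c) ^+ 2) ^+ m / th ^+ 4)%:E)%E.
Proof.
move=> mf fM df th0 thc; set mu := Rintegral _ _ _; set a := 1 + _.
have if_ : P.-integrable setT (EFin \o (fun w => f (X ^~ w))).
  apply: (@integrable_bounded _ _ _ _ _ M) => [|w]; first exact: mf.
  by have /andP[? ?] := fM (X ^~ w); rewrite ger0_norm.
have mfX : measurable_fun setT (fun w => f (X ^~ w)) by exact: mf.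
have h1 := mcdiarmid_mgf mf fM df (ltW th0) thc; rewrite -/mu -/a in h1.
(* The lower tail is the upper tail of [M - f], preferred to [- f] because values must stay between
   0 and M. *)
have h2 : (\int[P]_w (expR (th * (M - f (X ^~ w))))%:E <=
    (a ^+ m * expR (th * (M - mu)))%:E)%E.
  have -> : M - mu = \int[P]_w (M - f (X ^~ w)).
    by rewrite RintegralB // ?Rintegral_cst1 //; exact: integrableE_cst.
  apply: (@mcdiarmid_mgf (fun v => M - f v) M) => //; last exact: ltW.
  - by move=> d' T' Y mY; apply: measurable_funB => //; exact: mf.
  - by move=> v; have := fM v; lra.
  - move=> k v v' vv'; have := df k v' v (fun i ik => esym (vv' i ik)); lra.
have me1 : measurable_fun setT (fun w => (expR (th * f (X ^~ w)))%:E).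
  by apply/measurable_EFinP; apply: measurableT_comp => //; exact: measurable_funM.
have me2 : measurable_fun setT (fun w => (expR (th * (M - f (X ^~ w))))%:E).
  apply/measurable_EFinP; apply: measurableT_comp => //; apply: measurable_funM => //.
  exact: measurable_funB.
have b1 : 0 <= 4 ^+ 4 / th ^+ 4 * expR (- (th * mu)).
  by rewrite mulr_ge0 ?divr_ge0 ?expR_ge0 ?exprn_ge0 // ltW.
have b2 : 0 <= 4 ^+ 4 / th ^+ 4 * expR (- (th * (M - mu))).
  by rewrite mulr_ge0 ?divr_ge0 ?expR_ge0 ?exprn_ge0 // ltW.
apply: le_trans (_ : \int[P]_w
   ((4 ^+ 4 / th ^+ 4 * expR (- (th * mu)))%:E * (expR (th * f (X ^~ w)))%:E +
   (4 ^+ 4 / th ^+ 4 * expR (- (th * (M - mu))))%:E * (expR (th * (M - f (X ^~ w))))%:E) <= _)%E.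
  apply: ge0_le_integral => //.
  - by move=> w _; rewrite lee_fin -[4%N]/(2 * 2)%N exprM sqr_ge0.
  - apply/measurable_EFinP; apply: measurable_funX; exact: measurable_funB.
  - by apply: emeasurable_funD; apply: measurable_funeM.
  - move=> w _; rewrite -!EFinM -EFinD lee_fin; set y := f _.
    have := pow4_le_expR (th * (y - mu)); rewrite exprMn => h.
    rewrite -(ler_pM2l (exprn_gt0 4 th0)) (le_trans h) // le_eqVlt; apply/orP; left.
    have -> : expR (th * (y - mu)) = expR (- (th * mu)) * expR (th * y).
      by rewrite -expRD; congr expR; ring.
    have -> : expR (- (th * (y - mu))) = expR (- (th * (M - mu))) * expR (th * (M - y)).
      by rewrite -expRD; congr expR; ring.
    by apply/eqP; field; exact: lt0r_neq0.
rewrite ge0_integralD //; last 4 first.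
- by move=> w _; rewrite mule_ge0 ?lee_fin ?expR_ge0.
- exact: measurable_funeM.
- by move=> w _; rewrite mule_ge0 ?lee_fin ?expR_ge0.
- exact: measurable_funeM.
rewrite !ge0_integralZl //.
have := leeD (lee_wpmul2l (x := (_)%:E) b1 h1) (lee_wpmul2l (x := (_)%:E) b2 h2).
move=> h; apply: le_trans h _.
rewrite -!EFinM -EFinD lee_fin le_eqVlt; apply/orP; left; apply/eqP.
rewrite !expRN; field.
by rewrite !lt0r_neq0 ?expR_gt0.
Qed.

End BoundedDifferences.

(** * Closure properties of measurable functionals *)

Section Mfunctional.
Variables (R : realType) (I : Type).
Implicit Types f g : (I -> R) -> R.

Lemma mfunctional_coord i : mfunctional (fun v : I -> R => v i).
Proof. by move=> d T Y mY; exact: mY. Qed.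

Lemma mfunctional_cst (r : R) : mfunctional (fun _ : I -> R => r).
Proof. by move=> d T Y mY; exact: measurable_cst. Qed.

Lemma mfunctional_comp (h : R -> R) f :
  measurable_fun setT h -> mfunctional f -> mfunctional (fun v => h (f v)).
Proof. by move=> mh mf d T Y mY; exact: measurableT_comp mh (mf _ _ _ mY). Qed.

Lemma mfunctionalD f g : mfunctional f -> mfunctional g -> mfunctional (fun v => f v + g v).
Proof. by move=> mf mg d T Y mY; apply: measurable_funD; [exact: mf|exact: mg]. Qed.

Lemma mfunctionalB f g : mfunctional f -> mfunctional g -> mfunctional (fun v => f v - g v).
Proof. by move=> mf mg d T Y mY; apply: measurable_funB; [exact: mf|exact: mg]. Qed.

Lemma mfunctionalM f g : mfunctional f -> mfunctional g -> mfunctional (fun v => f v * g v).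
Proof. by move=> mf mg d T Y mY; apply: measurable_funM; [exact: mf|exact: mg]. Qed.

Lemma mfunctional_sum (J : Type) (s : seq J) (Q : pred J) (f : J -> (I -> R) -> R) :
  (forall j, mfunctional (f j)) -> mfunctional (fun v => \sum_(j <- s | Q j) f j v).
Proof.
move=> mf d T Y mY; under eq_fun do rewrite big_mkcond /=.
elim: s => [|j s IH]; first by under eq_fun do rewrite big_nil; exact: measurable_cst.
under eq_fun do rewrite big_cons; apply: measurable_funD => //.
by case: (Q j); [exact: mf|exact: measurable_cst].
Qed.

Lemma mfunctional_prod (J : Type) (s : seq J) (Q : pred J) (f : J -> (I -> R) -> R) :
  (forall j, mfunctional (f j)) -> mfunctional (fun v => \prod_(j <- s | Q j) f j v).
Proof.
move=> mf d T Y mY; under eq_fun do rewrite big_mkcond /=.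
elim: s => [|j s IH]; first by under eq_fun do rewrite big_nil; exact: measurable_cst.
under eq_fun do rewrite big_cons; apply: measurable_funM => //.
by case: (Q j); [exact: mf|exact: measurable_cst].
Qed.

End Mfunctional.

(** * Expectations of products of independent variables *)

Section IndependentProducts.
Variables (R : realType) (dT : measure_display) (T : measurableType dT).
Variables (P : probability T R) (I : finType) (X : I -> T -> R).
Hypotheses (mX : forall i, measurable_fun setT (X i)) (indX : mutually_independent P X).
Variable g : I -> R -> R.
Hypotheses (mg : forall i, measurable_fun setT (g i)).
Hypothesis ig : forall i, P.-integrable setT (EFin \o (fun w => g i (X i w))).

(** Decoupling the head coordinate j turns the integral into an iterated one whose factors separate.
    Integrability must come first, and follows from the same decoupling of the absolute value. *)
Lemma indep_prod (s : seq I) : uniq s ->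
  P.-integrable setT (EFin \o (fun w => \prod_(i <- s) g i (X i w))) /\
  \int[P]_w (\prod_(i <- s) g i (X i w)) = \prod_(i <- s) \int[P]_w g i (X i w).
Proof.
elim: s => [_|j s IH /= /andP[js us]].
  have -> : (fun w => \prod_(i <- [::]) g i (X i w)) = fun=> 1.
    by apply/funext => w; rewrite big_nil.
  by rewrite big_nil Rintegral_cst1; split => //; exact: integrableE_cst.
have [iPi ePi] := IH us; pose Pi (v : I -> R) := \prod_(i <- s) g i (v i).
have mPi : mfunctional Pi.
  by apply: mfunctional_prod => i; apply: mfunctional_comp => //; exact: mfunctional_coord.
pose f v := g j (v j) * Pi v.
have mf : mfunctional f.
  by apply: mfunctionalM => //; apply: mfunctional_comp => //; exact: mfunctional_coord.
have fE v v' : f (mixf (pred1 j) v v') = g j (v' j) * Pi v.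
  rewrite /f /mixf /= eqxx; congr (_ * _); rewrite /Pi big_seq [RHS]big_seq.
  by apply: eq_bigr => i is_; case: eqP => // ij; rewrite -ij is_ in js.
have intf : P.-integrable setT (EFin \o (fun w => f (X ^~ w))).
  apply/integrableP; split; first by apply/measurable_EFinP; exact: mf mX.
  have mnf : mfunctional (fun v => `|f v|) by apply: mfunctional_comp.
  rewrite (_ : (\int[P]_w _)%E = (\int[P]_w (`|f (X ^~ w)|)%:E)%E) //.
  rewrite (ge0_decouple mX indX (pred1 j) mnf) //.
  have /integrableP[mgj lgj] := ig j; have /integrableP[mP lP] := iPi.
  have mgj' : measurable_fun setT (fun w => (`|g j (X j w)|)%:E).
    by apply/measurable_EFinP; apply: measurableT_comp => //; exact/measurable_EFinP.
  have mP' : measurable_fun setT (fun w => (`|Pi (X ^~ w)|)%:E).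
    by apply/measurable_EFinP; apply: measurableT_comp => //; exact/measurable_EFinP.
  rewrite (eq_integral (fun w => (\int[P]_w' (`|g j (X j w')|)%:E) * (`|Pi (X ^~ w)|)%:E)%E).
    rewrite ge0_integralZl //; last by apply: integral_ge0 => w _; rewrite lee_fin.
    apply: lte_mul_pinfty => //; first by apply: integral_ge0 => w _; rewrite lee_fin.
    by rewrite ge0_fin_numE //; apply: integral_ge0 => w _; rewrite lee_fin.
  move=> w _; rewrite -ge0_integralZr //.
  by apply: eq_integral => w' _; rewrite fE normrM EFinM.
have -> : (fun w => \prod_(i <- j :: s) g i (X i w)) = fun w => f (X ^~ w).
  by apply/funext => w; rewrite big_cons.
split => //; rewrite big_cons -ePi.
rewrite [LHS]/Rintegral (decouple mX indX (pred1 j) mf) //.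
rewrite (eq_integral (fun w => ((\int[P]_w g j (X j w)) * Pi (X ^~ w))%:E)).
  by rewrite -/(Rintegral _ _ _) RintegralZl.
move=> w _; under eq_integral do rewrite fE.
rewrite -RintegralZr // EFin_Rintegral //.
by under eq_fun do rewrite mulrC; exact: integrableE_Z.
Qed.

Lemma indep_bigprod :
  P.-integrable setT (EFin \o (fun w => \prod_i g i (X i w))) /\
  \int[P]_w (\prod_i g i (X i w)) = \prod_i \int[P]_w g i (X i w).
Proof. exact: indep_prod (index_enum_uniq I). Qed.

End IndependentProducts.

(** * Variance of quadratic forms in a random tensor *)

Section TensorVariance.
Variables (R : realType) (dT : measure_display) (T : measurableType dT).
Variables (P : probability T R) (n d : nat) (xi : 'I_n -> T -> R) (K : R).
Hypotheses (mxi : forall i, measurable_fun setT (xi i)) (indxi : mutually_independent P xi).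
Hypothesis i4 : forall i, P.-integrable setT (EFin \o (fun w => xi i w ^+ 4)).
Hypothesis e1 : forall i, \int[P]_w xi i w = 0.
Hypothesis e2 : forall i, \int[P]_w (xi i w ^+ 2) = 1.
Hypothesis e4 : forall i, \int[P]_w (xi i w ^+ 4) <= K.
Hypothesis K1 : 1 <= K.

Lemma norm_pow_le (k : nat) (x : R) : (k <= 4)%N -> `|x ^+ k| <= 1 + x ^+ 4.
Proof.
move=> k4; rewrite normrX -[x ^+ 4]ger0_norm; last first.
  by rewrite -[4%N]/(2 * 2)%N exprM sqr_ge0.
rewrite normrX; have [x1|x1] := lerP `|x| 1.
  by rewrite (le_trans (exprn_ile1 k (normr_ge0 _) x1)) // lerDl exprn_ge0.
by apply: ler_wpDl => //; rewrite ler_weXn2l // ltW.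
Qed.

Lemma integrable_pow i k : (k <= 4)%N ->
  P.-integrable setT (EFin \o (fun w => xi i w ^+ k)).
Proof.
move=> k4; apply: (@le_integrable _ _ _ _ _ _ _ (EFin \o (fun w => 1 + xi i w ^+ 4))) => //.
- by apply/measurable_EFinP; exact: measurable_funX.
- by move=> w _; rewrite lee_fin (le_trans (norm_pow_le _ k4)) // ler_norm.
- by apply: integrableE_D => //; exact: integrableE_cst.
Qed.

Definition moment i k := \int[P]_w (xi i w ^+ k).

Lemma moment0 i : moment i 0 = 1.
Proof. by rewrite -[RHS](Rintegral_cst1 P); apply: eq_Rintegral => w _; rewrite expr0. Qed.

Lemma moment1 i : moment i 1 = 0.
Proof. by rewrite -(e1 i); apply: eq_Rintegral => w _; rewrite expr1. Qed.

Lemma moment4_ge1 i : 1 <= moment i 4.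
Proof.
have i2 : P.-integrable setT (EFin \o (fun w => 2 * xi i w ^+ 2)).
  by apply: integrableE_Z; exact: integrable_pow.
have i1 := integrableE_cst P 1.
have : \int[P]_w (2 * xi i w ^+ 2 - 1) = 1.
  rewrite RintegralB // RintegralZl ?integrable_pow // e2 Rintegral_cst1; lra.
move=> {1}<-; apply: le_Rintegral => //; first exact: integrableE_B.
move=> w _; rewrite -subr_ge0.
have -> : xi i w ^+ 4 - (2 * xi i w ^+ 2 - 1) = (xi i w ^+ 2 - 1) ^+ 2 by ring.
exact: sqr_ge0.
Qed.

Lemma moment_le i k : (k <= 4)%N -> `|moment i k| <= mweight K k.
Proof.
case: k => [|[|[|[|[|k]]]]] //= k4; rewrite ?moment0 ?moment1 /moment.
- by rewrite normr1.
- by rewrite normr0.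
- by rewrite e2 normr1.
- have i24 : P.-integrable setT (EFin \o (fun w => xi i w ^+ 2 + xi i w ^+ 4)).
    by apply: integrableE_D => //; exact: integrable_pow.
  (* The squares of a + a^2 and a - a^2 give 2 |a^3| <= a^2 + a^4, hence |E x^3| <= (1 + K)/2 <=
     K. *)
  have hb (a : R) : - (a ^+ 2 + a ^+ 4) <= 2 * a ^+ 3 <= a ^+ 2 + a ^+ 4.
    apply/andP; split; rewrite -subr_ge0.
      have -> : 2 * a ^+ 3 - - (a ^+ 2 + a ^+ 4) = (a + a ^+ 2) ^+ 2 by ring.
      exact: sqr_ge0.
    have -> : a ^+ 2 + a ^+ 4 - 2 * a ^+ 3 = (a - a ^+ 2) ^+ 2 by ring.
    exact: sqr_ge0.
  have i3 := integrable_pow i (k := 3) isT.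
  have : `|2 * \int[P]_w (xi i w ^+ 3)| <= \int[P]_w (xi i w ^+ 2 + xi i w ^+ 4).
    rewrite -RintegralZl // (le_trans (le_normr_Rintegral _ _)) //.
      exact: integrableE_Z.
    apply: le_Rintegral => //.
      by apply: integrable_norm; exact: integrableE_Z.
    by move=> w _; rewrite ler_norml hb.
  rewrite RintegralD //; last exact: integrable_pow.
  rewrite e2 normrM (ger0_norm (ler0n _ 2)); have := e4 i; have := K1.
  by set z := `|_|; set z4 := Rintegral _ _ _ => h1 h2 h3; lra.
- by rewrite ger0_norm // (le_trans _ (moment4_ge1 i)).
Qed.

Definition tens (v : 'I_n -> R) (S : {set 'I_n}) : R := \prod_(i in S) v i.

Definition mult4 (I J A B : {set 'I_n}) (i : 'I_n) : nat :=
  ((i \in I) + (i \in J) + (i \in A) + (i \in B))%N.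

Lemma mult4_le I J A B i : (mult4 I J A B i <= 4)%N.
Proof. by rewrite /mult4; case: (i \in I); case: (i \in J); case: (i \in A); case: (i \in B). Qed.

Lemma tens_mul4 v I J A B :
  tens v I * tens v J * (tens v A * tens v B) = \prod_i v i ^+ mult4 I J A B i.
Proof.
rewrite /tens big_mkcond [X in _ * X * _]big_mkcond [X in _ * (X * _)]big_mkcond.
rewrite [X in _ * (_ * X)]big_mkcond -!big_split /=; apply: eq_bigr => i _.
rewrite /mult4 !exprD.
by case: (i \in I); case: (i \in J); case: (i \in A); case: (i \in B); rewrite /= ?mulrA.
Qed.

Local Notation t w := (tens (xi ^~ w)).

Lemma tens_moment4 I J A B :
  P.-integrable setT (EFin \o (fun w => t w I * t w J * (t w A * t w B))) /\
  \int[P]_w (t w I * t w J * (t w A * t w B)) = \prod_i moment i (mult4 I J A B i).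
Proof.
have -> : (fun w => t w I * t w J * (t w A * t w B)) =
    fun w => \prod_i xi i w ^+ mult4 I J A B i.
  by apply/funext => w; rewrite tens_mul4.
apply: (@indep_bigprod _ _ _ _ _ _ mxi indxi (fun i x => x ^+ mult4 I J A B i)) => i.
  exact: measurable_funX.
exact: integrable_pow (mult4_le _ _ _ _ _).
Qed.

Lemma tens_moment4_le I J A B :
  `|\int[P]_w (t w I * t w J * (t w A * t w B))| <= tweight K I J A B.
Proof.
rewrite (tens_moment4 I J A B).2 normr_prod; apply: ler_prod => i _.
by rewrite normr_ge0 /= moment_le // mult4_le.
Qed.

(** All exponents are 0, 2 or 4, and E x^4 >= 1. Diagonal covariances are therefore nonnegative, so
    that the subtracted 1 survives the absolute value in [tens_cov_le]. *)
Lemma tens_moment4_diag_ge1 I A : 1 <= \int[P]_w (t w I * t w I * (t w A * t w A)).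
Proof.
rewrite (tens_moment4 I I A A).2 -[leLHS](big1_eq (R := R) (op := *%R) (index_enum 'I_n) xpredT).
apply: ler_prod => i _; rewrite ler01 /= /mult4.
by case: (i \in I); case: (i \in A); rewrite /= ?moment0 ?moment4_ge1 // /moment e2.
Qed.

Lemma tens_set0 v : tens v finset.set0 = 1.
Proof. by rewrite /tens finset.big_set0. Qed.

(** Orthonormality of the tensor entries, obtained from the fourth moments with A and B empty. *)
Lemma tens_moment2 I J :
  P.-integrable setT (EFin \o (fun w => t w I * t w J)) /\
  \int[P]_w (t w I * t w J) = (I == J)%:R.
Proof.
have [ii ee] := tens_moment4 I J finset.set0 finset.set0.
have tE : (fun w => t w I * t w J * (t w finset.set0 * t w finset.set0)) = fun w => t w I * t w J.
  by apply/funext => w; rewrite !tens_set0 !mulr1.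
rewrite tE in ii ee; split=> //; rewrite ee.
case: (eqVneq I J) => [->|nIJ].
  apply: big1 => i _; rewrite /mult4 !inE; case: (i \in J); first exact: e2.
  exact: moment0.
have [i ij] : exists i, (i \in I) != (i \in J).
  by apply/existsP; apply: contraNT nIJ; rewrite negb_exists => /forallP h;
    apply/eqP/finset.setP => i; have := h i; rewrite negbK => /eqP.
apply/eqP; rewrite prodf_seq_eq0; apply/hasP; exists i; rewrite ?mem_index_enum //=.
rewrite /mult4 !inE !addn0; move: ij.
by case: (i \in I); case: (i \in J) => //= _; rewrite moment1.
Qed.

Let p := #|dsubsets n d|.
Let S (a : 'I_p) : {set 'I_n} := enum_val a.

Lemma card_dsubset a : #|S a| = d.
Proof. by have := enum_valP a; rewrite inE => /eqP. Qed.

Let pr := ('I_p * 'I_p)%type.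
Let Z (c : pr) w := t w (S c.1) * t w (S c.2) - (c.1 == c.2)%:R.

Definition tens_cov (c c' : pr) : R := \int[P]_w (Z c w * Z c' w).

Lemma tens_cov_props c c' : P.-integrable setT (EFin \o (fun w => Z c w * Z c' w)) /\
  tens_cov c c' = \int[P]_w (t w (S c.1) * t w (S c.2) * (t w (S c'.1) * t w (S c'.2)))
    - ((c.1 == c.2) && (c'.1 == c'.2))%:R.
Proof.
have SE (a b : 'I_p) : (a == b) = (S a == S b) by rewrite (inj_eq enum_val_inj).
have [i44 e44] := tens_moment4 (S c.1) (S c.2) (S c'.1) (S c'.2).
have [i2 m2] := tens_moment2 (S c.1) (S c.2).
have [i2' m2'] := tens_moment2 (S c'.1) (S c'.2).
rewrite -SE in m2; rewrite -SE in m2'.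
rewrite /tens_cov.
have -> : (fun w => Z c w * Z c' w) = fun w =>
    t w (S c.1) * t w (S c.2) * (t w (S c'.1) * t w (S c'.2)) -
    ((c'.1 == c'.2)%:R * (t w (S c.1) * t w (S c.2)) +
     ((c.1 == c.2)%:R * (t w (S c'.1) * t w (S c'.2)) -
     (c.1 == c.2)%:R * (c'.1 == c'.2)%:R)).
  by apply/funext => w; rewrite /Z; ring.
set d1 := (c.1 == c.2)%:R; set d2 := (c'.1 == c'.2)%:R.
have ia : P.-integrable setT (EFin \o (fun w => d2 * (t w (S c.1) * t w (S c.2)))).
  exact: integrableE_Z.
have ib : P.-integrable setT (EFin \o (fun w => d1 * (t w (S c'.1) * t w (S c'.2)) - d1 * d2)).
  by apply: integrableE_B; [exact: integrableE_Z|exact: integrableE_cst].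
split; first by apply: integrableE_B => //; exact: integrableE_D.
rewrite RintegralB //; last exact: integrableE_D.
rewrite RintegralD // RintegralB //; [|exact: integrableE_Z|exact: integrableE_cst].
rewrite (Rintegral_cst1 P (d1 * d2)) RintegralZl // m2 RintegralZl // m2' -/d1 -/d2.
have -> : ((c.1 == c.2) && (c'.1 == c'.2))%:R = d1 * d2 :> R by rewrite -natrM mulnb.
by ring.
Qed.

Lemma tens_cov_le c c' : `|tens_cov c c'| <=
  tweight K (S c.1) (S c.2) (S c'.1) (S c'.2)
   - ((S c.1 == S c.2) && (S c'.1 == S c'.2))%:R.
Proof.
rewrite (tens_cov_props c c').2 !(inj_eq enum_val_inj).
have := tens_moment4_le (S c.1) (S c.2) (S c'.1) (S c'.2).
case: (eqVneq c.1 c.2) => [->|_]; last by rewrite !subr0.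
case: (eqVneq c'.1 c'.2) => [->|_]; last by rewrite !subr0.
rewrite /=; have := tens_moment4_diag_ge1 (S c.2) (S c'.2).
set x := Rintegral _ _ _ => x1; rewrite !ger0_norm ?subr_ge0 //; last by lra.
by rewrite lerD2r.
Qed.

Lemma tens_covC c c' : tens_cov c c' = tens_cov c' c.
Proof. by apply: eq_Rintegral => w _; rewrite mulrC. Qed.

Variable y : R.
Hypotheses (dn : (d < n)%N) (y0 : 0 <= y) (yq : y ^+ 2 = dratio R n d).
Hypothesis small : 2 * y + K * y ^+ 2 <= 1.

Lemma tens_cov_row c : \sum_c' `|tens_cov c c'| <= 'C(n, d)%:R * tensor_eps n K d y.
Proof.
apply: le_trans (tweight_row K1 dn y0 yq (card_dsubset c.1) (card_dsubset c.2) small).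
apply: le_trans (ler_sum _ (fun c' _ => tens_cov_le c c')) _.
pose h (c' : pr) := (S c'.1, S c'.2).
pose F (X : {set 'I_n} * {set 'I_n}) := tweight K (S c.1) (S c.2) X.1 X.2
   - ((S c.1 == S c.2) && (X.1 == X.2))%:R.
apply: (sum_inj_le (h := h) (F := F) (P := xpredT)) => //.
- by move=> [a b] [a' b'] _ _ [/enum_val_inj -> /enum_val_inj ->].
- by move=> [a b] _; rewrite /h /= !card_dsubset eqxx.
- move=> [A B] /= /andP[cA cB]; rewrite /F /=.
  case: eqP => [E|_]; last by rewrite subr0; exact: tweight_ge0.
  case: eqP => [<-|_]; last by rewrite subr0; exact: tweight_ge0.
  rewrite /= E tweight_diag // subr_ge0 exprn_ege1 //.
Qed.

(** Weigh |u u'| <= (u^2 + u'^2)/2 by |M|; symmetry turns the column sums into row sums. *)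
Lemma schur_test (M : pr -> pr -> R) (u : pr -> R) rho :
  (forall c c', M c c' = M c' c) -> (forall c, \sum_c' `|M c c'| <= rho) ->
  \sum_c \sum_c' u c * u c' * M c c' <= rho * \sum_c u c ^+ 2.
Proof.
move=> Msym Mrow.
apply: le_trans (_ : \sum_c \sum_c' (u c ^+ 2 * `|M c c'| / 2 + u c' ^+ 2 * `|M c' c| / 2) <= _).
  apply: ler_sum => c _; apply: ler_sum => c' _; rewrite (Msym c' c).
  rewrite (le_trans (ler_norm _)) // normrM.
  have h : `|u c * u c'| <= (u c ^+ 2 + u c' ^+ 2) / 2.
    rewrite ler_norml; apply/andP; split.
      by have := sqr_ge0 (u c + u c'); rewrite sqrrD; lra.
    by have := sqr_ge0 (u c - u c'); rewrite sqrrB; lra.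
  apply: le_trans (ler_wpM2r (normr_ge0 _) h) _.
  by rewrite le_eqVlt; apply/orP; left; apply/eqP; ring.
under eq_bigr do rewrite big_split /=.
rewrite big_split /= [X in _ + X]exchange_big /= mulr_sumr -big_split /=.
apply: ler_sum => c _; rewrite -!mulr_suml -!mulr_sumr -splitr mulrC.
by rewrite ler_wpM2r ?sqr_ge0.
Qed.

(** The deviation is linear in the centred products [Z], with coefficients A_ab. Its second moment
    is the covariance form evaluated at A, to which the Schur test applies. *)
Lemma tensor_quadf_variance (A : 'M[R]_p) :
  (\int[P]_w ((quadf A (\col_a t w (S a)) - \tr A) ^+ 2)%:E <=
   ('C(n, d)%:R * tensor_eps n K d y * \sum_a \sum_b A a b ^+ 2)%:E)%E.
Proof.
pose u (c : pr) := A c.1 c.2.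
have qE w : quadf A (\col_a t w (S a)) - \tr A = \sum_c u c * Z c w.
  rewrite /quadf mxE -(pair_big xpredT xpredT (fun a b => A a b *
    (t w (S a) * t w (S b) - (a == b)%:R))) /=.
  have -> : \tr A = \sum_a \sum_b A a b * (a == b)%:R.
    apply: eq_bigr => a _; rewrite (bigD1 a) //= eqxx mulr1 big1 ?addr0 // => b.
    by rewrite eq_sym => /negbTE ->; rewrite mulr0.
  under eq_bigr do rewrite !mxE mulr_suml.
  rewrite exchange_big /= -sumrB; apply: eq_bigr => a _; rewrite -sumrB.
  by apply: eq_bigr => b _; rewrite !mxE; ring.
have qE2 w : (quadf A (\col_a t w (S a)) - \tr A) ^+ 2 =
    \sum_c \sum_c' u c * u c' * (Z c w * Z c' w).
  rewrite qE expr2 mulr_suml; apply: eq_bigr => c _; rewrite mulr_sumr.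
  by apply: eq_bigr => c' _; ring.
have ii c c' : P.-integrable setT (EFin \o (fun w => u c * u c' * (Z c w * Z c' w))).
  by apply: integrableE_Z; have [] := tens_cov_props c c'.
under eq_integral do rewrite qE2.
rewrite -EFin_Rintegral; last by apply: integrableE_sum => c _; exact: integrableE_sum.
rewrite lee_fin Rintegral_sum; last by move=> c _; exact: integrableE_sum.
under eq_bigr do rewrite Rintegral_sum //.
under eq_bigr do under eq_bigr do rewrite RintegralZl ?(tens_cov_props _ _).1 //.
apply: le_trans (schur_test u tens_covC tens_cov_row) _.
by rewrite (pair_big xpredT xpredT (fun a b => A a b ^+ 2)).
Qed.

End TensorVariance.

(** * The Stieltjes transform of the Marchenko-Pastur law *)

Section SemicircleIntegral.
Variable R : realType.
Implicit Types (r A u : R).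

(** Continuity up to the endpoints, obtained by inverting sin on a closed interval; the primitive
    below is evaluated at u = -r and u = r, where asin is not differentiable. *)
Lemma asin_within (x : R) : -1 <= x <= 1 ->
  asin y @[y --> within [set y | -1 <= y <= 1] (nbhs x)] --> asin x.
Proof.
move=> x1.
have pi0 : - (pi / 2) <= pi / 2 :> R by have := pi_gt0 R; lra.
have cs : {within `[- (pi / 2), pi / 2], continuous (@sin R)}.
  by apply: continuous_subspaceT => y; exact: continuous_sin.
have := segment_can_le_continuous pi0 cs (@sinK R).
rewrite sinN sin_pihalf => /subspace_continuousP/(_ x).
have -> : [set` `[(-1 : R), 1]] = [set y | -1 <= y <= 1].
  by apply/seteqP; split=> y /=; rewrite in_itv.
by apply.
Qed.

Lemma cvg_asin_comp (F : set_system R) (FF : Filter F) (k : R -> R) (x : R) :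
  -1 <= x <= 1 -> k y @[y --> F] --> x -> (\forall y \near F, -1 <= k y <= 1) ->
  asin (k y) @[y --> F] --> asin x.
Proof.
move=> x1 kx knear; apply: cvg_comp (asin_within x1) => U /= /kx.
by apply: filterS2 knear => y ky; exact.
Qed.

Section primitive.
Variables (r A : R).
Hypotheses (r0 : 0 < r) (rA : r < A).

Let B := Num.sqrt (A ^+ 2 - r ^+ 2).
Let B2 : B ^+ 2 = A ^+ 2 - r ^+ 2.
Proof. by rewrite sqr_sqrtr // subr_ge0 ler_sqr ?nnegrE; have := r0; have := rA; lra. Qed.
Let B0 : 0 < B.
Proof. by rewrite sqrtr_gt0 subr_gt0 ltr_sqr ?nnegrE; have := r0; have := rA; lra. Qed.

Definition arcratio u := (r ^+ 2 + A * u) / (r * (u + A)).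

(** Write s = sqrt(r^2 - u^2). As s^2 = (A - u)(A + u) - B^2, the integrand s/(u + A) is (A - u)/s
    minus B^2/((u + A) s). The first two terms integrate the former; the last integrates the latter
    through the Moebius map [arcratio]. *)
Definition semicircle_primitive u :=
  Num.sqrt (r ^+ 2 - u ^+ 2) + A * asin (u / r) - B * asin (arcratio u).

Lemma semicircle_derive u : -r < u < r ->
  is_derive u 1 semicircle_primitive (Num.sqrt (r ^+ 2 - u ^+ 2) / (u + A)).
Proof.
move=> /andP[u1 u2]; have := r0; have := rA => rA' r0'.
have uA : 0 < u + A by lra.
have s2 : 0 < r ^+ 2 - u ^+ 2.
  by rewrite subr_sqr mulr_gt0; lra.
pose s := Num.sqrt (r ^+ 2 - u ^+ 2).
have s0 : 0 < s by rewrite sqrtr_gt0.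
have sE : s ^+ 2 = r ^+ 2 - u ^+ 2 by rewrite sqr_sqrtr // ltW.
have d1 : is_derive u 1 (fun u => r ^+ 2 - u ^+ 2) (- (2 * u)).
  apply: is_derive_eq; rewrite /GRing.scale /= /cst /=; ring.
have d2 : is_derive u 1 (fun u => Num.sqrt (r ^+ 2 - u ^+ 2)) (- u / s).
  have h := @is_derive1_comp _ Num.sqrt (fun u => r ^+ 2 - u ^+ 2) u _ _ (is_derive1_sqrt s2) d1.
  apply: (is_derive_eq h).
  by rewrite -/s; field; exact: lt0r_neq0.
have d3 : is_derive u 1 (fun u => u / r) r^-1.
  by apply: is_derive_eq; rewrite /GRing.scale /=; ring.
have ur1 : -1 < u / r < 1 by rewrite ltr_pdivrMr // ltr_pdivlMr // mulN1r mul1r u1.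
have d4 : is_derive u 1 (fun u => asin (u / r)) s^-1.
  have h := @is_derive1_comp _ asin (fun u => u / r) u _ _ (is_derive1_asin ur1) d3.
  apply: (is_derive_eq h).
  have -> : 1 - (u / r) ^+ 2 = (r ^+ 2 - u ^+ 2) / r ^+ 2 by field; exact: lt0r_neq0.
  rewrite sqrtrM ?ltW // sqrtrV ?sqr_ge0 // sqrtr_sqr gtr0_norm // -/s.
  by field; rewrite !lt0r_neq0.
have d5 : is_derive u 1 arcratio (B ^+ 2 / (r * (u + A) ^+ 2)).
  have n0 : r * (u + A) != 0 by rewrite mulf_neq0 ?lt0r_neq0.
  have da : is_derive u 1 (fun u => r ^+ 2 + A * u) A.
    by apply: is_derive_eq; rewrite /GRing.scale /=; ring.
  have db : is_derive u 1 (fun u => r * (u + A)) r.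
    by apply: is_derive_eq; rewrite /GRing.scale /=; ring.
  have dc := @is_deriveV _ (fun u => r * (u + A)) u _ _ n0 db.
  apply: (is_derive_eq (is_deriveM da dc)).
  rewrite /GRing.scale /= B2; field.
  by rewrite !lt0r_neq0.
(* The identity r^2 (u + A)^2 - (r^2 + A u)^2 = (A^2 - r^2)(r^2 - u^2). *)
have hE : 1 - arcratio u ^+ 2 = B ^+ 2 * s ^+ 2 / (r * (u + A)) ^+ 2.
  by rewrite sE B2 /arcratio; field; rewrite !lt0r_neq0.
have h1 : -1 < arcratio u < 1.
  rewrite -ltr_norml -(ltr_sqr (normr_ge0 _)) ?nnegrE // real_normK ?num_real //.
  by rewrite expr1n -subr_gt0 hE divr_gt0 ?mulr_gt0 ?exprn_gt0 ?mulr_gt0.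
have d6 : is_derive u 1 (fun u => asin (arcratio u)) (B / ((u + A) * s)).
  have h := @is_derive1_comp _ asin arcratio u _ _ (is_derive1_asin h1) d5.
  apply: (is_derive_eq h).
  have p0 : 0 < r * (u + A) by rewrite mulr_gt0.
  rewrite hE -exprMn sqrtrM ?sqr_ge0 // sqrtrV ?sqr_ge0 // !sqrtr_sqr.
  rewrite !gtr0_norm // ?mulr_gt0 //.
  by field; rewrite !lt0r_neq0.
have := is_deriveB (is_deriveD d2 (is_deriveZ A d4)) (is_deriveZ B d6).
move=> h; apply: (is_derive_eq h); rewrite /GRing.scale /= -/s.
apply: (@mulIf _ ((u + A) * s)); first by rewrite mulf_neq0 ?lt0r_neq0.
have -> : s / (u + A) * ((u + A) * s) = s ^+ 2 by field; exact: lt0r_neq0.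
have -> : (- u / s + A / s - B * (B / ((u + A) * s))) * ((u + A) * s) =
   (A - u) * (A + u) - B ^+ 2 by field; rewrite !lt0r_neq0.
by rewrite B2 sE; ring.
Qed.
Lemma arcratio_bound u : - r <= u <= r -> -1 <= arcratio u <= 1.
Proof.
move=> /andP[u1 u2]; have := r0; have := rA => rA' r0'.
have uA : 0 < u + A by lra.
have p0 : 0 < r * (u + A) by rewrite mulr_gt0.
rewrite /arcratio ler_pdivrMr // ler_pdivlMr // mulN1r mul1r.
have h1 : 0 <= (A - r) * (r - u) by rewrite mulr_ge0; lra.
have h2 : 0 <= (A + r) * (r + u) by rewrite mulr_ge0; lra.
apply/andP; split; lra.
Qed.

Lemma semicircle_primitive_cvg (F : set_system R) (FF : Filter F) (c x0 : R) :
  - r <= x0 - c <= r -> x @[x --> F] --> x0 ->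
  (\forall x \near F, - r <= x - c <= r) ->
  semicircle_primitive (x - c) @[x --> F] --> semicircle_primitive (x0 - c).
Proof.
move=> x0r Fx0 nr; have := r0; have := rA => rA' r0'.
have cu : x - c @[x --> F] --> x0 - c by apply: cvgB => //; exact: cvg_cst.
have cA : 0 < x0 - c + A by move/andP: x0r => [? ?]; lra.
apply: cvgB; first apply: cvgD.
- apply: (cvg_comp (fun x => r ^+ 2 - (x - c) ^+ 2)); last exact: sqrt_continuous.
  by apply: cvgB; [exact: cvg_cst|rewrite expr2; under eq_fun do rewrite expr2; exact: cvgM].
- apply: cvgM; first exact: cvg_cst.
  apply: cvg_asin_comp.
  + by rewrite ler_pdivrMr // ler_pdivlMr // mulN1r mul1r.
  + by apply: cvgM => //; exact: cvg_cst.
  + by apply: filterS nr => x xr; rewrite ler_pdivrMr // ler_pdivlMr // mulN1r mul1r.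
- apply: cvgM; first exact: cvg_cst.
  apply: cvg_asin_comp.
  + exact: arcratio_bound.
  + rewrite /arcratio; apply: cvgM.
      by apply: cvgD; [exact: cvg_cst|apply: cvgM => //; exact: cvg_cst].
    apply: cvgV; first by rewrite mulf_neq0 ?lt0r_neq0.
    by apply: cvgM; [exact: cvg_cst|apply: cvgD => //; exact: cvg_cst].
  + by apply: filterS nr => x; exact: arcratio_bound.
Qed.

Lemma semicircle_primitive_right : semicircle_primitive r = (A - B) * (pi / 2).
Proof.
have := r0; have := rA => rA' r0'.
have a1 : asin 1 = pi / 2 :> R.
  have h : (pi / 2 : R) \in `[- (pi / 2), pi / 2].
    by rewrite in_itv /=; have := pi_gt0 R; lra.
  by have := sinK h; rewrite sin_pihalf.
rewrite /semicircle_primitive /arcratio subrr sqrtr0 add0r divff ?lt0r_neq0 //.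
have -> : (r ^+ 2 + A * r) / (r * (r + A)) = 1 by field; rewrite !lt0r_neq0 //; lra.
by rewrite a1; ring.
Qed.

Lemma semicircle_primitive_left : semicircle_primitive (- r) = - ((A - B) * (pi / 2)).
Proof.
have := r0; have := rA => rA' r0'.
have a1 : asin (-1) = - (pi / 2) :> R.
  have h : (- (pi / 2) : R) \in `[- (pi / 2), pi / 2].
    by rewrite in_itv /=; have := pi_gt0 R; lra.
  by have := sinK h; rewrite sinN sin_pihalf.
rewrite /semicircle_primitive /arcratio sqrrN subrr sqrtr0 add0r mulNr divff ?lt0r_neq0 //.
have -> : (r ^+ 2 + A * - r) / (r * (- r + A)) = -1.
  by field; rewrite !lt0r_neq0 //; lra.
by rewrite a1; ring.
Qed.

Lemma semicircle_integral (c : R) :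
  (\int[lebesgue_measure]_(x in `[(c - r)%R, (c + r)%R])
     (Num.sqrt (r ^+ 2 - (x - c) ^+ 2) / (x - c + A))%:E =
   (pi * (A - Num.sqrt (A ^+ 2 - r ^+ 2)))%:E)%E.
Proof.
have := r0; have := rA => rA' r0'.
have crr : c - r < c + r by lra.
rewrite (@continuous_FTC2 _ _ (fun x => semicircle_primitive (x - c))) //.
- have -> : c + r - c = r by ring.
  have -> : c - r - c = - r by ring.
  rewrite semicircle_primitive_right semicircle_primitive_left -EFinB; congr EFin.
  by rewrite -/B; field.
- apply: continuous_in_subspaceT => x /set_mem /=; rewrite in_itv /= => /andP[x1 x2].
  have cu : {for x, continuous (fun x => x - c)}.
    by apply: cvgB; [exact: cvg_id|exact: cvg_cst].
  apply: cvgM.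
    apply: (cvg_comp (fun x => r ^+ 2 - (x - c) ^+ 2)); last exact: sqrt_continuous.
    by apply: cvgB; [exact: cvg_cst|rewrite expr2; under eq_fun do rewrite expr2; exact: cvgM].
  apply: cvgV; first by apply: lt0r_neq0; lra.
  by apply: cvgD => //; exact: cvg_cst.
- split.
  + move=> x; rewrite in_itv /= => /andP[x1 x2].
    have xr : - r < x - c < r by lra.
    have ds : is_derive x 1 (fun x => x - c) 1.
      by apply: is_derive_eq; rewrite /=; ring.
    have := @is_derive1_comp _ semicircle_primitive (fun x => x - c) x _ _
      (semicircle_derive xr) ds.
    by case.
  + apply: semicircle_primitive_cvg; first lra.
      by apply: cvg_at_right_filter; exact: cvg_id.
    near=> x; have : c - r < x by near: x; exact: nbhs_right_gt.
    have : x < c + r by near: x; exact: nbhs_right_lt.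
    lra.
  + apply: semicircle_primitive_cvg; first lra.
      by apply: cvg_at_left_filter; exact: cvg_id.
    near=> x; have : c - r < x by near: x; exact: nbhs_left_gt.
    have : x < c + r by near: x; exact: nbhs_left_lt.
    lra.
- move=> x; rewrite in_itv /= => /andP[x1 x2].
  have xr : - r < x - c < r by lra.
  have ds : is_derive x 1 (fun x => x - c) 1.
    by apply: is_derive_eq; rewrite /=; ring.
  have h := @is_derive1_comp _ semicircle_primitive (fun x => x - c) x _ _
    (semicircle_derive xr) ds.
  by rewrite derive1E (@derive_val _ _ _ _ _ _ _ h) mulr1.
Unshelve. all: by end_near.
Qed.

End primitive.
End SemicircleIntegral.

Lemma measurable_funV (R : realType) : measurable_fun setT (@GRing.inv R).
Proof.
have -> : [set: R] = [set x | x != 0] `|` [set 0].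
  by apply/seteqP; split=> x //= _; case: (eqVneq x 0); [right|left].
apply/measurable_funU => //.
  by apply: open_measurable; exact: open_neq.
split; last by apply: measurable_fun_set1.
apply: open_continuous_measurable_fun; first exact: open_neq.
by move=> x; rewrite inE /= => x0; exact: inv_continuous.
Qed.

Section MarchenkoPastur.
Variable R : realType.
Variable lam : R.
Hypothesis lam0 : 0 < lam.

Let lp : R := (1 + Num.sqrt lam) ^+ 2.
Let lm : R := (1 - Num.sqrt lam) ^+ 2.
Let c : R := 1 + lam.
Let r : R := 2 * Num.sqrt lam.
Local Notation mu := lebesgue_measure.

Definition mp_root (x : R) : R := Num.sqrt (Num.max 0 ((lp - x) * (x - lm))).

Let sq2 : Num.sqrt lam ^+ 2 = lam. Proof. by rewrite sqr_sqrtr // ltW. Qed.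
Let r0 : 0 < r. Proof. by rewrite mulr_gt0 // sqrtr_gt0. Qed.
Let r2 : r ^+ 2 = 4 * lam. Proof. by rewrite /r exprMn sq2; congr (_ * _); ring. Qed.
Let lmE : lm = c - r. Proof. by rewrite /lm /c /r -{2}sq2; ring. Qed.
Let lpE : lp = c + r. Proof. by rewrite /lp /c /r -{2}sq2; ring. Qed.
Let lm0 : 0 <= lm. Proof. exact: sqr_ge0. Qed.

Lemma mp_root_ge0 x : 0 <= mp_root x.
Proof. exact: sqrtr_ge0. Qed.

Lemma mp_root_in x : lm <= x <= lp -> mp_root x = Num.sqrt (r ^+ 2 - (x - c) ^+ 2).
Proof.
move=> /andP[x1 x2]; rewrite /mp_root; congr Num.sqrt.
rewrite max_r; first by rewrite lpE lmE; ring.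
by rewrite mulr_ge0 // subr_ge0.
Qed.

Lemma mp_root_out x : ~~ (lm < x < lp) -> mp_root x = 0.
Proof.
move=> h; rewrite /mp_root max_l ?sqrtr0 //; move: h; rewrite negb_and -!leNgt.
have lmp : lm <= lp by rewrite lmE lpE; have := r0; lra.
move=> /orP[h|h].
  by rewrite mulr_ge0_le0 // ?subr_ge0 ?subr_le0 // (le_trans h).
by rewrite mulr_le0_ge0 // ?subr_ge0 ?subr_le0 // (le_trans lmp).
Qed.

Lemma mp_root_gt0 x : mp_root x != 0 -> 0 < x.
Proof.
move=> h; have : lm < x < lp by apply: contraNT h => /mp_root_out ->; rewrite eqxx.
by move=> /andP[h1 _]; exact: le_lt_trans h1.
Qed.

Lemma measurable_mp_root : measurable_fun setT mp_root.
Proof.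
apply: measurableT_comp; first exact: continuous_measurable_fun (@sqrt_continuous R).
apply: measurable_maxr => //; apply: measurable_funM; first exact: measurable_funB.
exact: measurable_funB.
Qed.

Lemma mp_root_integral (t : R) : 0 < t ->
  (\int[mu]_x (mp_root x / (x + t))%:E =
   (pi * (c + t - Num.sqrt ((c + t) ^+ 2 - r ^+ 2)))%:E)%E.
Proof.
move=> t0.
have rA : r < c + t by have := lm0; rewrite lmE; lra.
rewrite -(semicircle_integral r0 rA c) -lmE -lpE [RHS]integral_mkcond.
apply: eq_integral => x _; rewrite patchE; case: ifPn => [|h].
  rewrite inE /= in_itv /= => h; rewrite mp_root_in //; congr (_ / _)%:E; ring.
rewrite mp_root_out ?mul0r //; apply: contra h => /andP[h1 h2].
by rewrite inE /= in_itv /= !ltW.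
Qed.

Lemma mp_ratio_ge0 x (t : R) : 0 <= t -> 0 <= mp_root x / (x + t).
Proof.
move=> t0; have [->|/mp_root_gt0 x0] := eqVneq (mp_root x) 0; first by rewrite mul0r.
by rewrite divr_ge0 ?mp_root_ge0 // addr_ge0 // ltW.
Qed.

Lemma mp_ratio0_ge0 x : 0 <= mp_root x / x.
Proof. by have := mp_ratio_ge0 x (lexx 0); rewrite addr0. Qed.

Lemma measurable_mp_ratio (t : R) : measurable_fun setT (fun x => mp_root x / (x + t)).
Proof.
apply: measurable_funM; first exact: measurable_mp_root.
by apply: measurableT_comp; [exact: measurable_funV|exact: measurable_funD].
Qed.

(** A monotone limit t -> 0 of the preceding formula. Direct substitution fails at lam = 1, where A
    = r is excluded from the primitive. In the limit the square root is sqrt(c^2 - r^2) = |1 -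
    lam|. *)
Lemma mp_root_integral0 :
  (\int[mu]_x (mp_root x / x)%:E = (pi * (c - `|1 - lam|))%:E)%E.
Proof.
pose t k : R := k.+1%:R^-1.
have t0 k : 0 < t k by rewrite invr_gt0.
have tcvg : t k @[k --> \oo] --> 0 := cvg_harmonic.
pose g k x := (mp_root x / (x + t k))%:E.
have := @cvg_monotone_convergence _ _ _ mu setT measurableT g.
have -> : (fun x => limn (g ^~ x)) = fun x => (mp_root x / x)%:E.
  apply/funext => x; apply/cvg_lim => //; rewrite /g.
  apply: cvg_EFin; first by near=> k.
  have [x0|/mp_root_gt0 x0] := eqVneq (mp_root x) 0.
    by under eq_fun do rewrite x0 mul0r; rewrite x0 mul0r; exact: cvg_cst.
  apply: cvgM; first exact: cvg_cst.
  apply: cvgV; first exact: lt0r_neq0.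
  by rewrite -[X in _ --> X]addr0; apply: cvgD => //; exact: cvg_cst.
move=> H; have {}H : (\int[mu]_x g k x)%E @[k --> \oo] --> (\int[mu]_x (mp_root x / x)%:E)%E.
  apply: H.
  - by move=> k; apply/measurable_EFinP; exact: measurable_mp_ratio.
  - by move=> k x _; rewrite lee_fin mp_ratio_ge0 // ltW.
  - move=> x _ k l kl; rewrite lee_fin.
    have [->|/mp_root_gt0 x0] := eqVneq (mp_root x) 0; first by rewrite !mul0r.
    rewrite ler_wpM2l ?mp_root_ge0 // lef_pV2 ?posrE ?addr_gt0 // lerD2l.
    by rewrite lef_pV2 ?posrE // ler_nat.
have K : (\int[mu]_x g k x)%E @[k --> \oo] --> (pi * (c - `|1 - lam|))%:E.
  under eq_fun do rewrite mp_root_integral //.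
  apply: cvg_EFin; first by near=> k.
  have ct : c + t k @[k --> \oo] --> c.
    by rewrite -[X in _ --> X]addr0; apply: cvgD => //; exact: cvg_cst.
  apply: cvgM; first exact: cvg_cst.
  apply: cvgB => //.
  have -> : `|1 - lam| = Num.sqrt (c ^+ 2 - r ^+ 2).
    by rewrite -sqrtr_sqr; congr Num.sqrt; rewrite r2 /c; ring.
  apply: (cvg_comp (fun k => (c + t k) ^+ 2 - r ^+ 2)); last exact: sqrt_continuous.
  apply: cvgB; last exact: cvg_cst.
  by rewrite expr2; under eq_fun do rewrite expr2; exact: cvgM.
exact: (cvg_unique _ H K).
Unshelve. all: by end_near.
Qed.

Local Notation rho := (mp_density lam).

Lemma mp_densityE x : rho x = (2 * pi * lam)^-1 * (mp_root x / x).
Proof.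
by rewrite /mp_density [(_ * x)^-1]invfM -[_ / x * _]mulrA (mulrC x^-1).
Qed.

Let pin : pi != 0 :> R. Proof. exact: lt0r_neq0 (pi_gt0 R). Qed.
Let lamn : lam != 0. Proof. exact: lt0r_neq0. Qed.
Let k0 : 0 < 2 * pi * lam. Proof. by rewrite !mulr_gt0 // pi_gt0. Qed.

Lemma mp_density_ge0 x : 0 <= rho x.
Proof.
rewrite mp_densityE; apply: mulr_ge0; first by rewrite invr_ge0 ltW.
exact: mp_ratio0_ge0.
Qed.

Lemma mp_density_lt0 x : x <= 0 -> rho x = 0.
Proof.
move=> x0; rewrite mp_densityE; have [->|/mp_root_gt0] := eqVneq (mp_root x) 0.
  by rewrite mul0r mulr0.
by rewrite ltNge x0.
Qed.

Lemma measurable_mp_density : measurable_fun setT rho.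
Proof.
have -> : rho = fun x => (2 * pi * lam)^-1 * (mp_root x / (x + 0)).
  by apply/funext => x; rewrite mp_densityE addr0.
by apply: measurable_funM => //; exact: measurable_mp_ratio.
Qed.

Lemma mp_density_integral :
  (\int[mu]_x (rho x)%:E = ((2 * lam)^-1 * (c - `|1 - lam|))%:E)%E.
Proof.
under eq_integral do rewrite mp_densityE EFinM.
rewrite ge0_integralZl //; last 3 first.
- apply/measurable_EFinP; have := measurable_mp_ratio 0.
  by under eq_fun do rewrite addr0.
- by move=> x _; rewrite lee_fin mp_ratio0_ge0.
- by rewrite lee_fin invr_ge0 ltW.
rewrite mp_root_integral0 -EFinM; congr EFin.
by move: pin; move: (pi : R) => p pn; field; rewrite pn lamn.
Qed.

Lemma integrable_mp_density : mu.-integrable setT (EFin \o rho).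
Proof.
apply/integrableP; split; first by apply/measurable_EFinP; exact: measurable_mp_density.
under eq_integral do rewrite /= ger0_norm ?mp_density_ge0 //.
by rewrite mp_density_integral ltry.
Qed.

(** Bounded on the half-line only: the law and the eigenvalues live there, while 1/(x + t) blows up
    on the negative axis. *)
Definition mp_good (C : R) (phi : R -> R) : Prop :=
  measurable_fun setT phi /\ forall x, 0 <= x -> `|phi x| <= C.

Lemma integrable_mp C phi : mp_good C phi ->
  mu.-integrable setT (EFin \o (fun x => phi x * rho x)).
Proof.
move=> [mphi phiC].
have iC : mu.-integrable setT (EFin \o (fun x => C * rho x)).
  exact: eq_integrable (integrableZl _ C integrable_mp_density).
apply: le_integrable iC => //.
  by apply/measurable_EFinP; apply: measurable_funM => //; exact: measurable_mp_density.
move=> x _; rewrite lee_fin [leLHS]normrM [leRHS]normrM; have [x0|x0] := leP x 0.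
  by rewrite mp_density_lt0 // normr0 !mulr0.
by rewrite ler_wpM2r // (le_trans (phiC _ (ltW x0))) // ler_norm.
Qed.

Definition mp_atom : R := if 1 < lam then 1 - lam^-1 else 0.

Definition mpL (phi : R -> R) : R := mp_atom * phi 0 + \int[mu]_x (phi x * rho x).

Lemma mp_atom_ge0 : 0 <= mp_atom.
Proof.
rewrite /mp_atom; case: ifP => // l1; rewrite subr_ge0 invf_le1 // ltW //.
Qed.

(** A single formula for both regimes, whose |1 - lam| cancels the one in the mass of the
    density. *)
Lemma mp_atomE : mp_atom = (2 * lam)^-1 * (lam - 1 + `|1 - lam|).
Proof.
rewrite /mp_atom; case: ifPn => l1.
  by rewrite ltr0_norm ?subr_lt0 //; field; exact: lt0r_neq0.
by rewrite ger0_norm ?subr_ge0 1?leNgt //; ring.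
Qed.

Lemma mpL_cst1 : mpL (fun=> 1) = 1.
Proof.
rewrite /mpL mulr1 mp_atomE; under eq_Rintegral do rewrite mul1r.
by rewrite /Rintegral mp_density_integral /= /c; field; exact: lt0r_neq0.
Qed.

Lemma mpLD C C' phi psi : mp_good C phi -> mp_good C' psi ->
  mpL (fun x => phi x + psi x) = mpL phi + mpL psi.
Proof.
move=> gphi gpsi; rewrite /mpL; under eq_Rintegral do rewrite mulrDl.
rewrite RintegralD //; [|exact: integrable_mp gphi|exact: integrable_mp gpsi].
by ring.
Qed.

Lemma mpLZ C a phi : mp_good C phi -> mpL (fun x => a * phi x) = a * mpL phi.
Proof.
move=> gphi; rewrite /mpL; under eq_Rintegral do rewrite -mulrA.
rewrite RintegralZl //; last exact: integrable_mp gphi.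
by ring.
Qed.

Lemma mpL_le C C' phi psi : mp_good C phi -> mp_good C' psi ->
  (forall x, 0 <= x -> phi x <= psi x) -> mpL phi <= mpL psi.
Proof.
move=> gphi gpsi le; rewrite /mpL lerD //; first by rewrite ler_wpM2l ?mp_atom_ge0 // le.
apply: le_Rintegral => //; [exact: integrable_mp gphi|exact: integrable_mp gpsi|].
move=> x _; have [x0|x0] := leP x 0; first by rewrite mp_density_lt0 // !mulr0.
by rewrite ler_wpM2r ?mp_density_ge0 // le // ltW.
Qed.

(** The positive root of lam t s^2 + (t + 1 - lam) s - 1 = 0, whose discriminant is (c + t)^2 - r^2
    = (t + 1 - lam)^2 + 4 lam t. *)
Definition mp_stieltjes (t : R) : R :=
  (lam - 1 - t + Num.sqrt ((c + t) ^+ 2 - r ^+ 2)) / (2 * lam * t).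

Lemma mpL_stieltjes t : 0 < t -> mpL (fun x => (x + t)^-1) = mp_stieltjes t.
Proof.
move=> t0; rewrite /mpL add0r mp_atomE.
(* Partial fractions, 1/(x (x + t)) = (1/x - 1/(x + t))/t; off the support both sides vanish. *)
have E x : (x + t)^-1 * rho x =
    (2 * pi * lam * t)^-1 * (mp_root x / x - mp_root x / (x + t)).
  rewrite mp_densityE; have [->|/mp_root_gt0 x0] := eqVneq (mp_root x) 0.
    by rewrite !mul0r subrr !mulr0.
  move: pin; move: (pi : R) => p pn; field.
  by rewrite pn lamn (lt0r_neq0 t0) (lt0r_neq0 x0) lt0r_neq0 // addr_gt0.
under eq_Rintegral do rewrite E.
have i0 : mu.-integrable setT (EFin \o (fun x => mp_root x / x)).
  apply/integrableP; split.
    apply/measurable_EFinP; have := measurable_mp_ratio 0.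
    by under eq_fun do rewrite addr0.
  under eq_integral do rewrite /= ger0_norm ?mp_ratio0_ge0 //.
  by rewrite mp_root_integral0 ltry.
have it : mu.-integrable setT (EFin \o (fun x => mp_root x / (x + t))).
  apply/integrableP; split; first by apply/measurable_EFinP; exact: measurable_mp_ratio.
  under eq_integral do rewrite /= ger0_norm ?mp_ratio_ge0 ?ltW //.
  by rewrite mp_root_integral // ltry.
have i1 : mu.-integrable setT (EFin \o (fun x => mp_root x / x - mp_root x / (x + t))).
  exact: eq_integrable (integrableB _ i0 it).
rewrite RintegralZl // RintegralB // /Rintegral mp_root_integral0 mp_root_integral //=.
rewrite /mp_stieltjes /c.
by move: pin; move: (pi : R) => p pn; field; rewrite pn lamn (lt0r_neq0 t0).
Qed.

Lemma mp_stieltjes_eq t : 0 < t ->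
  1 - t * mp_stieltjes t = mp_stieltjes t / (1 + lam * mp_stieltjes t).
Proof.
move=> t0; have := lam0 => lam0'.
set D := Num.sqrt ((c + t) ^+ 2 - r ^+ 2).
have pos : 0 < (c + t) ^+ 2 - r ^+ 2.
  have -> : (c + t) ^+ 2 - r ^+ 2 = (t + 1 - lam) ^+ 2 + 4 * lam * t.
    by rewrite r2 /c; ring.
  by rewrite ltr_wpDl ?sqr_ge0 // !mulr_gt0.
have D2 : D ^+ 2 = (t + 1 - lam) ^+ 2 + 4 * lam * t.
  by rewrite sqr_sqrtr ?ltW // r2 /c; ring.
have D0 : 0 < D by rewrite sqrtr_gt0.
have Dt : t + 1 - lam < D.
  have [h|h] := ltP (t + 1 - lam) 0; first exact: lt_trans D0.
  rewrite -ltr_sqr ?nnegrE // ?ltW // D2 ltrDl !mulr_gt0 //.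
have s0 : 0 < mp_stieltjes t.
  by rewrite divr_gt0 ?mulr_gt0 // -/D; lra.
have d0 : 0 < 1 + lam * mp_stieltjes t by rewrite addr_gt0 // mulr_gt0.
apply: (@mulIf _ (1 + lam * mp_stieltjes t)); first exact: lt0r_neq0.
rewrite divfK ?lt0r_neq0 //.
apply/eqP; rewrite -subr_eq0; apply/eqP.
have -> : (1 - t * mp_stieltjes t) * (1 + lam * mp_stieltjes t) - mp_stieltjes t =
   ((t + 1 - lam) ^+ 2 + 4 * lam * t - D ^+ 2) / (4 * lam * t).
  by rewrite /mp_stieltjes -/D; field; rewrite !lt0r_neq0.
by rewrite D2 subrr mul0r.
Qed.

Lemma mp_stieltjes_ge0 t : 0 < t -> 0 <= mp_stieltjes t.
Proof.
move=> t0; rewrite -mpL_stieltjes // /mpL add0r addr_ge0 //.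
  by rewrite mulr_ge0 ?mp_atom_ge0 // invr_ge0 ltW.
apply: Rintegral_ge0 => x _; have [x0|x0] := leP x 0; first by rewrite mp_density_lt0 // mulr0.
by rewrite mulr_ge0 ?mp_density_ge0 // invr_ge0 addr_ge0 // ltW.
Qed.

Lemma mp_good_le (tau : R) : mp_good 1 (fun x => (x <= tau)%R%:R).
Proof.
split; last by move=> x _; case: (x <= tau); rewrite ?normr1 ?normr0.
have -> : (fun x => (x <= tau)%R%:R) = \1_(`]-oo, tau]) :> (R -> R).
  apply/funext => x; rewrite indicE.
  have -> // : (x \in [set` `]-oo, tau]]) = (x <= tau)%R.
  by apply/idP/idP; rewrite inE /= in_itv.
exact: measurable_indic.
Qed.

Lemma mp_cdf_ge0 (tau : R) : 0 <= tau -> mp_cdf lam tau = mpL (fun x => (x <= tau)%R%:R).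
Proof.
move=> tau0; rewrite /mp_cdf /mpL tau0 andbT mulr1 -/mp_atom; congr (_ + _).
rewrite /Rintegral; congr fine; rewrite [LHS]integral_mkcond; apply: eq_integral => x _.
rewrite patchE; case: ifPn => [|h].
  by rewrite inE /= in_itv /= => ->; rewrite mul1r.
have /negbTE -> : ~~ (x <= tau) by apply: contra h => h; rewrite inE /= in_itv.
by rewrite mul0r.
Qed.

Lemma mp_cdf_lt0 tau : tau < 0 -> mp_cdf lam tau = 0.
Proof.
move=> tau0; rewrite /mp_cdf leNgt tau0 andbF add0r integral_mkcond.
rewrite (eq_integral (cst 0)%E) ?integral0 // => x _.
rewrite patchE; case: ifPn => //; rewrite inE /= in_itv /= => h.
by rewrite mp_density_lt0 // (le_trans h) // ltW.
Qed.

End MarchenkoPastur.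

(** * From Stieltjes transforms to distribution functions *)

Section GoodFunctions.
Variables (R : realType) (lam : R).
Hypothesis lam0 : 0 < lam.
Local Notation good := (@mp_good R).

Lemma good_cst (a : R) : good `|a| (fun=> a).
Proof. by split. Qed.

Lemma good_D C C' (f g : R -> R) : good C f -> good C' g -> good (C + C') (fun x => f x + g x).
Proof.
move=> [mf fC] [mg gC']; split; first exact: measurable_funD.
by move=> x x0; rewrite (le_trans (ler_normD _ _)) // lerD ?fC ?gC'.
Qed.

Lemma good_Z C a (f : R -> R) : good C f -> good (`|a| * C) (fun x => a * f x).
Proof.
move=> [mf fC]; split; first exact: measurable_funM.
by move=> x x0; rewrite normrM ler_wpM2l // fC.
Qed.

Lemma good_M C C' (f g : R -> R) : good C f -> good C' g -> good (C * C') (fun x => f x * g x).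
Proof.
move=> [mf fC] [mg gC']; split; first exact: measurable_funM.
by move=> x x0; rewrite normrM ler_pM // ?fC ?gC'.
Qed.

Lemma good_inv (t : R) : 1 <= t -> good 1 (fun x => (x + t)^-1).
Proof.
move=> t1; split; first by apply: measurableT_comp; [exact: measurable_funV|exact: measurable_funD].
move=> x x0; have xt : 1 <= x + t by rewrite (le_trans t1) // lerDr.
by rewrite ger0_norm ?invr_ge0 ?(le_trans ler01) // invf_le1 // (lt_le_trans ltr01).
Qed.

Lemma mpL_cst a : mpL lam (fun=> a) = a.
Proof.
have -> : (fun=> a) = (fun x : R => a * (fun=> 1) x) by apply/funext => x; rewrite mulr1.
by rewrite (mpLZ lam0 _ (good_cst 1)) mpL_cst1 // mulr1.
Qed.

Lemma mpL_dist C C' (f g : R -> R) e : good C f -> good C' g ->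
  (forall x, 0 <= x -> `|f x - g x| <= e) -> `|mpL lam f - mpL lam g| <= e.
Proof.
move=> gf gg fg.
have key C1 C2 (u v : R -> R) : good C1 u -> good C2 v ->
    (forall x, 0 <= x -> u x <= v x + e) -> mpL lam u <= mpL lam v + e.
  move=> gu gv uv.
  have -> : mpL lam v + e = mpL lam (fun x => v x + e).
    by rewrite (mpLD lam0 gv (good_cst e)) mpL_cst.
  exact: (mpL_le lam0 gu (good_D gv (good_cst e))).
have h1 : mpL lam f <= mpL lam g + e.
  by apply: key gf gg _ => x x0; have := fg _ x0; rewrite ler_norml => /andP[]; lra.
have h2 : mpL lam g <= mpL lam f + e.
  by apply: key gg gf _ => x x0; have := fg _ x0; rewrite ler_norml => /andP[]; lra.
by rewrite ler_norml; apply/andP; split; lra.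
Qed.

End GoodFunctions.

Section WeakConvergence.
Variables (R : realType) (lam : R).
Hypothesis lam0 : 0 < lam.
Variables (p : nat -> nat) (rt : forall n, 'I_(p n) -> R).
Hypothesis rt0 : forall n i, 0 <= @rt n i.
Hypothesis p0 : \forall n \near \oo, (0 < p n)%N.
Local Notation good := (@mp_good R).

Definition emp_mean n (f : R -> R) : R := (p n)%:R^-1 * \sum_i f (@rt n i).

Definition mp_conv (f : R -> R) : Prop := emp_mean n f @[n --> \oo] --> mpL lam f.

Lemma emp_mean_le n f g : (forall x, 0 <= x -> f x <= g x) -> emp_mean n f <= emp_mean n g.
Proof. by move=> fg; rewrite ler_wpM2l ?invr_ge0 //; apply: ler_sum => i _; exact: fg. Qed.

Lemma emp_meanD n f g : emp_mean n (fun x => f x + g x) = emp_mean n f + emp_mean n g.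
Proof. by rewrite /emp_mean big_split /= mulrDr. Qed.

Lemma emp_meanZ n a f : emp_mean n (fun x => a * f x) = a * emp_mean n f.
Proof. by rewrite /emp_mean -mulr_sumr mulrCA. Qed.

Lemma emp_mean_cst n a : (0 < p n)%N -> emp_mean n (fun=> a) = a.
Proof.
move=> pn; rewrite /emp_mean sumr_const card_ord -[a *+ _]mulr_natl mulrA mulVf ?mul1r //.
by rewrite pnatr_eq0 -lt0n.
Qed.

Lemma emp_mean_dist n f g e : (0 < p n)%N -> (forall x, 0 <= x -> `|f x - g x| <= e) ->
  `|emp_mean n f - emp_mean n g| <= e.
Proof.
move=> pn fg.
have key (u v : R -> R) : (forall x, 0 <= x -> u x <= v x + e) ->
    emp_mean n u <= emp_mean n v + e.
  move=> uv.
  have -> : emp_mean n v + e = emp_mean n (fun x => v x + e).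
    by rewrite emp_meanD emp_mean_cst.
  exact: emp_mean_le.
have h1 : emp_mean n f <= emp_mean n g + e.
  by apply: key => x x0; have := fg _ x0; rewrite ler_norml => /andP[]; lra.
have h2 : emp_mean n g <= emp_mean n f + e.
  by apply: key => x x0; have := fg _ x0; rewrite ler_norml => /andP[]; lra.
by rewrite ler_norml; apply/andP; split; lra.
Qed.

Lemma mp_conv_cst a : mp_conv (fun=> a).
Proof.
rewrite /mp_conv mpL_cst //; apply: (@cvg_near_cst _ _ _ _ _).
by apply: filterS p0 => n pn; rewrite emp_mean_cst.
Qed.

Lemma mp_convD C C' f g : good C f -> good C' g -> mp_conv f -> mp_conv g ->
  mp_conv (fun x => f x + g x).
Proof.
move=> gf gg cf cg; rewrite /mp_conv (mpLD lam0 gf gg).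
under eq_fun do rewrite emp_meanD; exact: cvgD.
Qed.

Lemma mp_convZ C a f : good C f -> mp_conv f -> mp_conv (fun x => a * f x).
Proof.
move=> gf cf; rewrite /mp_conv (mpLZ lam0 _ gf).
by under eq_fun do rewrite emp_meanZ; apply: cvgM => //; exact: cvg_cst.
Qed.

(** A three-epsilon argument: both averages have total mass 1, so a uniform error on the half-line
    passes to them unchanged. *)
Lemma mp_conv_unif C f : good C f ->
  (forall e, 0 < e -> exists g C', [/\ good C' g, mp_conv g &
    forall x, 0 <= x -> `|f x - g x| <= e]) -> mp_conv f.
Proof.
move=> gf H; apply/cvgrPdist_le => e e0.
have e3 : 0 < e / 3 by rewrite divr_gt0.
have [g [C' [gg cg fg]]] := H _ e3.
move/cvgrPdist_le : cg => /(_ _ e3) cg.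
near=> n.
have pn : (0 < p n)%N by near: n.
have h1 := mpL_dist lam0 gf gg fg.
have h2 := emp_mean_dist pn fg.
have h3 : `|mpL lam g - emp_mean n g| <= e / 3 by near: n.
have -> : mpL lam f - emp_mean n f = (mpL lam f - mpL lam g) + (mpL lam g - emp_mean n g)
    - (emp_mean n f - emp_mean n g) by ring.
rewrite (le_trans (ler_normB _ _)) // (le_trans (lerD (ler_normD _ _) (lexx _))) //.
lra.
Unshelve. all: by end_near.
Qed.

(** Countably many, so that one almost sure event covers them; distinct, for partial fractions; and
    accumulating at 1, to imitate a multiple pole. *)
Definition node k : R := 1 + k.+1%:R^-1.

Lemma node_ge1 k : 1 <= node k.
Proof. by rewrite lerDl invr_ge0. Qed.

Lemma node_inj : injective node.
Proof. by move=> i j /addrI/invr_inj/eqP; rewrite eqr_nat => /eqP[]. Qed.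

Hypothesis conv_node : forall k, mp_conv (fun x => (x + node k)^-1).

Definition node_prod (s : seq nat) (x : R) : R := \prod_(j <- s) (x + node j)^-1.

Lemma node_prod_cons j s x : node_prod (j :: s) x = (x + node j)^-1 * node_prod s x.
Proof. by rewrite /node_prod big_cons. Qed.

Lemma good_node_prod s : good 1 (node_prod s).
Proof.
elim: s => [|j s IH].
  have -> : node_prod [::] = fun=> 1 by apply/funext => x; rewrite /node_prod big_nil.
  by rewrite -[X in good X]normr1; exact: good_cst.
have -> : node_prod (j :: s) = fun x => (x + node j)^-1 * node_prod s x.
  by apply/funext => x; rewrite node_prod_cons.
by rewrite -[X in good X]mulr1; apply: good_M IH; apply: good_inv; exact: node_ge1.
Qed.

(* Partial fractions reduce a product over distinct nodes to shorter ones. *)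
Lemma conv_node_prod s : uniq s -> mp_conv (node_prod s).
Proof.
have [k] := ubnP (size s); elim: k s => // k IH [|i [|j s]].
- have -> : node_prod [::] = fun=> 1 by apply/funext => x; rewrite /node_prod big_nil.
  by move=> _ _; exact: mp_conv_cst.
- have -> : node_prod [:: i] = fun x => (x + node i)^-1.
    by apply/funext => x; rewrite /node_prod big_seq1.
  by move=> _ _; exact: conv_node.
rewrite ltnS /= => sk /andP[]; rewrite inE negb_or => /andP[ij is_] /andP[js us].
have ci : mp_conv (node_prod (i :: s)) by apply: IH => //=; rewrite is_.
have cj : mp_conv (node_prod (j :: s)) by apply: IH => //=; rewrite js.
have nij : node j - node i != 0.
  by rewrite subr_eq0; apply: contraNneq ij => /node_inj ->.
pose g x := (node j - node i)^-1 * (node_prod (i :: s) x + (-1) * node_prod (j :: s) x).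
have gE x : 0 <= x -> node_prod [:: i, j & s] x = g x.
  move=> x0; rewrite /g !node_prod_cons.
  have xi : x + node i != 0.
    by apply: lt0r_neq0; rewrite (lt_le_trans ltr01) // (le_trans (node_ge1 i)) // lerDr.
  have xj : x + node j != 0.
    by apply: lt0r_neq0; rewrite (lt_le_trans ltr01) // (le_trans (node_ge1 j)) // lerDr.
  by move: nij xi xj; move: (node i) (node j) => a b nab xa xb; field; rewrite nab xa xb.
have gi := good_node_prod (i :: s); have gj := good_node_prod (j :: s).
(* The identity [gE] holds on the half-line only, so it is passed on as a uniform approximation with
   error 0. *)
apply: (mp_conv_unif (good_node_prod _)) => e e0; exists g.
have gj' := good_Z (-1) gj; have gg := good_D gi gj'.
exists (`|(node j - node i)^-1| * (1 + `|-1| * 1)); split.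
- exact: good_Z gg.
- have cg := mp_convD gi gj' ci (mp_convZ (a := -1) gj cj).
  exact: (mp_convZ (a := (node j - node i)^-1) gg cg).
- by move=> x x0; rewrite gE // subrr normr0 ltW.
Qed.

Definition yv (x : R) : R := (x + 1)^-1.

Lemma yv_bound x : 0 <= x -> 0 < yv x <= 1.
Proof.
move=> x0; have x1 : 0 < x + 1 by rewrite ltr_wpDl.
by rewrite invr_gt0 x1 /= invf_le1 // lerDr.
Qed.

Lemma good_yvX k : good 1 (fun x => yv x ^+ k).
Proof.
split; last first.
  move=> x /yv_bound/andP[y0 y1].
  by rewrite ger0_norm ?exprn_ge0 ?exprn_ile1 // ltW.
apply: measurable_funX; apply: measurableT_comp; first exact: measurable_funV.
exact: measurable_funD.
Qed.

(** Nearby distinct nodes replace the pole of order k at -1, which partial fractions over distinct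
    nodes cannot produce. Factors are exchanged one at a time, each at a cost of at most 1/(N + 1),
    the distance of [node N] to 1. *)
Lemma yv_node_prod k N x : 0 <= x -> `|yv x ^+ k - node_prod (iota N k) x| <= k%:R / N.+1%:R.
Proof.
move=> x0; elim: k N => [|k IH] N.
  by rewrite /node_prod big_nil subrr normr0 mul0r.
have /andP[y0 y1] := yv_bound x0.
have -> : node_prod (iota N k.+1) x = (x + node N)^-1 * node_prod (iota N.+1 k) x.
  exact: node_prod_cons.
set a := (x + node N)^-1; set b := node_prod _ _.
have -> : yv x ^+ k.+1 - a * b = (yv x - a) * b + yv x * (yv x ^+ k - b).
  by rewrite exprS; ring.
have b1 : `|b| <= 1 by have [_] := good_node_prod (iota N.+1 k); apply.
have ha : `|yv x - a| <= N.+1%:R^-1.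
  have x1 : 0 < x + 1 by rewrite ltr_wpDl.
  have n0 : 0 < N.+1%:R^-1 :> R by rewrite invr_gt0.
  have xn : 0 < x + node N by rewrite /node addrA addr_gt0.
  have -> : yv x - a = N.+1%:R^-1 * (yv x * a).
    rewrite /yv /a /node; move: n0 xn; rewrite /node; move: (N.+1%:R^-1) => h h0 xn.
    by field; rewrite (lt0r_neq0 x1) lt0r_neq0.
  rewrite ger0_norm; last first.
    by rewrite mulr_ge0 ?mulr_ge0 // ?invr_ge0 ltW.
  apply: ler_piMr; first exact: ltW.
  apply: mulr_ile1 => //; try exact: ltW.
    by rewrite invr_ge0 ltW.
  by rewrite invf_le1 // (le_trans (node_ge1 N)) // lerDr.
rewrite (le_trans (ler_normD _ _)) // !normrM -natr1 mulrDl mul1r addrC lerD //.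
  rewrite -[leRHS]mul1r; apply: ler_pM => //; first by rewrite (ger0_norm (ltW y0)).
  apply: le_trans (IH N.+1) _.
  by rewrite ler_wpM2l // lef_pV2 ?posrE // ler_nat.
by rewrite -[leRHS]mulr1 ler_pM.
Qed.

Lemma conv_yvX k : mp_conv (fun x => yv x ^+ k).
Proof.
apply: (mp_conv_unif (good_yvX k)) => e e0.
pose N := Num.truncn (k%:R / e).
exists (node_prod (iota N k)), 1; split; first exact: good_node_prod.
  exact: conv_node_prod (iota_uniq _ _).
move=> x x0; rewrite (le_trans (yv_node_prod _ _ x0)) //.
rewrite ler_pdivrMr // mulrC -ler_pdivrMr // ltW //.
by rewrite truncnS_gt.
Qed.

Lemma conv_poly (q : {poly R}) : (exists C, good C (fun x => q.[yv x])) /\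
  mp_conv (fun x => q.[yv x]).
Proof.
have -> : (fun x => q.[yv x]) = fun x => \sum_(i < size q) q`_i * yv x ^+ i.
  by apply/funext => x; rewrite horner_coef.
elim: (size q) => [|k [[C gC] cC]].
  have -> : (fun x => \sum_(i < 0) q`_i * yv x ^+ i) = fun=> 0.
    by apply/funext => x; rewrite big_ord0.
  by split; [exists `|0 : R|; exact: good_cst|exact: mp_conv_cst].
have -> : (fun x => \sum_(i < k.+1) q`_i * yv x ^+ i) =
    fun x => \sum_(i < k) q`_i * yv x ^+ i + q`_k * yv x ^+ k.
  by apply/funext => x; rewrite big_ord_recr.
have gk := good_Z q`_k (good_yvX k).
split; first by exists (C + `|q`_k| * 1); exact: good_D.
have ck := mp_convZ (a := q`_k) (good_yvX k) (conv_yvX (k := k)).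
exact: mp_convD gC gk cC ck.
Qed.

Lemma bernoulli_le (z : R) M : 0 <= z <= 1 -> 1 - M%:R * z <= (1 - z) ^+ M.
Proof.
move=> /andP[z0 z1]; elim: M => [|M IH]; first by rewrite mul0r subr0.
rewrite exprS -natr1; have z1' : 0 <= 1 - z by rewrite subr_ge0.
apply: le_trans (ler_wpM2l z1' IH); rewrite -subr_ge0.
have -> : (1 - z) * (1 - M%:R * z) - (1 - (M%:R + 1) * z) = M%:R * z ^+ 2 by ring.
by rewrite mulr_ge0 // sqr_ge0.
Qed.

Lemma bernoulli_ge (z : R) M : 0 <= z <= 1 -> (1 - z) ^+ M * (1 + M%:R * z) <= 1.
Proof.
move=> /andP[z0 z1]; have z1' : 0 <= 1 - z by rewrite subr_ge0.
elim: M => [|M IH]; first by rewrite mul0r addr0 mulr1.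
apply: le_trans IH; rewrite exprSr -mulrA ler_wpM2l ?exprn_ge0 // -subr_ge0 -natr1.
have -> : 1 + M%:R * z - (1 - z) * (1 + (M%:R + 1) * z) = (M%:R + 1) * z ^+ 2 by ring.
by rewrite mulr_ge0 ?sqr_ge0 // addr_ge0.
Qed.

(* With y = 1/(1+x) and y2 < a < y1, the polynomial 1 - (1 - y^N)^M with M close
   to a^-N tends to 1 on y >= y1 and to 0 on y <= y2, by Bernoulli's inequality. *)
Lemma conv_step (t1 t2 e : R) : 0 <= t1 -> t1 < t2 -> 0 < e ->
  exists f C, [/\ good C f, mp_conv f &
    forall x, 0 <= x -> (x <= t1)%R%:R - e <= f x <= (x <= t2)%R%:R + e].
Proof.
move=> t10 t12 e0.
pose a := yv ((t1 + t2) / 2).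
have m0 : 0 <= (t1 + t2) / 2 by lra.
have t20 : 0 <= t2 by lra.
have /andP[a0 a1] := yv_bound m0.
have /andP[y10 _] := yv_bound t10; have /andP[y20 _] := yv_bound t20.
have ay1 : a < yv t1 by rewrite /a /yv ltf_pV2 ?posrE; lra.
have ay2 : yv t2 < a by rewrite /a /yv ltf_pV2 ?posrE; lra.
have geo (q : R) : 0 <= q < 1 -> \forall N \near \oo, 2 * q ^+ N <= e.
  move=> /andP[q0 q1].
  have qn : `|q| < 1 by rewrite ger0_norm.
  have /cvgrPdist_le := cvg_expr qn; have e2 : 0 < e / 2 by rewrite divr_gt0.
  move=> /(_ _ e2); apply: filterS => N; rewrite sub0r normrN ger0_norm ?exprn_ge0 //.
  lra.
have [N [hN1 hN2]] : exists N, 2 * (a / yv t1) ^+ N <= e /\ 2 * (yv t2 / a) ^+ N <= e.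
  have h1 : 0 <= a / yv t1 < 1 by rewrite divr_ge0 ?ltW //= ltr_pdivrMr // mul1r.
  have h2 : 0 <= yv t2 / a < 1 by rewrite divr_ge0 ?ltW //= ltr_pdivrMr // mul1r.
  near \oo => N; exists N; split; near: N; exact: geo.
pose M := (Num.truncn (a ^- N)).+1.
have aN : 0 < a ^+ N by rewrite exprn_gt0.
have aN1 : 1 <= a ^- N by rewrite invf_ge1 // exprn_ile1 // ltW.
have M1 : a ^- N <= M%:R by rewrite ltW // truncnS_gt.
have M2 : M%:R <= 2 * a ^- N.
  rewrite /M -natr1; have : (Num.truncn (a ^- N))%:R <= a ^- N.
    by rewrite truncn_le // (le_trans ler01).
  lra.
pose q : {poly R} := 1 - (1 - 'X^N) ^+ M.
have [[C gC] cq] := conv_poly q.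
exists (fun x => q.[yv x]), C; split=> // x x0.
have -> : q.[yv x] = 1 - (1 - yv x ^+ N) ^+ M.
  by rewrite /q !hornerE.
have /andP[y0 y1] := yv_bound x0.
have z01 : 0 <= yv x ^+ N <= 1 by rewrite exprn_ge0 ?exprn_ile1 // ltW.
have w01 : 0 <= (1 - yv x ^+ N) ^+ M <= 1.
  move/andP: z01 => [z0 z1].
  by rewrite exprn_ge0 ?exprn_ile1 // ?subr_ge0 // lerBlDr lerDl.
have hb1 := bernoulli_le M z01; have hb2 := bernoulli_ge M z01.
move: w01 => /andP[w0 w1]; apply/andP; split.
(* Here (1 - z)^M <= 1/(1 + M z) <= (a / yv t1)^N, with z = (yv x)^N and M >= a^-N. *)
- case: (leP x t1) => xt /=; last by rewrite sub0r; lra.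
  rewrite mulr1n.
  have yy : yv t1 <= yv x by rewrite /yv lef_pV2 ?posrE ?lerD2r // ltr_wpDl.
  have hz : (yv t1 / a) ^+ N <= M%:R * yv x ^+ N.
    rewrite expr_div_n mulrC; apply: ler_pM => //.
    - by rewrite invr_ge0 ltW.
    - by rewrite exprn_ge0 // ltW.
    - by apply: lerXn2r => //; rewrite nnegrE ltW.
  have g0 : 0 < (yv t1 / a) ^+ N by rewrite exprn_gt0 // divr_gt0.
  have ge : (1 - yv x ^+ N) ^+ M * (yv t1 / a) ^+ N <= 1.
    apply: le_trans hb2; rewrite ler_wpM2l // (le_trans hz) // lerDr //.
  have : (1 - yv x ^+ N) ^+ M <= (a / yv t1) ^+ N.
    have -> : (a / yv t1) ^+ N = ((yv t1 / a) ^+ N)^-1 by rewrite -exprVn invf_div.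
    by rewrite -[leRHS]mul1r ler_pdivlMr.
  have : 0 <= (a / yv t1) ^+ N by rewrite exprn_ge0 // divr_ge0 // ltW.
  lra.
(* Here 1 - (1 - z)^M <= M z <= 2 (yv t2 / a)^N, because M <= 2 a^-N. *)
- case: (leP x t2) => xt /=; first by rewrite mulr1n; lra.
  rewrite add0r.
  have yy : yv x <= yv t2 by rewrite /yv lef_pV2 ?posrE ?lerD2r // ?ltr_wpDl // ltW.
  have : M%:R * yv x ^+ N <= 2 * (yv t2 / a) ^+ N.
    have -> : 2 * (yv t2 / a) ^+ N = 2 * a ^- N * yv t2 ^+ N.
      by rewrite expr_div_n -mulrA (mulrC (a ^- N)).
    apply: ler_pM => //; first by rewrite exprn_ge0 // ltW.
    by apply: lerXn2r => //; rewrite nnegrE ltW.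
  lra.
Unshelve. all: by end_near.
Qed.

Definition emp_cdf n (tau : R) : R := emp_mean n (fun x => (x <= tau)%R%:R).

Lemma weak_convergence tau : {for tau, continuous (mp_cdf lam)} ->
  emp_cdf n tau @[n --> \oo] --> mp_cdf lam tau.
Proof.
move=> cG; have [tau0|tau0] := ltP tau 0.
  rewrite mp_cdf_lt0 //; apply: cvg_near_cst; near=> n.
  rewrite /emp_cdf /emp_mean big1 ?mulr0 // => i _.
  by rewrite leNgt (lt_le_trans tau0) // rt0.
(* The function from [conv_step] lies between two indicators up to e/3, so the two distribution
   functions compare at shifted points; continuity at tau then closes the gap. *)
have bnd (t1 t2 e : R) : 0 <= t1 -> t1 < t2 -> 0 < e -> \forall n \near \oo,
    emp_cdf n t1 <= mp_cdf lam t2 + e /\ mp_cdf lam t1 - e <= emp_cdf n t2.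
  move=> t10 t12 e0; have e3 : 0 < e / 3 by rewrite divr_gt0.
  have t20 : 0 <= t2 by lra.
  have [f [C [gf cf fb]]] := conv_step t10 t12 e3.
  have f1 x : 0 <= x -> (x <= t1)%R%:R <= f x + e / 3.
    by move=> /fb /andP[h _]; rewrite -lerBlDr.
  have f2 x : 0 <= x -> f x <= (x <= t2)%R%:R + e / 3 by move=> /fb /andP[].
  have ge := good_cst (e / 3).
  have L1 : mp_cdf lam t1 <= mpL lam f + e / 3.
    have -> : mpL lam f + e / 3 = mpL lam (fun x => f x + e / 3).
      by rewrite (mpLD lam0 gf ge) mpL_cst.
    by rewrite mp_cdf_ge0 //; exact: (mpL_le lam0 (mp_good_le t1) (good_D gf ge)).
  have L2 : mpL lam f <= mp_cdf lam t2 + e / 3.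
    have -> : mp_cdf lam t2 + e / 3 = mpL lam (fun x => (x <= t2)%R%:R + e / 3).
      by rewrite (mpLD lam0 (mp_good_le t2) ge) mpL_cst // mp_cdf_ge0.
    exact: (mpL_le lam0 gf (good_D (mp_good_le t2) ge)).
  move/cvgrPdist_le : cf => /(_ _ e3) cf; near=> n.
  have pn : (0 < p n)%N by near: n.
  have : `|mpL lam f - emp_mean n f| <= e / 3 by near: n.
  have E1 : emp_cdf n t1 <= emp_mean n f + e / 3.
    have -> : emp_mean n f + e / 3 = emp_mean n (fun x => f x + e / 3).
      by rewrite emp_meanD emp_mean_cst.
    exact: emp_mean_le.
  have E2 : emp_mean n f <= emp_cdf n t2 + e / 3.
    have -> : emp_cdf n t2 + e / 3 = emp_mean n (fun x => (x <= t2)%R%:R + e / 3).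
      by rewrite emp_meanD emp_mean_cst.
    exact: emp_mean_le.
  by rewrite ler_norml => /andP[h1 h2]; split; lra.
apply/cvgrPdist_le => e e0.
have e2 : 0 < e / 2 by rewrite divr_gt0.
move/cvgrPdist_le : cG => /(_ _ e2) /nbhs_ballP[dl /= dl0 dG].
have near_G s : `|tau - s| < dl -> `|mp_cdf lam tau - mp_cdf lam s| <= e / 2 by move=> h; exact: dG.
have up : \forall n \near \oo, emp_cdf n tau <= mp_cdf lam tau + e.
  have t12 : tau < tau + dl / 2 by lra.
  have := bnd _ _ _ tau0 t12 e2; apply: filterS => n [h _].
  have := near_G (tau + dl / 2); rewrite ler_norml => /(_ _)/andP[]; first last.
    by lra.
  by rewrite opprD addNKr normrN ger0_norm; lra.
have lo : \forall n \near \oo, mp_cdf lam tau - e <= emp_cdf n tau.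
  have nG := near_G (tau - dl / 2); have {}nG : `|mp_cdf lam tau - mp_cdf lam (tau - dl / 2)| <= e / 2.
    by apply: nG; rewrite opprB addrC subrK ger0_norm; lra.
  move: nG; rewrite ler_norml => /andP[_ nG].
  (* A shifted point below 0 is out of reach of [bnd], but the limit is 0 there and nonnegativity of
     the empirical function suffices. *)
  have [s0|s0] := ltP (tau - dl / 2) 0.
    have hG : mp_cdf lam tau - e <= 0 by move: nG; rewrite (mp_cdf_lt0 lam0 s0); lra.
    near=> n; apply: le_trans hG _.
    by rewrite mulr_ge0 ?invr_ge0 ?sumr_ge0.
  have t12 : tau - dl / 2 < tau by lra.
  have := bnd _ _ _ s0 t12 e2; apply: filterS => n [_ h]; lra.
near=> n.
have : emp_cdf n tau <= mp_cdf lam tau + e by near: n.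
have : mp_cdf lam tau - e <= emp_cdf n tau by near: n.
by rewrite ler_norml => h1 h2; apply/andP; split; lra.
Unshelve. all: by end_near.
Qed.

End WeakConvergence.

(** * The regime d = o(n^(1/3)) *)

Section EpsilonLimit.
Variables (R : realType) (K : R).
Hypothesis K1 : 1 <= K.

Lemma pow1D_le_expR (a : R) k : 0 <= a -> (1 + a) ^+ k <= expR (k%:R * a).
Proof.
move=> a0; rewrite expRM_natl lerXn2r ?nnegrE ?expR_ge0 ?addr_ge0 //.
exact: expR_ge1Dx.
Qed.

(** The bound [tensor_eps] with d-th powers replaced by exponentials: a function of z = d y alone,
    vanishing at z = 0. *)
Definition eps_bound (z : R) : R :=
  expR (2 * K * z ^+ 2) * (expR (2 * K * z) * (2 * z + K * z ^+ 2)) +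
  (expR (2 * K * z ^+ 2) * (expR (K * z) - 1) ^+ 2 + (expR (2 * K * z ^+ 2) - 1)).

Lemma tensor_eps_le n d : (0 < d)%N -> (d < n)%N ->
  let y := Num.sqrt (dratio R n d) in
  let z := Num.sqrt (d%:R ^+ 3 / (n - d)%:R) in
  y <= z /\ tensor_eps n K d y <= eps_bound z.
Proof.
move=> d0 dn y z.
have K0 : 0 <= K by apply: le_trans K1.
have nd0 : 0 < (n - d)%:R :> R by rewrite ltr0n subn_gt0.
have d1 : 1 <= d%:R :> R by rewrite ler1n.
have y0 : 0 <= y := sqrtr_ge0 _.
have zE : z = d%:R * y.
  rewrite /z /y exprS -mulrA mulrC -mulrA.
  have -> : d%:R ^+ 2 * ((n - d)%:R^-1 * d%:R) = d%:R ^+ 2 * dratio R n d by rewrite /dratio; ring.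
  by rewrite sqrtrM ?sqr_ge0 // sqrtr_sqr ger0_norm.
have yz : y <= z by rewrite zE ler_peMl.
have z0 : 0 <= z by apply: le_trans yz.
split=> //.
have y2 : y ^+ 2 = d%:R / (n - d)%:R by rewrite sqr_sqrtr // divr_ge0.
have C1 : dconst n K d <= expR (2 * K * z ^+ 2).
  rewrite /dconst (le_trans (pow1D_le_expR _ _)) ?divr_ge0 ?mulr_ge0 // ler_expR.
  have -> : d%:R * (2 * d%:R * K / (n - d)%:R) = 2 * K * (d%:R * y ^+ 2) by rewrite y2; ring.
  rewrite ler_wpM2l ?mulr_ge0 // zE exprMn ler_wpM2r ?sqr_ge0 //.
  by rewrite expr2 ler_peMl.
have C0 : 1 <= dconst n K d by rewrite exprn_ege1 // lerDl divr_ge0 // !mulr_ge0.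
have C00 : 0 <= dconst n K d by apply: le_trans C0.
have P1 : (1 + 2 * K * y) ^+ d <= expR (2 * K * z).
  rewrite (le_trans (pow1D_le_expR _ _)) ?mulr_ge0 // ler_expR zE le_eqVlt.
  by apply/orP; left; apply/eqP; ring.
have P2 : (1 + K * y) ^+ d <= expR (K * z).
  rewrite (le_trans (pow1D_le_expR _ _)) ?mulr_ge0 // ler_expR zE le_eqVlt.
  by apply/orP; left; apply/eqP; ring.
have Q1 : 1 <= (1 + K * y) ^+ d by rewrite exprn_ege1 // lerDl mulr_ge0.
have y2z : y ^+ 2 <= z ^+ 2 by rewrite lerXn2r.
rewrite /tensor_eps /eps_bound; apply: lerD; last apply: lerD.
- apply: ler_pM => //.
    by rewrite mulr_ge0 ?exprn_ge0 ?addr_ge0 ?mulr_ge0 ?sqr_ge0.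
  apply: ler_pM => //; rewrite ?exprn_ge0 ?addr_ge0 ?mulr_ge0 ?sqr_ge0 //.
  by rewrite lerD ?ler_wpM2l.
- apply: ler_pM => //; first exact: sqr_ge0.
  by rewrite lerXn2r ?nnegrE ?subr_ge0 // ?lerD2r // (le_trans Q1).
- by rewrite lerD2r.
Qed.

Lemma eps_bound_cvg0 (z : nat -> R) : z n @[n --> \oo] --> 0 ->
  eps_bound (z n) @[n --> \oo] --> 0.
Proof.
move=> z0.
have z2 : z n ^+ 2 @[n --> \oo] --> 0.
  rewrite -[X in _ --> X](mulr0 0); under eq_fun do rewrite expr2; exact: cvgM.
have cM (a : R) (u : nat -> R) : u n @[n --> \oo] --> 0 -> a * u n @[n --> \oo] --> 0.
  by move=> u0; rewrite -[X in _ --> X](mulr0 a); apply: cvgM => //; exact: cvg_cst.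
have ce (u : nat -> R) : u n @[n --> \oo] --> 0 -> expR (u n) @[n --> \oo] --> (1 : R).
  by move=> u0; have := cvg_comp _ _ u0 (@continuous_expR R 0); rewrite expR0.
have e1 := ce _ (cM (2 * K) _ z2); have e2 := ce _ (cM (2 * K) _ z0).
have e3 := ce _ (cM K _ z0).
rewrite /eps_bound.
have -> : 0 = 1 * (1 * (0 + 0)) + (1 * ((1 - 1) * (1 - 1)) + (1 - 1)) :> R by ring.
under eq_fun do rewrite [(expR (K * _) - 1) ^+ 2]expr2.
have c1 : (fun _ : nat => 1 : R) n @[n --> \oo] --> (1 : R) by exact: cvg_cst.
apply: cvgD; first by do 2!apply: cvgM => //; apply: cvgD; exact: cM.
by apply: cvgD; [apply: cvgM => //; apply: cvgM; exact: cvgB|exact: cvgB].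
Qed.

Variable d : nat -> nat.
Hypothesis d0 : forall n, (0 < d n)%N.
Hypothesis dcvg : (fun n : nat => (d n)%:R / (n%:R `^ (3%:R^-1))) @ \oo --> (0 : R).

Lemma d3n_cvg0 : (d n)%:R ^+ 3 / n%:R @[n --> \oo] --> (0 : R).
Proof.
have h : ((d n)%:R / (n%:R `^ (3%:R^-1))) ^+ 3 @[n --> \oo] --> (0 * 0 * 0 : R).
  under eq_fun do rewrite exprSr expr2; apply: cvgM => //; exact: cvgM.
rewrite !mulr0 in h.
apply: cvg_trans h; apply: near_eq_cvg; near=> n.
have n0 : (0 < n)%N by near: n; exists 1%N.
rewrite expr_div_n; congr (_ / _).
by rewrite -powR_mulrn ?powR_ge0 // -powRrM mulVf ?pnatr_eq0 // powRr1.
Unshelve. all: by end_near.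
Qed.

Lemma d_half : \forall n \near \oo, (d n * 2 <= n)%N.
Proof.
have h2 : 0 < 2^-1 :> R by rewrite invr_gt0.
have /cvgrPdist_lt/(_ _ h2) := d3n_cvg0; apply: filterS2 (nbhs_infty_gt 0) => n n0.
rewrite sub0r normrN ger0_norm ?divr_ge0 ?exprn_ge0 // ltr_pdivrMr ?ltr0n // => h.
rewrite -(ler_nat R) natrM -ler_pdivlMr // mulrC ltW // (le_lt_trans _ h) //.
by rewrite -natrX ler_nat -[leqLHS]expn1 leq_pexp2l.
Qed.

Lemma z_cvg0 : Num.sqrt ((d n)%:R ^+ 3 / (n - d n)%:R) @[n --> \oo] --> (0 : R).
Proof.
have h : (d n)%:R ^+ 3 / (n - d n)%:R @[n --> \oo] --> (0 : R).
  apply: (@squeeze_cvgr _ _ _ _ (fun=> 0) (fun n => 2 * ((d n)%:R ^+ 3 / n%:R))).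
  - near=> n.
    have n0 : (0 < n)%N by near: n; exact: nbhs_infty_gt.
    have dn : (d n * 2 <= n)%N by near: n; exact: d_half.
    have ndn : (n <= 2 * (n - d n))%N by rewrite mulnBr leq_subRL ?leq_mul2l //; lia.
    have nd : (0 < n - d n)%N by move: ndn; case: (n - d n)%N => //; rewrite muln0 leqNgt n0.
    rewrite divr_ge0 ?exprn_ge0 //= mulrCA ler_wpM2l ?exprn_ge0 //.
    rewrite -[2 as X in X * _]invrK -invfM lef_pV2 ?posrE ?ltr0n ?mulr_gt0 ?invr_gt0 ?ltr0n //.
    by rewrite ler_pdivrMl // -natrM ler_nat.
  - exact: cvg_cst.
  - rewrite -[X in _ --> X](mulr0 2); apply: cvgM; [exact: cvg_cst|exact: d3n_cvg0].
rewrite -sqrtr0; apply: (cvg_comp _ _ h); exact: sqrt_continuous.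
Unshelve. all: by end_near.
Qed.

Definition ysq n : R := Num.sqrt (dratio R n (d n)).

Lemma tensor_eps_ge0 n : (d n < n)%N -> 0 <= tensor_eps n K (d n) (ysq n).
Proof.
move=> dn; have K0 : 0 <= K by apply: le_trans K1.
have nd0 : 0 < (n - d n)%:R :> R by rewrite ltr0n subn_gt0.
have C0 : 1 <= dconst n K (d n) by rewrite exprn_ege1 // lerDl divr_ge0 // !mulr_ge0.
have C00 : 0 <= dconst n K (d n) by apply: le_trans C0.
have y0 : 0 <= ysq n := sqrtr_ge0 _.
apply: addr_ge0; last by rewrite addr_ge0 ?subr_ge0 // mulr_ge0 // sqr_ge0.
apply: mulr_ge0 => //; apply: mulr_ge0.
  by rewrite exprn_ge0 // addr_ge0 // !mulr_ge0.
by rewrite addr_ge0 // mulr_ge0 // sqr_ge0.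
Qed.

Lemma tensor_eps_cvg0 : tensor_eps n K (d n) (ysq n) @[n --> \oo] --> (0 : R).
Proof.
apply: (squeeze_cvgr _ (cvg_cst 0) (eps_bound_cvg0 z_cvg0)); near=> n.
have n0 : (0 < n)%N by near: n; exact: nbhs_infty_gt.
have dn2 : (d n * 2 <= n)%N by near: n; exact: d_half.
have dn : (d n < n)%N by have := d0 n; lia.
by rewrite tensor_eps_ge0 //=; have [] := tensor_eps_le (d0 n) dn.
Unshelve. all: by end_near.
Qed.

Lemma ysq_small : \forall n \near \oo, 2 * ysq n + K * ysq n ^+ 2 <= 1.
Proof.
have K0 : 0 <= K by apply: le_trans K1.
have h : 2 * Num.sqrt ((d n)%:R ^+ 3 / (n - d n)%:R) +
    K * (Num.sqrt ((d n)%:R ^+ 3 / (n - d n)%:R) * Num.sqrt ((d n)%:R ^+ 3 / (n - d n)%:R))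
    @[n --> \oo] --> (2 * 0 + K * (0 * 0) : R).
  by apply: cvgD; apply: cvgM; try exact: cvg_cst; try exact: z_cvg0; apply: cvgM; exact: z_cvg0.
rewrite !mulr0 addr0 in h.
have /cvgrPdist_lt/(_ _ ltr01) := h; apply: filterS2 d_half => n dn2.
rewrite sub0r normrN => /ltW/(le_trans (ler_norm _)) hz.
have dn : (d n < n)%N by have := d0 n; lia.
have [yz _] := tensor_eps_le (d0 n) dn; apply: le_trans hz.
by rewrite lerD // ler_wpM2l // expr2 ler_pM ?sqrtr_ge0.
Qed.

End EpsilonLimit.

(** * Measurability of matrix-valued functionals *)

Section MatrixFunctionals.
Variables (R : realType) (I : Type).

Definition mfmx a b (B : (I -> R) -> 'M[R]_(a, b)) : Prop :=
  forall i j, mfunctional (fun v => B v i j).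

Lemma eq_mfunctional (f g : (I -> R) -> R) : f =1 g -> mfunctional f -> mfunctional g.
Proof. by move=> /funext ->. Qed.

Lemma mfmx_mul a b c (A : (I -> R) -> 'M[R]_(a, b)) (B : (I -> R) -> 'M[R]_(b, c)) :
  mfmx A -> mfmx B -> mfmx (fun v => A v *m B v).
Proof.
move=> mA mB i j; apply: (eq_mfunctional (f := fun v => \sum_k A v i k * B v k j)).
  by move=> v; rewrite mxE.
by apply: mfunctional_sum => k; apply: mfunctionalM; [exact: mA|exact: mB].
Qed.

Lemma mfmx_tr a b (A : (I -> R) -> 'M[R]_(a, b)) : mfmx A -> mfmx (fun v => (A v)^T).
Proof. by move=> mA i j; apply: eq_mfunctional (mA j i) => v; rewrite mxE. Qed.

Lemma mfmx_scale a b c (A : (I -> R) -> 'M[R]_(a, b)) : mfmx A -> mfmx (fun v => c *: A v).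
Proof.
move=> mA i j; apply: eq_mfunctional (mfunctionalM (mfunctional_cst c) (mA i j)) => v.
by rewrite mxE.
Qed.

Lemma mfmx_sum a b (J : Type) (s : seq J) (Q : pred J) (A : J -> (I -> R) -> 'M[R]_(a, b)) :
  (forall k, mfmx (A k)) -> mfmx (fun v => \sum_(k <- s | Q k) A k v).
Proof.
move=> mA i j; apply: eq_mfunctional (mfunctional_sum s Q (fun k => mA k i j)) => v.
by rewrite summxE.
Qed.

Lemma mfmx_col a b (j : 'I_b) (A : (I -> R) -> 'M[R]_(a, b)) :
  mfmx A -> mfmx (fun v => col j (A v)).
Proof. by move=> mA i k; apply: eq_mfunctional (mA i j) => v; rewrite mxE. Qed.

Lemma mfunctional_det a (A : (I -> R) -> 'M[R]_a) : mfmx A -> mfunctional (fun v => \det (A v)).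
Proof.
move=> mA; apply: mfunctional_sum => s.
by apply: mfunctionalM (mfunctional_cst _) _; apply: mfunctional_prod => i; exact: mA.
Qed.

Lemma mfunctional_trace a (A : (I -> R) -> 'M[R]_a) : mfmx A -> mfunctional (fun v => \tr (A v)).
Proof. by move=> mA; apply: mfunctional_sum => i; exact: mA. Qed.

(** Cramer's rule: the entries are cofactors divided by the determinant, all polynomial in the
    entries of A. *)
Lemma mfmx_inv a (A : (I -> R) -> 'M[R]_a) : mfmx A -> (forall v, A v \in unitmx) ->
  mfmx (fun v => invmx (A v)).
Proof.
move=> mA uA i j.
have -> : (fun v => invmx (A v) i j) =
    fun v => (\det (A v))^-1 * ((-1) ^+ (j + i) * \det (row' j (col' i (A v)))).
  by apply/funext => v; rewrite /invmx uA !mxE.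
apply: mfunctionalM.
  by apply: mfunctional_comp; [exact: measurable_funV|exact: mfunctional_det].
apply: mfunctionalM (mfunctional_cst _) _; apply: mfunctional_det => k l.
by apply: eq_mfunctional (mA (lift j k) (lift i l)) => v; rewrite !mxE.
Qed.

Lemma mfmx_resolvent a t (W : (I -> R) -> 'M[R]_a) : mfmx W -> 0 < t ->
  (forall v, psdmx (W v)) -> mfmx (fun v => resolvent t (W v)).
Proof.
move=> mW t0 pW; apply: mfmx_inv => [i j|v]; last exact: resolvent_unit.
apply: eq_mfunctional (mfunctionalD (mW i j) (mfunctional_cst ((t%:M : 'M[R]_a) i j))) => v.
by rewrite [RHS]mxE.
Qed.

End MatrixFunctionals.

Lemma mutually_independent_inj (d : measure_display) (T : measurableType d) (R : realType)
  (P : probability T R) (I J : finType) (X : I -> T -> R) (h : J -> I) :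
  injective h -> mutually_independent P X -> mutually_independent P (fun j => X (h j)).
Proof.
move=> hinj indX A B mB.
(* Coordinates outside the image of [h] are constrained to the whole line, that is, not at all. *)
pose B' i := if [pick j | h j == i] is Some j then B j else setT.
have B'E j : B' (h j) = B j.
  rewrite /B'; case: pickP => [j' /eqP/hinj ->//|/(_ j)]; by rewrite eqxx.
have mB' i : measurable (B' i) by rewrite /B'; case: pickP => [j _|_]; [exact: mB|exact: measurableT].
have := indX (h @: A)%SET B' mB'.
rewrite big_imset /=; last by move=> j j' _ _ /hinj.
have -> : \bigcap_(i in [set i | i \in (h @: A)%SET]) (X i @^-1` B' i) =
    \bigcap_(j in [set j | j \in A]) (X (h j) @^-1` B j).
  apply/seteqP; split=> w hw.
    by move=> j /= jA; rewrite -B'E; apply: hw; rewrite /=; exact: imset_f.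
  by move=> _ /= /imsetP[j jA ->]; rewrite /preimage /= B'E; exact: hw.
by move=> ->; apply: eq_bigr => j _; rewrite B'E.
Qed.

(** * Stability of the self-consistent equation *)

Section SelfConsistentEquation.
Variable R : realType.

Lemma lip_ratio (a b : R) : 0 <= a -> 0 <= b -> `|a / (1 + a) - b / (1 + b)| <= `|a - b|.
Proof.
move=> a0 b0; have a1 : 0 < 1 + a by rewrite ltr_wpDr.
have b1 : 0 < 1 + b by rewrite ltr_wpDr.
have -> : a / (1 + a) - b / (1 + b) = (a - b) / ((1 + a) * (1 + b)).
  by field; rewrite !lt0r_neq0.
rewrite normrM; apply: ler_piMr => //.
rewrite ger0_norm; last by rewrite invr_ge0 mulr_ge0 // ltW.
by rewrite invf_le1 ?mulr_gt0 // mulr_ege1 // lerDl.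
Qed.

(** Up to sign, the residual at s is (s - s') times t + 1/((1 + lam s)(1 + lam s')), a factor at
    least 1 because t >= 1. A small residual thus forces s close to the root. *)
Lemma stable_root (lam t s s' : R) : 0 < lam -> 1 <= t -> 0 <= s -> 0 <= s' ->
  1 - t * s' = s' / (1 + lam * s') ->
  `|s - s'| <= `|1 - t * s - s / (1 + lam * s)|.
Proof.
move=> lam0 t1 s0 s'0 e.
have h : 0 < 1 + lam * s by rewrite ltr_wpDr // mulr_ge0 // ltW.
have h' : 0 < 1 + lam * s' by rewrite ltr_wpDr // mulr_ge0 // ltW.
have -> : 1 - t * s - s / (1 + lam * s) =
    - ((s - s') * (t + ((1 + lam * s) * (1 + lam * s'))^-1)).
  have -> : 1 - t * s - s / (1 + lam * s) =
      (1 - t * s - s / (1 + lam * s)) - (1 - t * s' - s' / (1 + lam * s')).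
    by rewrite e subrr subr0.
  by field; rewrite !lt0r_neq0.
have u1 : 1 <= t + ((1 + lam * s) * (1 + lam * s'))^-1.
  by apply: le_trans t1 _; rewrite lerDl invr_ge0 mulr_ge0 // ltW.
by rewrite normrN normrM ler_peMr // ger0_norm // (le_trans ler01).
Qed.

Lemma lip_param (lam lam' s : R) : 0 <= lam -> 0 <= lam' -> 0 <= s <= 1 ->
  `|s / (1 + lam' * s) - s / (1 + lam * s)| <= `|lam' - lam|.
Proof.
move=> lam0 lam'0 /andP[s0 s1].
have h : 0 < 1 + lam * s by rewrite ltr_wpDr // mulr_ge0.
have h' : 0 < 1 + lam' * s by rewrite ltr_wpDr // mulr_ge0.
have -> : s / (1 + lam' * s) - s / (1 + lam * s) =
    - ((lam' - lam) * (s ^+ 2 / ((1 + lam' * s) * (1 + lam * s)))).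
  by field; rewrite !lt0r_neq0.
rewrite normrN normrM; apply: ler_piMr => //.
rewrite ger0_norm; last by rewrite divr_ge0 ?sqr_ge0 // mulr_ge0 // ltW.
rewrite ler_pdivrMr ?mulr_gt0 // mul1r (le_trans (exprn_ile1 2 s0 s1)) //.
by rewrite mulr_ege1 // lerDl mulr_ge0.
Qed.

End SelfConsistentEquation.

(** * The Gram matrix of independent tensor columns *)

Section TensorGram.
Variables (R : realType) (dT : measure_display) (T : measurableType dT).
Variables (P : probability T R) (n d m : nat).
Let I := ('I_m * 'I_n)%type.
Let p := #|dsubsets n d|.
Variable t : R.
Hypotheses (t1 : 1 <= t) (m0 : (0 < m)%N).
Let t0 : 0 < t. Proof. exact: lt_le_trans t1. Qed.
Let c : R := m%:R^-1.
Let c0 : 0 <= c. Proof. by rewrite invr_ge0. Qed.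

Lemma card_dsubsets : p = 'C(n, d).
Proof. by rewrite /p /dsubsets -[in RHS](card_ord n) card_draws. Qed.

Definition tmx (v : I -> R) : 'M[R]_(p, m) := tensor_mx d (fun j i => v (j, i)).

Definition tres (v : I -> R) : 'M[R]_p := resolvent t (c *: (tmx v *m (tmx v)^T)).

Definition stransf (v : I -> R) : R := p%:R^-1 * \tr (tres v).

Definition lres (k : 'I_m) (v : I -> R) : 'M[R]_p := resolvent t (gram_without c (tmx v) k).

Lemma mfmx_tmx : mfmx tmx.
Proof.
move=> a j.
apply: (eq_mfunctional (f := fun v => \prod_(i in (enum_val a : {set 'I_n})) v (j, i))).
  by move=> v; rewrite mxE.
by apply: mfunctional_prod => i; exact: mfunctional_coord.
Qed.

Lemma mfmx_tres : mfmx tres.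
Proof.
apply: mfmx_resolvent => // [|v]; last exact: psdmx_gram.
by apply: mfmx_scale; apply: mfmx_mul; [|apply: mfmx_tr]; exact: mfmx_tmx.
Qed.

Lemma mfmx_lres k : mfmx (lres k).
Proof.
apply: mfmx_resolvent => // [|v]; last exact: psdmx_gram_without.
apply: mfmx_scale; apply: mfmx_sum => j.
have mc := mfmx_col j mfmx_tmx.
by apply: mfmx_mul => //; exact: mfmx_tr.
Qed.

Lemma mfunctional_stransf : mfunctional stransf.
Proof.
exact: mfunctionalM (mfunctional_cst _) (mfunctional_trace mfmx_tres).
Qed.

Lemma stransf_bound v : 0 <= stransf v <= 1.
Proof.
have ps := psdmx_gram (tmx v) c0.
have h1 := resolvent_tr_ge0 t0 ps; have h2 := resolvent_tr_le t0 ps.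
rewrite /stransf mulr_ge0 ?invr_ge0 //=.
have [->|p0] := eqVneq p%:R (0 : R); first by rewrite invr0 mul0r.
have pp : 0 < p%:R :> R by rewrite lt_def p0 /=.
rewrite ler_pdivrMl // mulr1 (le_trans h2) // ler_pdivrMr //.
by rewrite ler_peMr.
Qed.

Let blk (ji : I) : nat := ji.1.

Lemma gram_without_agree (k : 'I_m) v v' : agree_off blk k v v' ->
  gram_without c (tmx v) k = gram_without c (tmx v') k.
Proof.
move=> vv'; rewrite /gram_without; congr (_ *: _); apply: eq_bigr => j jk.
have -> : col j (tmx v) = col j (tmx v') => //.
apply/matrixP => a b; rewrite !mxE; apply: eq_bigr => i _.
by apply: vv'; rewrite /blk /=; apply: contraNneq jk => /ord_inj ->.
Qed.

(** Changing column k does not affect the trace with that column removed, and both full traces lie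
    within 1/t below it. *)
Lemma stransf_bdiff : bdiff blk (p%:R^-1) stransf.
Proof.
move=> k v v' vv'; rewrite /stransf -[X in _ + X]mulr1 -mulrDr ler_wpM2l ?invr_ge0 //.
(* Block numbers range over all naturals; for k >= m there is no such column, and v = v'. *)
have [km|mk] := ltnP k m; last first.
  have -> : v = v'.
    apply/funext => ji; apply: vv'; rewrite /blk; apply: contraTneq mk => <-.
    by rewrite -ltnNge.
  by rewrite lerDl.
have hv := tr_resolvent_leave_one_out (tmx v) c0 t0 (Ordinal km).
have hv' := tr_resolvent_leave_one_out (tmx v') c0 t0 (Ordinal km).
rewrite (gram_without_agree (k := Ordinal km) vv') in hv.
have ti : t^-1 <= 1 by rewrite invf_le1.
rewrite /tres; move: hv hv' => /andP[h1 h2] /andP[h3 h4]; lra.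
Qed.

Variable X : I -> T -> R.
Hypotheses (mX : forall i, measurable_fun setT (X i)) (indX : mutually_independent P X).

(** The choice th = sqrt p / 2 gives (th/p)^2 = 1/(4p), so the m factors multiply to at most
    exp(m/p), while th^-4 = 16/p^2 provides the decay. The condition th/p <= 1/2 holds because p >=
    1. *)
Lemma stransf_4th_moment : (0 < p)%N ->
  (\int[P]_w ((stransf (X ^~ w) - \int[P]_w stransf (X ^~ w)) ^+ 4)%:E <=
   (2 * 4 ^+ 4 * 4 ^+ 2 * expR (m%:R / p%:R) / p%:R ^+ 2)%:E)%E.
Proof.
move=> p0; have pp : 0 < p%:R :> R by rewrite ltr0n.
pose th : R := Num.sqrt p%:R / 2.
have th0 : 0 < th by rewrite divr_gt0 // sqrtr_gt0.
have th2 : th ^+ 2 = p%:R / 4.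
  by rewrite /th expr_div_n sqr_sqrtr ?ltW //; congr (_ / _); ring.
have s2 : Num.sqrt p%:R ^+ 2 = p%:R :> R by rewrite sqr_sqrtr // ltW.
have thc : th * p%:R^-1 <= 2^-1.
  rewrite ler_pdivrMr // /th mulrC ler_pM2l ?invr_gt0 //.
  have s1 : 1 <= Num.sqrt p%:R :> R.
    have h : 1 <= p%:R :> R by rewrite ler1n.
    by have := ler_wsqrtr h; rewrite sqrtr1.
  by rewrite -{2}s2 expr2 ler_peMr // ltW // sqrtr_gt0.
have blkm ji : (blk ji < m)%N by exact: ltn_ord.
have := bounded_differences_4th_moment mX indX blkm mfunctional_stransf
  stransf_bound stransf_bdiff th0 thc.
move=> h; apply: le_trans h _; rewrite lee_fin.
have -> : th ^+ 4 = p%:R ^+ 2 / 4 ^+ 2 by rewrite -[4%N]/(2 * 2)%N exprM th2 expr_div_n.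
rewrite invf_div mulrA -[_ / p%:R ^+ 2]/(_ * _) ler_wpM2r ?invr_ge0 ?sqr_ge0 //.
rewrite mulrAC ler_wpM2l ?mulr_ge0 ?exprn_ge0 //.
have a0 : 0 <= 2 * (th * p%:R^-1) ^+ 2 by rewrite mulr_ge0 ?sqr_ge0.
apply: le_trans (pow1D_le_expR _ a0) _; rewrite ler_expR ler_wpM2l //.
rewrite exprMn th2.
have -> : 2 * (p%:R / 4 * p%:R^-1 ^+ 2) = 2^-1 * p%:R^-1 :> R by field; exact: lt0r_neq0.
by apply: ler_piMl; [rewrite invr_ge0|lra].
Qed.

Variables (K y : R).
Hypothesis i4 : forall i, P.-integrable setT (EFin \o (fun w => X i w ^+ 4)).
Hypothesis e1 : forall i, \int[P]_w X i w = 0.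
Hypothesis e2 : forall i, \int[P]_w (X i w ^+ 2) = 1.
Hypothesis e4 : forall i, \int[P]_w (X i w ^+ 4) <= K.
Hypothesis K1 : 1 <= K.
Hypotheses (dn : (d < n)%N) (y0 : 0 <= y) (yq : y ^+ 2 = dratio R n d).
Hypothesis small : 2 * y + K * y ^+ 2 <= 1.
Hypothesis eps0 : 0 <= tensor_eps n K d y.

Definition qdev (k : 'I_m) (v : I -> R) : R :=
  quadf (lres k v) (col k (tmx v)) - \tr (lres k v).

Lemma mfunctional_qdev k : mfunctional (qdev k).
Proof.
have mc := mfmx_col k mfmx_tmx.
apply: mfunctionalB; last exact: mfunctional_trace (mfmx_lres k).
have := mfmx_mul (mfmx_mul (mfmx_tr mc) (mfmx_lres k)) mc; exact.
Qed.

(** With column k redrawn from the inner copy, the resolvent of the other columns is a constant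
    matrix, and the tensor variance bound applies with Frobenius norm squared at most p. *)
Lemma qdev_variance k :
  (\int[P]_w (qdev k (X ^~ w) ^+ 2)%:E <= (p%:R ^+ 2 * tensor_eps n K d y)%:E)%E.
Proof.
have mq2 : mfunctional (fun v => qdev k v ^+ 2).
  exact: mfunctionalM (mfunctional_qdev k) (mfunctional_qdev k).
rewrite (ge0_decouple mX indX (fun ji => blk ji == k) mq2); last by move=> v; exact: sqr_ge0.
pose xi i w := X (k, i) w.
have indxi : mutually_independent P xi.
  by apply: (mutually_independent_inj (h := fun i => (k, i))) => // i j [].
have inner w : (\int[P]_w' (qdev k (mixf (fun ji => blk ji == k) (X ^~ w) (X ^~ w')) ^+ 2)%:E <=
    (p%:R ^+ 2 * tensor_eps n K d y)%:E)%E.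
  pose A := lres k (X ^~ w).
  have E w' : qdev k (mixf (fun ji => blk ji == k) (X ^~ w) (X ^~ w')) =
      quadf A (\col_a tens (xi ^~ w') (enum_val a)) - \tr A.
    have -> : A = lres k (mixf (fun ji => blk ji == k) (X ^~ w) (X ^~ w')).
      rewrite /A /lres; congr resolvent; apply: gram_without_agree => ji jk.
      by rewrite /mixf (negbTE jk).
    rewrite /qdev; congr (quadf _ _ - _); apply/matrixP => a b; rewrite !mxE.
    by apply: eq_bigr => i _; rewrite /mixf /blk /= eqxx.
  under eq_integral do rewrite E.
  apply: le_trans (tensor_quadf_variance (fun i => mX (k, i)) indxi (fun i => i4 (k, i))
    (fun i => e1 (k, i)) (fun i => e2 (k, i)) (fun i => e4 (k, i)) K1 dn y0 yq small A) _.
  rewrite lee_fin -card_dsubsets expr2 -!mulrA ler_wpM2l // mulrC ler_wpM2r //.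
  apply: le_trans (resolvent_frob t0 (psdmx_gram_without (tmx (X ^~ w)) c0 k)) _.
  by rewrite ler_pdivrMr ?exprn_gt0 // ler_peMr // exprn_ege1.
apply: le_trans (_ : \int[P]_w (p%:R ^+ 2 * tensor_eps n K d y)%:E <= _)%E; last first.
  by rewrite integral_cst //= probability_setT mule1.
apply: ge0_le_integral => //.
- by move=> w _; apply: integral_ge0 => w' _; rewrite lee_fin sqr_ge0.
- apply: (measurable_fun_fubini_tonelli_F (m2 := P) (fun z : T * T =>
    (qdev k (mixf (fun ji => blk ji == k) (X ^~ z.1) (X ^~ z.2)) ^+ 2)%:E)).
    apply/measurable_EFinP; exact: mq2 (measurable_mixX mX (fun ji => blk ji == k)).
  by move=> z; rewrite lee_fin sqr_ge0.
Qed.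

Lemma integrable_qdev2 k : P.-integrable setT (EFin \o (fun w => qdev k (X ^~ w) ^+ 2)).
Proof.
have mq2 : mfunctional (fun v => qdev k v ^+ 2).
  exact: mfunctionalM (mfunctional_qdev k) (mfunctional_qdev k).
apply/integrableP; split; first by apply/measurable_EFinP; exact: mq2 mX.
under eq_integral do rewrite /= ger0_norm ?sqr_ge0 //.
exact: le_lt_trans (qdev_variance k) (ltry _).
Qed.

Variables (lam eta : R).
Hypotheses (lam0 : 0 < lam) (eta0 : 0 < eta) (p0 : (0 < p)%N).

(** The residual of the equation, times p, is a sum over columns comparing their quadratic forms
    with the full trace. Each difference splits into [qdev] and a trace difference of at most 1.
    Then |z| <= z^2/(2 eta p) + eta p/2 replaces [qdev] by its square, whose mean is known. *)
Lemma stransf_pointwise v : `|stransf v - mp_stieltjes lam t| <=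
  (`|p%:R / m%:R - lam| + (eta / 2 + p%:R^-1)) +
  (2 * eta * p%:R ^+ 2 * m%:R)^-1 * \sum_k qdev k v ^+ 2.
Proof.
have pp : 0 < p%:R :> R by rewrite ltr0n.
have mm : 0 < m%:R :> R by rewrite ltr0n.
set s := stransf v; have /andP[s0 s1] : 0 <= s <= 1 := stransf_bound v.
set ln := p%:R / m%:R; have ln0 : 0 <= ln by rewrite divr_ge0.
apply: le_trans (stable_root lam0 t1 s0 (mp_stieltjes_ge0 lam0 t0) (mp_stieltjes_eq lam0 t0)) _.
have -> : 1 - t * s - s / (1 + lam * s) =
  (1 - t * s - s / (1 + ln * s)) + (s / (1 + ln * s) - s / (1 + lam * s)) by ring.
apply: le_trans (ler_normD _ _) _; rewrite -[leRHS]addrA [leLHS]addrC; apply: lerD.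
  by apply: lip_param; rewrite ?s0 // ltW.
set tr := \tr (tres v).
have trE : tr = p%:R * s by rewrite /s /stransf mulrA mulfV ?mul1r // lt0r_neq0.
have tr0 : 0 <= tr by rewrite trE mulr_ge0.
pose q k := quadf (lres k v) (col k (tmx v)).
have q0 k : 0 <= q k by apply: quadf_resolvent_ge0 => //; exact: psdmx_gram_without.
(* As c tr = ln s, the m equal terms c tr/(1 + c tr) add up to p s/(1 + ln s). *)
have sc : p%:R * (1 - t * s - s / (1 + ln * s)) =
    \sum_k (c * q k / (1 + c * q k) - c * tr / (1 + c * tr)).
  rewrite sumrB -(resolvent_self_consistent (tmx v) c0 t0) -/(tres v) -/tr sumr_const card_ord.
  rewrite trE -mulr_natl /c /ln; field.
  have : 0 < m%:R + p%:R * s by rewrite ltr_wpDr // mulr_ge0.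
  by move=> h; rewrite !lt0r_neq0.
have bound : p%:R * `|1 - t * s - s / (1 + ln * s)| <=
    \sum_k (c * (qdev k v ^+ 2 / (2 * eta * p%:R) + eta * p%:R / 2 + 1)).
  have -> : p%:R * `|1 - t * s - s / (1 + ln * s)| =
      `|p%:R * (1 - t * s - s / (1 + ln * s))| by rewrite normrM (ger0_norm (ltW pp)).
  rewrite sc; apply: le_trans (ler_norm_sum _ _ _) _; apply: ler_sum => k _.
  apply: le_trans (lip_ratio _ _) _; rewrite ?mulr_ge0 //.
  rewrite -mulrBr normrM (ger0_norm c0) ler_wpM2l //.
  have -> : q k - tr = qdev k v + (\tr (lres k v) - tr) by rewrite /qdev -/(q k); ring.
  rewrite (le_trans (ler_normD _ _)) // lerD //; last first.
    have /andP[h1 h2] := tr_resolvent_leave_one_out (tmx v) c0 t0 k.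
    by rewrite ger0_norm // (le_trans h2) // invf_le1.
  set z := qdev k v; have ep : 0 < 2 * eta * p%:R by rewrite !mulr_gt0.
  have -> : z ^+ 2 / (2 * eta * p%:R) + eta * p%:R / 2 =
      (`|z| ^+ 2 + (eta * p%:R) ^+ 2) / (2 * eta * p%:R).
    by rewrite real_normK ?num_real //; field; rewrite !lt0r_neq0.
  rewrite ler_pdivlMr //.
  have := sqr_ge0 (`|z| - eta * p%:R); rewrite sqrrB.
  have -> : `|z| * (2 * eta * p%:R) = (`|z| * (eta * p%:R)) *+ 2 by rewrite -mulr_natr; ring.
  lra.
rewrite -(ler_pM2l pp) (le_trans bound) // le_eqVlt; apply/orP; left; apply/eqP.
have sumE (x : R) : \sum_(k < m) x = m%:R * x by rewrite sumr_const card_ord mulr_natl.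
rewrite -mulr_sumr !big_split /= -mulr_suml !sumE /c.
move: (\sum_k _) => z; by field; rewrite !lt0r_neq0.
Qed.

Lemma stransf_mean : `|\int[P]_w stransf (X ^~ w) - mp_stieltjes lam t| <=
  `|p%:R / m%:R - lam| + (eta / 2 + p%:R^-1) + tensor_eps n K d y / (2 * eta).
Proof.
have pp : 0 < p%:R :> R by rewrite ltr0n.
have mm : 0 < m%:R :> R by rewrite ltr0n.
have is_ : P.-integrable setT (EFin \o (fun w => stransf (X ^~ w))).
  apply: (@integrable_bounded _ _ _ _ _ 1) => [|w]; first exact: mfunctional_stransf mX.
  by have /andP[? ?] := stransf_bound (X ^~ w); rewrite ger0_norm.
have ic := integrableE_cst P (mp_stieltjes lam t).
have isc : P.-integrable setT (EFin \o (fun w => stransf (X ^~ w) - mp_stieltjes lam t)).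
  exact: integrableE_B.
rewrite -[X in _ - X](Rintegral_cst1 P) -RintegralB //.
apply: le_trans (le_normr_Rintegral _ isc) _ => //.
set a := _ + (eta / 2 + _); set b := (2 * eta * p%:R ^+ 2 * m%:R)^-1.
have b0 : 0 <= b by rewrite invr_ge0 !mulr_ge0 ?sqr_ge0 // ltW.
have isum : P.-integrable setT (EFin \o (fun w => \sum_k qdev k (X ^~ w) ^+ 2)).
  by apply: integrableE_sum => k _; exact: integrable_qdev2.
apply: le_trans (_ : \int[P]_w (a + b * \sum_k qdev k (X ^~ w) ^+ 2) <= _).
  apply: le_Rintegral => //.
  - exact: integrable_norm.
  - by apply: integrableE_D; [exact: integrableE_cst|exact: integrableE_Z].
  - by move=> w _; exact: stransf_pointwise.
rewrite RintegralD //; [|exact: integrableE_cst|exact: integrableE_Z].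
rewrite Rintegral_cst1 RintegralZl // Rintegral_sum; last by move=> k _; exact: integrable_qdev2.
rewrite lerD2l.
have hk k : \int[P]_w qdev k (X ^~ w) ^+ 2 <= p%:R ^+ 2 * tensor_eps n K d y.
  by rewrite -lee_fin EFin_Rintegral; [exact: qdev_variance|exact: integrable_qdev2].
apply: le_trans (ler_wpM2l b0 (ler_sum _ (fun k _ => hk k))) _.
rewrite sumr_const card_ord -[_ *+ m]mulr_natl /b le_eqVlt; apply/orP; left; apply/eqP.
by field; rewrite !lt0r_neq0.
Qed.

End TensorGram.

Lemma sum_inv_pronic (R : realType) k :
  \sum_(0 <= i < k) (i.+1%:R * i.+2%:R)^-1 = 1 - k.+1%:R^-1 :> R.
Proof.
elim: k => [|k IH]; first by rewrite big_nil invr1 subrr.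
rewrite big_nat_recr //= IH -!natr1.
have : 0 <= k%:R :> R by []; move: (k%:R : R) => a a0.
by field; rewrite !lt0r_neq0 //; lra.
Qed.

(** * Almost sure convergence *)

Section AlmostSureConvergence.
Variables (R : realType) (dT : measure_display) (T : measurableType dT).
Variable P : probability T R.

(** The bounds telescope, so the series of fourth powers has finite expectation; it is finite almost
    surely, and its terms tend to 0. *)
Lemma ae_cvg0_of_4th_moments (g : nat -> T -> R) (K : R) : 0 <= K ->
  (forall n, measurable_fun setT (g n)) ->
  (\forall n \near \oo, (\int[P]_w (g n w ^+ 4)%:E <= (K / (n.+1%:R * n.+2%:R))%:E)%E) ->
  {ae P, forall w, g n w @[n --> \oo] --> (0 : R)}.
Proof.
move=> K0 mg [N _ gN].
pose h k w := g (k + N)%N w.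
have pow4_ge0 (a : R) : 0 <= a ^+ 4 by rewrite -[4%N]/(2 * 2)%N exprM sqr_ge0.
have mh4 k : measurable_fun setT (fun w => (h k w ^+ 4)%:E).
  by apply/measurable_EFinP; apply: measurable_funX; exact: mg.
pose F w := (\sum_(0 <= k <oo) (h k w ^+ 4)%:E)%E.
have h0 k w : setT w -> (0 <= (h k w ^+ 4)%:E)%E by rewrite lee_fin pow4_ge0.
have mF : measurable_fun setT F.
  by apply: ge0_emeasurable_sum => k; [move=> w _ _; exact: h0|].
have F0 w : (0 <= F w)%E by apply: nneseries_ge0 => k _ _; exact: h0.
have iF : P.-integrable setT F.
  apply/integrableP; split => //.
  under eq_integral do rewrite gee0_abs //.
  rewrite integral_nneseries //.
  apply: (@le_lt_trans _ _ K%:E); last exact: ltry.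
  apply: lime_le.
    by apply: is_cvg_nneseries => k _ _; apply: integral_ge0 => w _; exact: h0.
  near=> k.
  apply: le_trans (_ : \sum_(0 <= i < k) (K * (i.+1%:R * i.+2%:R)^-1)%:E <= _)%E.
    apply: lee_sum => i _; apply: le_trans (gN (i + N)%N _) _; first by rewrite /= leq_addl.
    rewrite lee_fin ler_wpM2l // lef_pV2 ?posrE ?mulr_gt0 // -!natrM ler_nat.
    by rewrite leq_mul // ltnS leq_addr.
  by rewrite sumEFin lee_fin -mulr_sumr sum_inv_pronic ler_piMr.
apply: filterS (integrable_ae measurableT iF) => w /(_ Logic.I) Fw.
rewrite -(cvg_shiftn N).
pose u k := h k w ^+ 4.
have cu : cvgn (series u).
  apply: nondecreasing_is_cvgn; first by apply: nondecreasing_series => k _ _; exact: pow4_ge0.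
  exists (fine (F w)) => _ [k _ <-]; rewrite -lee_fin fineK // /series /= -sumEFin.
  by apply: (@nneseries_lim_ge R (fun i => (u i)%:E) xpredT) => i _ _; exact: h0.
have /cvgrPdist_lt c0 := cvg_series_cvg_0 cu.
apply/cvgrPdist_lt => e e0; have e4 : 0 < e ^+ 4 by rewrite exprn_gt0.
apply: filterS (c0 _ e4) => k; rewrite !sub0r !normrN /u normrX.
by rewrite ltr_pXn2r ?nnegrE // ltW.
Unshelve. all: by end_near.
Qed.

End AlmostSureConvergence.

(** By Pascal's rule p >= n - d + 1. With d <= n/2 this makes p at least linear in n, enough for the
    series of 1/p^2 to converge. *)
Lemma bin_lower_bound n d : (0 < d <= n)%N -> (n - d < 'C(n, d))%N.
Proof.
elim: n d => [|n IH] [|d] //= dn; rewrite binS subSS.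
have [->|lt] := eqVneq d n; first by rewrite subnn binn addn1.
have dn' : (d < n)%N by rewrite ltn_neqAle lt.
have := IH d.+1 dn'; have : (0 < 'C(n, d))%N by rewrite bin_gt0 ltnW.
by rewrite subnS; case: (n - d)%N => [|k] /=; lia.
Qed.

Lemma Rintegral_expectation (R : realType) (dT : measure_display) (T : measurableType dT)
  (P : probability T R) (g : T -> R) : \int[P]_w g w = fine 'E_P[g].
Proof. by rewrite unlock. Qed.

Lemma natr_card_pred (R : pzRingType) (I : finType) (Q : pred I) :
  #|Q|%:R = \sum_i (Q i)%:R :> R.
Proof.
by rewrite -sum1_card natr_sum big_mkcond /=; apply: eq_bigr => i _; rewrite unfold_in; case: (Q i).
Qed.

Lemma card_dsubsets_lower (R : realType) (d : nat -> nat) :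
  (forall n, (0 < d n)%N) ->
  (fun n : nat => (d n)%:R / (n%:R `^ (3%:R^-1))) @ \oo --> (0 : R) ->
  \forall n \near \oo, (d n < n)%N /\ (n.+2 <= 2 * #|dsubsets n (d n)|)%N.
Proof.
move=> d0 dcvg; apply: filterS2 (nbhs_infty_gt 0) (d_half d0 dcvg) => n n0 dn.
have dn' : (0 < d n <= n)%N by rewrite d0 /=; lia.
have := bin_lower_bound dn'; rewrite -card_dsubsets; lia.
Qed.

Section StieltjesConvergence.
Variables (R : realType) (dT : measure_display) (T : measurableType dT).
Variables (P : probability T R) (d m : nat -> nat) (lam K : R).
Variable X : forall n : nat, 'I_(m n) * 'I_n -> T -> R.
Hypothesis d0 : forall n, (0 < d n)%N.
Hypothesis dcvg : (fun n : nat => (d n)%:R / (n%:R `^ (3%:R^-1))) @ \oo --> (0 : R).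
Hypothesis m0 : forall n, (0 < m n)%N.
Hypothesis lam0 : 0 < lam.
Hypothesis pcvg : (fun n : nat => ('C(n, d n))%:R / (m n)%:R) @ \oo --> lam.
Hypothesis mX : forall n i, measurable_fun setT (@X n i).
Hypothesis indX : forall n, mutually_independent P (@X n).
Hypothesis i4 : forall n i, P.-integrable setT (EFin \o (fun w => @X n i w ^+ 4)).
Hypothesis e1 : forall n i, \int[P]_w @X n i w = 0.
Hypothesis e2 : forall n i, \int[P]_w (@X n i w ^+ 2) = 1.
Hypothesis e4 : forall n i, \int[P]_w (@X n i w ^+ 4) <= K.
Hypothesis K1 : 1 <= K.
Variable t : R.
Hypothesis t1 : 1 <= t.

Let st n w : R := @stransf R n (d n) (m n) t (@X n ^~ w).
Let p n : nat := #|dsubsets n (d n)|.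

Lemma st_mean_cvg : \int[P]_w st n w @[n --> \oo] --> mp_stieltjes lam t.
Proof.
apply/cvgrPdist_le => e e0.
(* The budget, with eta = e: e/8 for the ratio p/m, e/2 from eta, 2e/8 for 1/p, and e/8 for the
   variance term. The latter is divided by 2e, hence the threshold e (e/8) on [tensor_eps]. *)
have e8 : 0 < e / 8 by rewrite divr_gt0.
have ee : 0 < e * (e / 8) by rewrite mulr_gt0.
have /cvgrPdist_le/(_ _ e8) c1 := pcvg.
have /cvgrPdist_le/(_ _ ee) c2 := tensor_eps_cvg0 K1 d0 dcvg.
have ni : (n.+1%:R^-1 : R) @[n --> \oo] --> (0 : R) := cvg_harmonic.
have /cvgrPdist_le/(_ _ e8) c3 := ni.
near=> n.
have [dn pn] : (d n < n)%N /\ (n.+2 <= 2 * p n)%N.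
  by near: n; exact: card_dsubsets_lower d0 dcvg.
have sm : 2 * ysq R d n + K * ysq R d n ^+ 2 <= 1 by near: n; exact: ysq_small.
have p0 : (0 < p n)%N by lia.
have yq : ysq R d n ^+ 2 = dratio R n (d n).
  by rewrite sqr_sqrtr // divr_ge0.
have := stransf_mean t1 (m0 n) (@mX n) (indX (n := n)) (@i4 n) (@e1 n) (@e2 n) (@e4 n) K1 dn
  (sqrtr_ge0 _) yq sm (tensor_eps_ge0 K1 dn) lam0 e0 p0.
rewrite distrC -/(p n) => h; apply: le_trans h _.
have h1 : `|(p n)%:R / (m n)%:R - lam| <= e / 8.
  by rewrite distrC /p card_dsubsets; near: n.
have h2 : tensor_eps n K (d n) (ysq R d n) / (2 * e) <= e / 8.
  rewrite ler_pdivrMr ?mulr_gt0 //.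
  have : `|0 - tensor_eps n K (d n) (ysq R d n)| <= e * (e / 8) by near: n.
  rewrite sub0r normrN => /(le_trans (ler_norm _)) h; apply: le_trans h _.
  by have := mulr_gt0 e0 e0; lra.
have h3 : (p n)%:R^-1 <= 2 * (e / 8).
  have : `|0 - (n.+1%:R^-1 : R)| <= e / 8 by near: n.
  rewrite sub0r normrN ger0_norm ?invr_ge0 // => h.
  have hp : (p n)%:R^-1 <= 2 / n.+1%:R :> R.
    rewrite ler_pdivlMr ?ltr0n // ler_pdivrMl ?ltr0n // -natrM ler_nat.
    by lia.
  by apply: le_trans hp _; rewrite ler_wpM2l.
by move: h1 h2 h3; move: `|_| (tensor_eps _ _ _ _ / _) ((p n)%:R^-1) => a b q; lra.
Unshelve. all: by end_near.
Qed.

Lemma st_ae_cvg : {ae P, forall w, st n w @[n --> \oo] --> mp_stieltjes lam t}.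
Proof.
pose g n w := st n w - \int[P]_w st n w.
have mst n : measurable_fun setT (st n).
  have mf : mfunctional (@stransf R n (d n) (m n) t) by exact: mfunctional_stransf.
  exact: (mf _ _ (@X n) (@mX n)).
have ratio : \forall n \near \oo, (m n)%:R / (p n)%:R <= lam^-1 + 1 :> R.
  have c : (('C(n, d n))%:R / (m n)%:R)^-1 @[n --> \oo] --> lam^-1.
    by apply: cvgV => //; exact: lt0r_neq0.
  have /cvgrPdist_le/(_ _ ltr01) := c; apply: filterS => n.
  rewrite distrC invf_div -card_dsubsets -/(p n) => /(le_trans (ler_norm _)).
  by rewrite lerBlDr addrC.
(* The outer 4 comes from 2p >= n + 2, which gives 1/p^2 <= 4/((n + 1)(n + 2)); the exponent bounds
   m/p, whose limit is 1/lam. *)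
pose C : R := 4 * (2 * 4 ^+ 4 * 4 ^+ 2 * expR (lam^-1 + 1)).
have C0 : 0 <= C by rewrite /C !mulr_ge0 ?exprn_ge0 ?expR_ge0.
have ae0 : {ae P, forall w, g n w @[n --> \oo] --> (0 : R)}.
  apply: (ae_cvg0_of_4th_moments C0) => [n|]; first exact: measurable_funB.
  near=> n.
  have [dn pn] : (d n < n)%N /\ (n.+2 <= 2 * p n)%N.
    by near: n; exact: card_dsubsets_lower d0 dcvg.
  have p0 : (0 < p n)%N by lia.
  have rn : (m n)%:R / (p n)%:R <= lam^-1 + 1 :> R by near: n.
  have := stransf_4th_moment t1 (@mX n) (indX (n := n)) p0.
  move=> h; apply: le_trans h _; rewrite lee_fin -/(p n) /C.
  have p2 : ((p n)%:R ^+ 2)^-1 <= 4 / (n.+1%:R * n.+2%:R) :> R.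
    rewrite ler_pdivlMr ?mulr_gt0 ?ltr0n // ler_pdivrMl ?exprn_gt0 ?ltr0n //.
    by rewrite -natrX -!natrM ler_nat; nia.
  set k := 2 * 4 ^+ 4 * 4 ^+ 2; have k0 : 0 <= k by rewrite /k !mulr_ge0 ?exprn_ge0.
  have -> : 4 * (k * expR (lam^-1 + 1)) / (n.+1%:R * n.+2%:R) =
    k * expR (lam^-1 + 1) * (4 / (n.+1%:R * n.+2%:R)) by rewrite [4 * (_ * _)]mulrC -[_ * 4 * _]mulrA.
  apply: ler_pM => //; first by rewrite mulr_ge0 ?expR_ge0.
  by rewrite ler_wpM2l // ler_expR.
apply: filterS ae0 => w gw.
have -> : (fun n => st n w) = fun n => g n w + \int[P]_w st n w.
  by apply/funext => n; rewrite /g subrK.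
by rewrite -[mp_stieltjes lam t]add0r; exact: cvgD gw st_mean_cvg.
Unshelve. all: by end_near.
Qed.

End StieltjesConvergence.

Theorem theorem1p4 (R : realType) (dT : measure_display) (T : measurableType dT)
  (P : probability T R) (d m : nat -> nat) (lam : R)
  (x : forall n : nat, 'I_(m n) -> 'I_n -> {RV P >-> R}) :
  (forall n, (0 < d n)%N) ->
  (fun n : nat => (d n)%:R / (n%:R `^ (3%:R^-1))) @ \oo --> (0 : R) ->
  (forall n, (0 < m n)%N) ->
  0 < lam ->
  (fun n : nat => ('C(n, d n))%:R / (m n)%:R) @ \oo --> lam ->
  (forall n, mutually_independent P
     (fun ji : 'I_(m n) * 'I_n => (x n ji.1 ji.2 : T -> R))) ->
  (forall n j i, 'E_P[x n j i] = 0%E) ->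
  (forall n j i, 'E_P[fun w => (x n j i w ^+ 2)%R] = 1%E) ->
  (exists C : R, forall n j i, ('E_P[fun w => (x n j i w ^+ 4)%R] <= C%:E)%E) ->
  {ae P, forall w : T,
     cdf_weak_cvg
       (fun n => esd ((m n)%:R^-1 *:
           (tensor_mx (d n) (fun j i => x n j i w)
             *m (tensor_mx (d n) (fun j i => x n j i w))^T)))
       (mp_cdf lam)}.
Proof.
move=> d0 dcvg m0 lam0 pcvg indx Ex Ex2 [C Ex4].
pose X n (ji : 'I_(m n) * 'I_n) : T -> R := x n ji.1 ji.2.
(* The weights [mweight] require K >= 1, so the moment bound is enlarged if necessary. *)
pose K : R := Num.max 1 C.
have mX n i : measurable_fun setT (X n i) by exact: measurable_funPT.
have e1 n i : \int[P]_w X n i w = 0 by rewrite Rintegral_expectation Ex.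
have e2 n i : \int[P]_w (X n i w ^+ 2) = 1 by rewrite Rintegral_expectation Ex2.
have i4 n i : P.-integrable setT (EFin \o (fun w => X n i w ^+ 4)).
  apply/integrableP; split; first by apply/measurable_EFinP; exact: measurable_funX.
  under eq_integral => w _ do rewrite /= ger0_norm -?[4%N]/(2 * 2)%N ?exprM ?sqr_ge0 //.
  have := Ex4 n i.1 i.2; rewrite unlock => h.
  apply: le_lt_trans (ltry C); apply: le_trans h; rewrite le_eqVlt; apply/orP; left.
  by apply/eqP; apply: eq_integral => w _; rewrite -exprM.
have e4 n i : \int[P]_w (X n i w ^+ 4) <= K.
  rewrite /K le_max -lee_fin -[in X in _ || X]lee_fin orbC EFin_Rintegral //.
  by have := Ex4 n i.1 i.2; rewrite unlock => ->.
have K1 : 1 <= K by rewrite /K le_max lexx.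
have stc k := st_ae_cvg d0 dcvg m0 lam0 pcvg mX indx i4 e1 e2 e4 K1 (node_ge1 R k).
(* A countable intersection over the nodes, taken before tau is introduced: one null set serves
   every tau. *)
apply: filterS (ae_foralln stc) => w cw tau ctau.
pose W n := (m n)%:R^-1 *: (tensor_mx (d n) (fun j i => x n j i w)
             *m (tensor_mx (d n) (fun j i => x n j i w))^T).
have psdW n : psdmx (W n) by apply: psdmx_gram; rewrite invr_ge0.
(* Eigenvalues are selected at the fixed w; the probabilistic part involved only traces of
   resolvents, which are measurable functionals. *)
pose rt n := projT1 (cid (psdmx_spectrum (psdW n))).
have rtP n := projT2 (cid (psdmx_spectrum (psdW n))).
have p0 : \forall n \near \oo, (0 < #|dsubsets n (d n)|)%N.
  by apply: filterS (card_dsubsets_lower d0 dcvg) => n []; case: #|_|.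
have esdE n t : esd (W n) t = emp_cdf rt n t.
  rewrite /esd /emp_cdf /emp_mean mulrC; congr (_ * _).
  have [cW _ _] := rtP n; rewrite (eig_count_prod _ cW).
  exact: natr_card_pred.
have -> : (fun n => esd (W n) tau) = fun n => emp_cdf rt n tau.
  by apply/funext => n; rewrite esdE.
apply: weak_convergence => //.
- by move=> n i; have [_ r0 _] := rtP n; exact: r0.
- move=> k; rewrite /mp_conv mpL_stieltjes //; last exact: lt_le_trans (node_ge1 R k).
  apply: cvg_trans (cw k); rewrite (_ : (fun n => emp_mean rt n _) =
    fun n => stransf (d n) (node R k) (X n ^~ w)) //.
  apply/funext => n; rewrite /emp_mean /stransf; congr (_ * _).
  have [_ _ tW] := rtP n; rewrite /tres -[RHS]/(\tr (resolvent (node R k) (W n))) tW //.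
  exact: lt_le_trans (node_ge1 R k).
Qed.
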